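(* Let $K$ be a $p$-adic field and let $\boldsymbol{f}=(f_1,\ldots,f_l):U\to K^l$ be a $K$-analytic mapping defined on a compact open neighborhood $U\subset K^n$ of the origin such that $\boldsymbol{f}(0)=0$ and the ideal $\mathcal{I}_{\boldsymbol{f}}=(f_1,\ldots,f_l)$ is not trivial. Let $\sigma:X_K\to U$ be a log-principalization of $\mathcal{I}_{\boldsymbol{f}}$ with numerical data $(N_i,v_i)$, $i\in T$, and let $$\lambda(\mathcal{I}_{\boldsymbol{f}})=\min_{i\in T}\frac{v_i}{N_i}.$$ Then $-\lambda(\mathcal{I}_{\boldsymbol{f}})$ is the real part of a pole of (the meromorphic continuation of) $$Z_U(s,\boldsymbol{f})=\int_U\|\boldsymbol{f}(x)\|_K^s\,|dx|.$$ In particular, $\lambda(\mathcal{I}_{\boldsymbol{f}})$ depends only on $\mathcal{I}_{\boldsymbol{f}}$ (and not on the choice of the log-principalization $\sigma$).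
   Context: $K$ is a finite extension of $\mathbb{Q}_p$, with valuation ring $R_K$ and residue field of cardinality $q$; $|z|_K=q^{-\mathrm{ord}(z)}$ and $\|(z_1,\ldots,z_l)\|_K=\max_i|z_i|_K$. $|dx|$ is the Haar measure on $K^n$ for which $R_K^n$ has measure $1$. The integral $Z_U(s,\boldsymbol{f})$ converges for $\operatorname{Re}(s)>0$ and continues meromorphically to $\mathbb{C}$ as a rational function of $q^{-s}$. ''$\mathcal{I}_{\boldsymbol{f}}$ is not trivial'' is the assumption guaranteeing (by a known theorem) that a log-principalization exists; in particular $f_1,\ldots,f_l$ do not all vanish identically on a nonempty open subset of $U$. Log-principalization: let $Z_K\subset U$ be the common zero set of $f_1,\ldots,f_l$. A log-principalization of $\mathcal{I}_{\boldsymbol{f}}$ is a map $\sigma:X_K\to U$ such that: (1) $X_K$ is an $n$-dimensional $K$-analytic manifold and $\sigma$ is a proper $K$-analytic map which is a composition of finitely many blow-ups in closed submanifolds and which is an isomorphism outside $Z_K$; (2) $\sigma^{-1}(Z_K)=\bigcup_{i\in T}E_i$, where the $E_i$ are (nonempty) closed submanifolds of $X_K$ of codimension one, each equipped with a pair of positive integers $(N_i,v_i)$, such that at every $b\in X_K$ there are local coordinates $(y_1,\ldots,y_n)$ around $b$ for which, if $E_1,\ldots,E_p$ are the $E_i$ containing $b$, on some neighborhood of $b$: $E_i$ is given by $y_i=0$ for $i=1,\ldots,p$; the ideal $\sigma^*(\mathcal{I}_{\boldsymbol{f}})$ generated by the $f_j\circ\sigma$ is generated by $\varepsilon(y)\prod_{i=1}^p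 y_i^{N_i}$; and $\sigma^*(dx_1\wedge\cdots\wedge dx_n)=\eta(y)\left(\prod_{i=1}^p y_i^{v_i-1}\right)dy_1\wedge\cdots\wedge dy_n$, where $\varepsilon,\eta$ are units in the local ring of $X_K$ at $b$. The pairs $(N_i,v_i)$, $i\in T$, are the numerical data of $\sigma$. *)

(* Defs.v *)
From HB Require Import structures.
From mathcomp Require Import all_boot all_order all_algebra.
From mathcomp Require Import complex.
From mathcomp Require Import all_classical all_reals all_analysis.

Set Implicit Arguments.
Unset Strict Implicit.
Unset Printing Implicit Defensive.

Import Order.TTheory GRing.Theory Num.Theory.
Import numFieldNormedType.Exports.

Local Open Scope classical_set_scope.
Local Open Scope ring_scope.

(* |z| = q^(- ord z), with ord 0 = +oo; the value of [ord] at 0 is not used. *)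
Definition abs_of_ord (R : realType) (K : fieldType) (ord : K -> int) (q : nat)
    (z : K) : R :=
  if z == 0 then 0 else (q%:R : R) ^ (- ord z).

(* A finite extension of Q_p, with its normalized valuation.  Q_p is the
   completion of Q for the p-adic absolute value; inside a complete field of
   characteristic 0 whose valuation is positive at p, it is the closure of the
   image of Q.  In [residue_card], the r i represent each class of
   R_K / m_K exactly once. *)
HB.mixin Record Field_isPadic (R : realType) K
    & GRing.Field K & Uniform K := {
  ordv : K -> int;
  resq : nat;
  ordvM : forall x y : K, x != 0 -> y != 0 -> ordv (x * y) = ordv x + ordv y;
  ordvD : forall x y : K, x != 0 -> y != 0 -> x + y != 0 ->
    Num.min (ordv x) (ordv y) <= ordv (x + y);
  ordv_uniformizer : exists2 x : K, x != 0 & ordv x = 1;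
  entourage_abs_of_ord : entourage =
    entourage_ (fun (x : K) (e : R) y => abs_of_ord R ordv resq (x - y) < e);
  padic_complete : forall F : set_system K, ProperFilter F -> cauchy F ->
    exists x : K, F --> x;
  residue_card : exists r : 'I_resq -> K,
    (forall i, abs_of_ord R ordv resq (r i) <= 1) /\
    (forall x : K, abs_of_ord R ordv resq x <= 1 ->
       exists! i, abs_of_ord R ordv resq (x - r i) < 1);
  padic_char0 : [pchar K] =i pred0;
  padic_prime : exists2 p : nat, prime p & abs_of_ord R ordv resq (p%:R : K) < 1;
  padic_finite : exists (m : nat) (b : 'I_m -> K), forall x : K,
    exists c : 'I_m -> K,
      (forall i, closure (range (ratr : rat -> K)) (c i)) /\
      x = \sum_i c i * b i
}.

#[short(type="padicFieldType")]
HB.structure Definition PadicField (R : realType) :=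
  {K of Field_isPadic R K & GRing.Field K & Uniform K}.

Section PadicAnalysis.
Context {R : realType} {K : padicFieldType R}.

Definition absK (z : K) : R := abs_of_ord R ordv (@resq R K) z.

Definition normK n (z : 'rV[K]_n) : R := \big[Num.max/0]_(i < n) absK (z 0 i).

Definition monomial n (z : 'rV[K]_n) (a : {ffun 'I_n -> nat}) : K :=
  \prod_(i < n) z 0 i ^+ a i.

(* The bound on the coefficients is the convergence of the power series on the
   polydisc of radius r; under it the sums over the boxes [0, N)^n converge to
   the sum of the (unconditionally summable) series. *)
Definition analytic_at n (g : 'rV[K]_n -> K) (a : 'rV[K]_n) : Prop :=
  exists (c : {ffun 'I_n -> nat} -> K) (r M : R),
    [/\ 0 < r,
        forall k : {ffun 'I_n -> nat}, absK (c k) * r ^+ (\sum_i k i)%N <= M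
      & forall z : 'rV[K]_n, normK z < r ->
          (fun N : nat => \sum_(k : {ffun 'I_n -> 'I_N})
             (let k' := [ffun i => val (k i)] in c k' * monomial z k'))
          @ \oo --> g (a + z)].

Definition analytic_map_at n m (g : 'rV[K]_n -> 'rV[K]_m) (a : 'rV[K]_n) :=
  forall j, analytic_at (fun x => g x 0 j) a.

Definition analytic_map_on n m (U : set 'rV[K]_n) (g : 'rV[K]_n -> 'rV[K]_m) :=
  forall a, U a -> analytic_map_at g a.

(* The ideal generated by the components of f in the ring of K-analytic
   functions on U (functions are total and only their values on U matter). *)
Definition ideal_on n l (U : set 'rV[K]_n) (f : 'rV[K]_n -> 'rV[K]_l) :
    set ('rV[K]_n -> K) :=
  [set h | exists a : 'I_l -> 'rV[K]_n -> K,
     (forall j x, U x -> analytic_at (a j) x) /\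
     (forall x, U x -> h x = \sum_j a j x * f x 0 j)].

(* J is the matrix of the differential of g at a, acting on row vectors. *)
Definition is_jacobian n m (g : 'rV[K]_n -> 'rV[K]_m) (a : 'rV[K]_n)
    (J : 'M[K]_(n, m)) : Prop :=
  forall e : R, 0 < e -> exists2 d : R, 0 < d &
    forall h : 'rV[K]_n, normK h < d ->
      normK (g (a + h) - g a - h *m J) <= e * normK h.

(* A space with a family of K^n-valued maps, each meant to be used on a given
   subset; it is a manifold when [is_manifold] holds. *)
Record charted_space (n : nat) := ChartedSpace {
  carrier :> topologicalType;
  atlas : set (set carrier * (carrier -> 'rV[K]_n))
}.

Section Charts.
Context {n : nat}.
Implicit Types X Y : charted_space n.

(* y restricts to a homeomorphism of the open set V onto an open set. *)
Definition is_chart (X : topologicalType) (V : set X) (y : X -> 'rV[K]_n) :=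
  [/\ open V,
      forall x x', V x -> V x' -> y x = y x' -> x = x',
      forall x, V x -> {for x, continuous y}
    & forall A, open A -> A `<=` V -> open (y @` A)].

Definition analytic_transition (X : topologicalType)
    (V V' : set X) (y y' : X -> 'rV[K]_n) :=
  forall x, V x -> V' x -> exists2 g : 'rV[K]_n -> 'rV[K]_n,
    analytic_map_at g (y x) & \forall x' \near x, y' x' = g (y x').

Definition is_manifold X : Prop :=
  [/\ hausdorff_space X,
      forall x : X, exists c, atlas c /\ c.1 x,
      forall c : set X * (X -> 'rV[K]_n), atlas c -> is_chart c.1 c.2
    & forall c d : set X * (X -> 'rV[K]_n), atlas c -> atlas d ->
        analytic_transition c.1 d.1 c.2 d.2].

Definition open_manifold (U : set 'rV[K]_n) : charted_space n :=
  @ChartedSpace n (set_type U) [set (setT, set_val)].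

(* (V, y) belongs to the maximal atlas of X. *)
Definition local_coordinates X (V : set X) (y : X -> 'rV[K]_n) : Prop :=
  is_chart V y /\
  forall c : set X * (X -> 'rV[K]_n), atlas c ->
    analytic_transition V c.1 y c.2 /\ analytic_transition c.1 V c.2 y.

Definition mfd_analytic_at X (h : X -> K) (b : X) : Prop :=
  forall c : set X * (X -> 'rV[K]_n), atlas c -> c.1 b ->
    exists2 g, analytic_at g (c.2 b) & \forall x \near b, h x = g (c.2 x).

Definition mfd_analytic_map_at X Y (h : X -> Y) (b : X) : Prop :=
  forall (c : set X * (X -> 'rV[K]_n)) (d : set Y * (Y -> 'rV[K]_n)),
    atlas c -> c.1 b -> atlas d -> d.1 (h b) ->
    (\forall x \near b, d.1 (h x)) /\
    exists2 g, analytic_map_at g (c.2 b) &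
      \forall x \near b, d.2 (h x) = g (c.2 x).

Definition analytic_iso_on X Y (A : set X) (B : set Y) (h : X -> Y) : Prop :=
  exists k : Y -> X,
    [/\ forall x, A x -> B (h x) /\ k (h x) = x,
        forall y, B y -> A (k y) /\ h (k y) = y,
        forall x, A x -> mfd_analytic_map_at h x
      & forall y, B y -> mfd_analytic_map_at k y].

Definition adapted X (C : set X) (r : nat) (V : set X) (y : X -> 'rV[K]_n) :=
  local_coordinates V y /\
  forall x, V x -> (C x <-> forall i : 'I_n, (i < r)%N -> y x 0 i = 0).

(* The codimension is positive and may vary from point to point. *)
Definition closed_submanifold X (C : set X) : Prop :=
  closed C /\
  forall b, C b -> exists (r : nat) (V : set X) (y : X -> 'rV[K]_n),
    [/\ (0 < r <= n)%N, V b & adapted C r V y].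

Definition closed_hypersurface X (C : set X) : Prop :=
  closed C /\
  forall b, C b -> exists (V : set X) (y : X -> 'rV[K]_n),
    [/\ (0 < n)%N, V b & adapted C 1 V y].

(* The blow-up of K^n along {x_0 = ... = x_(r-1) = 0} is
     {(x, [u]) in K^n * P^(r-1) | x_i u_j = x_j u_i for i, j < r}.
   On the part u_i <> 0 (i < r) it has the coordinates z with z_i = x_i,
   z_j = u_j / u_i for j < r, j <> i, and z_j = x_j for j >= r.
   [blowup_base] and [blowup_dir] are x and u (extended by 0) as functions of z,
   with u normalized by u_i = 1. *)
Definition blowup_base (r : nat) (i : 'I_n) (z : 'rV[K]_n) : 'rV[K]_n :=
  \row_j (if (j < r)%N && (j != i) then z 0 i * z 0 j else z 0 j).

Definition blowup_dir (r : nat) (i : 'I_n) (z : 'rV[K]_n) : 'rV[K]_n :=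
  \row_j (if j == i then 1 else if (j < r)%N then z 0 j else 0).

Definition same_blowup_point (r : nat) (i j : 'I_n) (z z' : 'rV[K]_n) : Prop :=
  blowup_base r i z = blowup_base r j z' /\
  exists2 c : K, c != 0 & blowup_dir r i z = c *: blowup_dir r j z'.

(* h : X -> Y is, up to isomorphism over Y, the blow-up of Y in C: over a
   coordinate neighborhood V of a point of C, the sets W i with the coordinates
   w i are the standard charts of the model above restricted to y(V). *)
Definition is_blowup X Y (C : set Y) (h : X -> Y) : Prop :=
  [/\ is_manifold X,
      closed_submanifold C,
      forall x, mfd_analytic_map_at h x,
      analytic_iso_on (h @^-1` (~` C)) (~` C) h
    & forall b, C b -> exists (r : nat) (V : set Y) (y : Y -> 'rV[K]_n)
          (W : 'I_n -> set X) (w : 'I_n -> X -> 'rV[K]_n),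
        [/\ [/\ (0 < r <= n)%N, V b & adapted C r V y],
            forall i : 'I_n, (i < r)%N ->
              [/\ local_coordinates (W i) (w i),
                  w i @` W i = [set z | (y @` V) (blowup_base r i z)]
                & forall x, W i x -> y (h x) = blowup_base r i (w i x)],
            h @^-1` V = \bigcup_(i in [set i : 'I_n | (i < r)%N]) W i
          & forall (i j : 'I_n) x x', (i < r)%N -> (j < r)%N ->
              W i x -> W j x' ->
              (x = x' <-> same_blowup_point r i j (w i x) (w j x'))]].

Inductive composition_of_blowups :
    forall X Y : charted_space n, (X -> Y) -> Prop :=
| Blowups_id (X : charted_space n) : @composition_of_blowups X X id
| Blowups_comp (X Y Z : charted_space n) (C : set Y) (h : X -> Y) (s : Y -> Z) :
    is_blowup C h -> composition_of_blowups s ->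
    composition_of_blowups (s \o h).

Definition zero_set l (U : set 'rV[K]_n) (f : 'rV[K]_n -> 'rV[K]_l) :
    set (open_manifold U) :=
  [set x | f (set_val x) = 0].
Arguments zero_set {l} U f.

Definition is_proper (X Y : topologicalType) (h : X -> Y) : Prop :=
  continuous h /\ forall A : set Y, compact A -> compact (h @^-1` A).

(* The conditions at b on the divisors E i and the numerical data (N i, v i).
   The coordinate attached to a divisor E i through b is the one of index
   [k i]: this is the usual y_1, ..., y_p up to a permutation. *)
Definition log_principal_at l (U : set 'rV[K]_n) (f : 'rV[K]_n -> 'rV[K]_l)
    (X : charted_space n) (sigma : X -> open_manifold U)
    (T : finType) (E : T -> set X) (N v : T -> nat) (b : X) : Prop :=
  exists (V : set X) (y : X -> 'rV[K]_n) (k : T -> 'I_n) (eps eta : X -> K),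
    let generator x := eps x * \prod_(i | `[< E i b >]) y x 0 (k i) ^+ N i in
    [/\ local_coordinates V y /\ V b,
        (forall i j, E i b -> E j b -> k i = k j -> i = j) /\
        (forall i, E i b -> forall x, V x -> (E i x <-> y x 0 (k i) = 0)),
        [/\ mfd_analytic_at eps b, eps b != 0,
            mfd_analytic_at eta b & eta b != 0],
        (* (f_1 o sigma, ..., f_l o sigma) = (generator) in the local ring *)
        (forall j, exists2 a, mfd_analytic_at a b &
           \forall x \near b, f (set_val (sigma x)) 0 j = a x * generator x) /\
        (exists2 c : 'I_l -> X -> K, (forall j, mfd_analytic_at (c j) b) &
           \forall x \near b,
             generator x = \sum_j c j x * f (set_val (sigma x)) 0 j)
      & (* sigma^* (dx_1 /\ ... /\ dx_n)
           = eta * prod y_i^(v_i - 1) dy_1 /\ ... /\ dy_n *)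
        exists2 g : 'rV[K]_n -> 'rV[K]_n, analytic_map_at g (y b) &
          \forall x \near b, set_val (sigma x) = g (y x) /\
            exists2 J, is_jacobian g (y x) J &
              \det J = eta x *
                \prod_(i | `[< E i b >]) y x 0 (k i) ^+ (v i).-1].

Definition log_principalization l (U : set 'rV[K]_n)
    (f : 'rV[K]_n -> 'rV[K]_l)
    (X : charted_space n) (sigma : X -> open_manifold U)
    (T : finType) (E : T -> set X) (N v : T -> nat) : Prop :=
  [/\ [/\ is_manifold X,
          forall x, mfd_analytic_map_at sigma x,
          is_proper sigma,
          composition_of_blowups sigma
        & analytic_iso_on (sigma @^-1` (~` zero_set U f)) (~` zero_set U f)
            sigma],
      sigma @^-1` zero_set U f = \bigcup_i E i,
      forall i, [/\ E i !=set0, closed_hypersurface (E i),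
                    (0 < N i)%N & (0 < v i)%N]
    & forall b, log_principal_at f sigma E N v b].

End Charts.

Definition is_lambda (T : finType) (N v : T -> nat) (lam : R) : Prop :=
  (exists i, lam = (v i)%:R / (N i)%:R) /\
  (forall i, lam <= (v i)%:R / (N i)%:R).

End PadicAnalysis.

Definition borelK (R : realType) (K : padicFieldType R) (n : nat) :=
  'rV[K]_n.

Section Borel.
Context {R : realType} (K : padicFieldType R) (n : nat).

HB.instance Definition _ := Choice.on (borelK K n).
HB.instance Definition _ := isPointed.Build (borelK K n) (0 : 'rV[K]_n).
HB.instance Definition _ :=
  Measurable.copy (borelK K n)
    (g_sigma_algebraType (@open 'rV[K]_n : set (set (borelK K n)))).

End Borel.

Definition normalized_haar (R : realType) (K : padicFieldType R) (n : nat)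
    (mu : {measure set (borelK K n) -> \bar R}) : Prop :=
  (forall (a : 'rV[K]_n) (A : set (borelK K n)), measurable A ->
     mu [set a + x | x in (A : set 'rV[K]_n)] = mu A) /\
  mu [set z : 'rV[K]_n | normK z <= 1] = 1%E.

(* t^s for t >= 0; in particular 0^s = 0 when Re s > 0. *)
Definition cpow (R : realType) (t : R) (s : R[i]) : R[i] :=
  Complex (t `^ complex.Re s * cos (complex.Im s * ln t))
          (t `^ complex.Re s * sin (complex.Im s * ln t)).

Definition zetaU (R : realType) (K : padicFieldType R) (n l : nat)
    (mu : {measure set (borelK K n) -> \bar R}) (U : set 'rV[K]_n)
    (f : 'rV[K]_n -> 'rV[K]_l) (s : R[i]) : R[i] :=
  Complex (\int[mu]_(x in U) complex.Re (cpow (normK (f x)) s))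
          (\int[mu]_(x in U) complex.Im (cpow (normK (f x)) s)).

Section Meromorphic.
Context {R : realType}.
Local Notation C := (R[i]^o).

Definition holomorphic_at (h : C -> C) (s0 : C) : Prop :=
  \forall s \near s0, derivable h s 1.

Definition meromorphic_at (M : C -> C) (s0 : C) : Prop :=
  exists (m : nat) (h : C -> C), holomorphic_at h s0 /\
    \forall s \near s0^', M s = h s / (s - s0) ^+ m.

Definition is_pole (M : C -> C) (s0 : C) : Prop :=
  exists (m : nat) (h : C -> C),
    [/\ (0 < m)%N, holomorphic_at h s0, h s0 != 0
      & \forall s \near s0^', M s = h s / (s - s0) ^+ m].

Definition meromorphic_continuation (Z M : C -> C) : Prop :=
  (forall s0, meromorphic_at M s0) /\
  (forall s, 0 < complex.Re s -> M s = Z s).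

End Meromorphic.

(* Main.v *)
Require Import Defs.
From mathcomp Require Import all_boot all_order all_algebra.
From mathcomp Require Import complex.
From mathcomp Require Import all_classical all_reals all_analysis.
From mathcomp Require Import ring lra zify.

Set Implicit Arguments.
Unset Strict Implicit.
Unset Printing Implicit Defensive.

Import Order.TTheory GRing.Theory Num.Theory.
Import numFieldNormedType.Exports.

Local Open Scope classical_set_scope.
Local Open Scope ring_scope.

(* On X_K the set {||f o sigma|| = q^(-m)} is cut into clopen pieces of charts on
   which ||f o sigma|| and the Jacobian of sigma are, in absolute value, monomials
   in the |y_i|.  On such a piece, multiplying y_i by a uniformizer shows that the
   volumes V_m of the images in U satisfy V_m = W_m + q^(-v_i) V_(m - N_i), where
   W_m is the contribution of the points with |y_i| maximal.  Hence, with
   t = q^(-s), the integral Z_U is up to a power of t a finite sum of terms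
     B t^k / prod_(i in I) (1 - q^(-v_i) t^(N_i)),   B > 0,
   and every i in T occurs in one of them.  At s = - lambda no denominator is
   singular except those with v_i / N_i = lambda, and the leading Laurent
   coefficients of all terms are positive, so that the poles cannot cancel.

   For the independence of sigma: the sums sum_m V_m x^m are bounded for
   1 < x < q^lambda and the V_m x^m are unbounded for x > q^lambda.  If f and g
   generate the same ideal, then ||f|| and ||g|| are bounded by multiples of each
   other on the compact set U, so that the two thresholds agree. *)

(** * The absolute value of K *)

(** All measuring is done in U: X_K carries no measure, and only the volumes of images of clopen
    subsets of X_K are compared. The obstacle is the change of variables along sigma, whose Jacobian
    is not constant in absolute value. It is avoided by comparing two images of one set under maps
    whose Jacobian determinants have a constant ratio of absolute values. For the scaling of y_i by
    a uniformizer this ratio is q^(-v_i): one factor 1/q comes from the scaling itself, v_i - 1 of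
    them from the monomial in the Jacobian of sigma. The positivity of B holds because sigma maps
    non-empty open sets on which f does not vanish to non-empty open sets. The leading coefficients
    are positive because - lambda is real: there each q^(-v_i) t^(N_i) is real, and at most 1 by the
    minimality of lambda. Independence is proved by growth because Z_U depends on the generators and
    not only on the ideal: two systems of generators have comparable norms but in general different
    integrals. The threshold for the growth of the V_m is insensitive to such a change, and it is
    governed by the same terms as the poles. *)

Lemma compact_finite_cover (X : topologicalType) (A : set X) (f : X -> set X) :
  compact A -> (forall x, A x -> nbhs x (f x)) ->
  exists s : seq X, {in s, forall x, A x} /\ A `<=` \bigcup_(x in [set` s]) f x.
Proof.
move=> cA fA; apply: contrapT => nocover.
(* If no finite family covers A, the parts of A missed by finite families form a proper filter base;
   a cluster point [p] is contradicted by the part missed by [f p]. *)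
pose G (s : seq X) := A `\` \bigcup_(x in [set` s]) f x.
pose D := [set s : seq X | {in s, forall x, A x}].
have FF : ProperFilter (filter_from D G).
  apply: filter_from_proper; last first.
    move=> s Ds; apply: contrapT => /set0P/negP/negPn/eqP G0.
    by apply: nocover; exists s; split => // x Ax; apply: contrapT => nx; rewrite -[False]/(set0 x) -G0.
  apply: filter_from_filter; first by exists [::].
  move=> s t Ds Dt; exists (s ++ t).
    by move=> x; rewrite mem_cat => /orP[/Ds|/Dt].
  move=> x [Ax nx]; split; split => //; apply: contra_not nx => -[y ys fy];
    by exists y => //=; rewrite mem_cat ys ?orbT.
have FA : filter_from D G A by exists [::] => // x [].
have [p [Ap clp]] := cA _ FF FA.
have Fp : filter_from D G (A `\` f p).
  exists [:: p]; first by move=> x; rewrite inE => /eqP ->.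
  by move=> x [Ax nx]; split => // fx; apply: nx; exists p => //=; rewrite inE.
by have [x [[_ nfx] fx]] := clp _ _ Fp (fA _ Ap).
Qed.

(** The absolute value of a uniformizer. The value group is discrete, so all radii below are taken
    among its powers and indexed by exponents. *)
Definition rhoK (R : realType) (K : padicFieldType R) : R := (@resq R K)%:R^-1.

Section AbsoluteValue.
Context {R : realType} {K : padicFieldType R}.
Implicit Types x y z : K.

Notation q := (@resq R K).
Notation rho := (rhoK K).

Lemma absK0 : absK (0 : K) = 0 :> R.
Proof. by rewrite /absK /abs_of_ord eqxx. Qed.

Lemma absKE z : z != 0 -> absK z = (q%:R : R) ^ (- ordv z).
Proof. by move=> z0; rewrite /absK /abs_of_ord (negbTE z0). Qed.

Lemma ordv1 : ordv (1 : K) = 0.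
Proof.
have := @ordvM R K 1 1 (oner_neq0 _) (oner_neq0 _); rewrite mulr1 => h.
by apply: (addIr (ordv (1 : K))); rewrite add0r -h.
Qed.

Lemma absK1 : absK (1 : K) = 1 :> R.
Proof. by rewrite absKE ?oner_neq0// ordv1 oppr0 expr0z. Qed.

(** If q = 0, the class of 0 has no representative. If q = 1, every non-zero element has absolute
    value 1, so 0 and 1 lie in different residue classes although there is only one index. *)
Lemma resq_gt1 : (1 < q)%N.
Proof.
have [r [r1 rP]] := @residue_card R K.
have le0 : abs_of_ord R ordv q (0 : K) <= 1 by rewrite [X in X <= _]absK0.
have le1 : abs_of_ord R ordv q (1 : K) <= 1 by rewrite [X in X <= _]absK1.
have [i [hi _]] := rP _ le0; have [j [hj _]] := rP _ le1.
case: (ltngtP 1 q) => // q1; exfalso.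
  by have := ltn_ord i; lia.
have all1 z : z != 0 -> absK z = 1 by move=> z0; rewrite absKE// -q1 exp1rz.
have eq0 z : abs_of_ord R ordv q z < 1 -> z = 0.
  by move=> h; apply: contrapT => /eqP/all1 h'; move: h; rewrite [X in X < _]h' ltxx.
have ij : i = j by apply/val_inj; case: i j {hi hj} => [a +] [b +] /=; lia.
move/eq0/eqP : hi; move/eq0/eqP: hj; rewrite ij !subr_eq0 => /eqP <-.
by rewrite eq_sym oner_eq0.
Qed.

Lemma resq_gt0 : 0 < (q%:R : R).
Proof. by rewrite ltr0n (ltn_trans _ resq_gt1). Qed.

Lemma resq_gt1R : 1 < (q%:R : R).
Proof. by rewrite ltr1n resq_gt1. Qed.

Lemma rho_gt0 : 0 < rho.
Proof. by rewrite /rhoK invr_gt0 resq_gt0. Qed.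

Lemma rho_ge0 : 0 <= rho. Proof. exact/ltW/rho_gt0. Qed.

Lemma rho_lt1 : rho < 1.
Proof. by rewrite /rhoK invf_lt1 ?resq_gt0 ?resq_gt1R. Qed.

Hint Resolve resq_gt0 resq_gt1R rho_gt0 rho_ge0 rho_lt1 : core.

Lemma rhoX_gt0 k : 0 < rho ^+ k. Proof. exact: exprn_gt0. Qed.
Lemma rhoX_ge0 k : 0 <= rho ^+ k. Proof. exact/ltW/rhoX_gt0. Qed.
Hint Resolve rhoX_gt0 rhoX_ge0 : core.

Lemma absK_ge0 z : 0 <= absK z.
Proof.
by have [->|z0] := eqVneq z 0; rewrite ?absK0// absKE// exprz_ge0// ltW.
Qed.
Hint Resolve absK_ge0 : core.

Lemma absK_eq0 z : (absK z == 0) = (z == 0).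
Proof.
have [->|z0] := eqVneq z 0; first by rewrite absK0 eqxx.
by rewrite absKE// gt_eqF// exprz_gt0.
Qed.

Lemma absK_gt0 z : (0 < absK z) = (z != 0).
Proof. by rewrite lt_neqAle absK_ge0 andbT eq_sym absK_eq0. Qed.

Lemma absKM x y : absK (x * y) = absK x * absK y.
Proof.
have [->|x0] := eqVneq x 0; first by rewrite mul0r absK0 mul0r.
have [->|y0] := eqVneq y 0; first by rewrite mulr0 absK0 mulr0.
by rewrite !absKE ?mulf_neq0// ordvM// opprD expfzDr// gt_eqF.
Qed.

Lemma absKN1 : absK (- 1 : K) = 1 :> R.
Proof.
apply/eqP; rewrite -(@pexpr_eq1 _ _ 2)// expr2 -absKM mulrNN mulr1 absK1//.
Qed.

Lemma absKN z : absK (- z) = absK z.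
Proof. by rewrite -mulN1r absKM absKN1 mul1r. Qed.

Lemma absKX z k : absK (z ^+ k) = absK z ^+ k.
Proof.
by elim: k => [|k IH]; rewrite ?expr0 ?absK1// !exprS absKM IH.
Qed.

Lemma absKV z : absK z^-1 = (absK z)^-1.
Proof.
have [->|z0] := eqVneq z 0; first by rewrite invr0 absK0 invr0.
apply: (mulfI (_ : absK z != 0)); first by rewrite absK_eq0.
by rewrite -absKM !mulfV ?absK1// absK_eq0.
Qed.

Lemma absK_prod (I : Type) (r : seq I) (P : pred I) (F : I -> K) :
  absK (\prod_(i <- r | P i) F i) = \prod_(i <- r | P i) absK (F i).
Proof. exact: (big_morph _ absKM absK1). Qed.

Lemma absKD x y : absK (x + y) <= Num.max (absK x) (absK y).
Proof.
have [->|x0] := eqVneq x 0; first by rewrite add0r le_max lexx orbT.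
have [->|y0] := eqVneq y 0; first by rewrite addr0 le_max lexx.
have [->|xy0] := eqVneq (x + y) 0; first by rewrite absK0 le_max absK_ge0.
rewrite !absKE// le_max !ler_eXz2l// !lerN2.
by have := @ordvD R K x y x0 y0 xy0; rewrite ge_min.
Qed.

Lemma absKD_le x y (r : R) : absK x <= r -> absK y <= r -> absK (x + y) <= r.
Proof. by move=> xr yr; rewrite (le_trans (absKD x y))// ge_max xr. Qed.

Lemma absKB_le x y (r : R) : absK x <= r -> absK y <= r -> absK (x - y) <= r.
Proof. by move=> xr yr; rewrite absKD_le// absKN. Qed.

Lemma absKB_sym x y : absK (x - y) = absK (y - x).
Proof. by rewrite -absKN opprB. Qed.

Lemma absK_sum_le (I : Type) (s : seq I) (P : pred I) (F : I -> K) (r : R) :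
  0 <= r -> (forall i, P i -> absK (F i) <= r) ->
  absK (\sum_(i <- s | P i) F i) <= r.
Proof.
move=> r0 h; elim/big_ind: _ => //; first by rewrite absK0.
by move=> x y; exact: absKD_le.
Qed.

Lemma absKD_eq x y : absK y < absK x -> absK (x + y) = absK x.
Proof.
move=> yx; apply/eqP; rewrite eq_le absKD_le// ?(ltW yx)//=.
have : absK x <= Num.max (absK (x + y)) (absK (- y)).
  by rewrite -{1}(addrK y x) absKD.
by rewrite absKN le_max => /orP[//|]; rewrite leNgt yx.
Qed.

Lemma absK_near_eq x y : absK (y - x) < absK x -> absK y = absK x.
Proof. by move=> h; rewrite -(absKD_eq h) addrC subrK. Qed.

Lemma absK_int z : z != 0 -> exists k : int, absK z = rho ^ k.
Proof.
by move=> z0; exists (ordv z); rewrite absKE// /rhoK exprz_inv.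
Qed.

Lemma uniformizer : exists pi : K, absK pi = rho.
Proof.
have [x x0 x1] := @ordv_uniformizer R K.
by exists x; rewrite absKE// x1 exprN1 /rhoK.
Qed.

Lemma rhoXzS k : rho ^+ k.+1 < rho ^+ k.
Proof. by rewrite exprS gtr_pMl. Qed.

(** Discreteness of the value group. It brings an element of absolute value less than [rho ^+ k]
    back into the ball of radius [rho ^+ k] after division by a uniformizer. *)
Lemma absK_ltS x k : absK x < rho ^+ k -> absK x <= rho ^+ k.+1.
Proof.
have [->|x0] := eqVneq x 0; first by rewrite absK0// ltW.
have [m ->] := absK_int x0; rewrite !exprnP.
rewrite /rhoK !exprz_inv ltr_eXz2l// ler_eXz2l//; lia.
Qed.

Lemma rhoX_small (e : R) : 0 < e -> exists k, rho ^+ k < e.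
Proof.
move=> e0; have /cvgrPdist_lt/(_ _ e0) : (fun k => rho ^+ k) @ \oo --> (0:R).
  by apply: cvg_expr; rewrite ger0_norm.
by move=> [k _ /(_ k (leqnn k))] /=; rewrite sub0r normrN ger0_norm ?exprn_ge0//; exists k.
Qed.

Lemma rhoX_le k j : (k <= j)%N -> rho ^+ j <= rho ^+ k.
Proof. by move=> kj; apply: ler_wiXn2l => //; exact: ltW. Qed.

Lemma nbhs_absK (x : K) (S : set K) :
  nbhs x S <-> exists k, forall y, absK (y - x) <= rho ^+ k -> S y.
Proof.
rewrite -nbhs_entourageE entourage_abs_of_ord; split.
  move=> [A [e /= e0 eA] AS]; have [k ke] := rhoX_small e0.
  exists k => y yk; apply: AS; apply/xsectionP/eA => /=.
  by rewrite -/(absK _) absKB_sym (le_lt_trans yk).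
move=> [k kS]; exists [set xy | absK (xy.1 - xy.2) < rho ^+ k].
  by exists (rho ^+ k) => //=.
by move=> y /xsectionP /= h; apply: kS; rewrite absKB_sym ltW.
Qed.

End AbsoluteValue.

#[global] Hint Resolve resq_gt0 resq_gt1R rho_gt0 rho_ge0 rho_lt1 rhoX_gt0 rhoX_ge0
  absK_ge0 : core.

(** * The maximum norm on K^n and its balls *)

Section Norm.
Context {R : realType} {K : padicFieldType R}.
Notation q := (@resq R K).
Notation rho := (rhoK K).

Section NormVector.
Context {n : nat}.
Implicit Types (a x y z : 'rV[K]_n) (r e : R).

Lemma normK_le z r : 0 <= r -> normK z <= r <-> forall i, absK (z 0 i) <= r.
Proof.
move=> r0; split.
  move=> zr i; apply: le_trans zr; rewrite /normK (bigD1 i)//= le_max lexx//.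
by move=> h; rewrite /normK; elim/big_ind: _ => // x y; rewrite ge_max => -> ->.
Qed.

Lemma normK_ge0 z : 0 <= normK z.
Proof.
by rewrite /normK; elim/big_rec: _ => // i x _ x0; rewrite le_max x0 orbT.
Qed.
Hint Resolve normK_ge0 : core.

Lemma absK_le_normK z i : absK (z 0 i) <= normK z.
Proof. by move: i; apply/normK_le. Qed.

Lemma normK_eq0 z : normK z = 0 <-> z = 0.
Proof.
split=> [z0|->]; last first.
  apply/le_anti; rewrite normK_ge0 andbT; apply/normK_le => // i.
  by rewrite mxE absK0.
apply/rowP => i; rewrite mxE; apply/eqP.
by rewrite -absK_eq0 eq_le absK_ge0 andbT -z0 absK_le_normK.
Qed.

Lemma normK0 : normK (0 : 'rV[K]_n) = 0.
Proof. exact/normK_eq0. Qed.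

Lemma normK_gt0 z : (0 < normK z) = (z != 0).
Proof.
rewrite lt_neqAle normK_ge0 andbT eq_sym; congr (~~ _).
by apply/eqP/eqP => /normK_eq0.
Qed.

Lemma normK_attained z : z != 0 -> exists i, normK z = absK (z 0 i).
Proof.
rewrite -normK_gt0 /normK; elim/big_ind: _ => //; first by rewrite ltxx.
- by move=> x y hx hy; case: (leP x y).
- by move=> i _ _; exists i.
Qed.

Lemma normK_int z : z != 0 -> exists k : int, normK z = rho ^ k.
Proof.
move=> z0; have [i zi] := normK_attained z0; rewrite zi; apply: absK_int.
by rewrite -absK_gt0 -zi normK_gt0.
Qed.

Lemma normKZ (c : K) z : normK (c *: z) = absK c * normK z.
Proof.
have c0 := absK_ge0 c.
apply/le_anti/andP; split.
  apply/normK_le => [|i]; first exact: mulr_ge0.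
  by rewrite mxE absKM ler_wpM2l// absK_le_normK.
have [->|z0] := eqVneq z 0; first by rewrite normK0 mulr0.
by have [i ->] := normK_attained z0; have := absK_le_normK (c *: z) i; rewrite mxE absKM.
Qed.

Lemma normKN z : normK (- z) = normK z.
Proof. by rewrite -scaleN1r normKZ absKN1 mul1r. Qed.

Lemma normKB_sym x y : normK (x - y) = normK (y - x).
Proof. by rewrite -normKN opprB. Qed.

Lemma normKD_le x y r : normK x <= r -> normK y <= r -> normK (x + y) <= r.
Proof.
move=> xr yr; have r0 := le_trans (normK_ge0 _) xr.
by apply/normK_le => // i; rewrite mxE absKD_le//; [move: xr|move: yr] => /normK_le; exact.
Qed.

Lemma normKD_lt x y r : normK x < r -> normK y < r -> normK (x + y) < r.
Proof.
move=> xr yr; apply: le_lt_trans (_ : Num.max (normK x) (normK y) < r).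
  by apply: normKD_le; rewrite le_max lexx ?orbT.
by rewrite gt_max xr.
Qed.

Lemma normKD_eq x y : normK y < normK x -> normK (x + y) = normK x.
Proof.
move=> yx; apply/eqP; rewrite eq_le normKD_le// ?(ltW yx)//= leNgt.
apply/negP => h; suff : normK (x + y - y) < normK x by rewrite addrK ltxx.
by apply: normKD_lt; rewrite ?normKN.
Qed.

Lemma normK_mx_bound m (A : 'M[K]_(n, m)) : exists2 C : R, 0 < C &
  forall z, normK (z *m A) <= C * normK z.
Proof.
pose C := 1 + \sum_(i < n) \sum_(j < m) absK (A i j).
have C0 : 0 < C.
  apply: ltr_pwDl; first exact: ltr01.
  by apply: sumr_ge0 => i _; apply: sumr_ge0 => j _; exact: absK_ge0.
exists C => // z; rewrite {1}/normK; elim/big_ind: _ => //.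
- by rewrite mulr_ge0// ltW.
- by move=> a b ha hb; rewrite ge_max ha.
move=> j _; rewrite mxE; apply: absK_sum_le => [|i _]; first by rewrite mulr_ge0// ltW.
rewrite absKM mulrC ler_pM ?absK_le_normK ?absK_ge0//.
have s0 : 0 <= \sum_(i0 < n | i0 != i) \sum_j0 absK (A i0 j0).
  by apply: sumr_ge0 => k _; apply: sumr_ge0 => k' _; exact: absK_ge0.
have s1 : 0 <= \sum_(j0 < m | j0 != j) absK (A i j0).
  by apply: sumr_ge0 => k _; exact: absK_ge0.
by rewrite /C (bigD1 i)//= (bigD1 j)//=; lra.
Qed.

(** With radii given by exponents, two balls that meet are nested in the order of their exponents,
    and every ball is clopen. *)
Definition ballK a k : set 'rV[K]_n := [set z | normK (z - a) <= rho ^+ k].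

Lemma ballK_center a k : ballK a k a.
Proof. rewrite /ballK /mkset subrr normK0; exact: rhoX_ge0. Qed.
Hint Resolve ballK_center : core.

Lemma ballK_le a k j : (k <= j)%N -> ballK a j `<=` ballK a k.
Proof. by move=> kj z /le_trans; apply; exact: rhoX_le. Qed.

Lemma ballK_sym a b k : ballK a k b -> ballK b k a.
Proof. by rewrite /ballK /= normKB_sym. Qed.

Lemma ballK_trans a b c k : ballK a k b -> ballK b k c -> ballK a k c.
Proof.
by rewrite /ballK /= => ab bc; rewrite -(subrK b c) -addrA normKD_le.
Qed.

Lemma ballK_eq a b k : ballK a k b -> ballK a k = ballK b k.
Proof.
by move=> ab; apply/seteqP; split => c; apply: ballK_trans => //; exact: ballK_sym.
Qed.

Lemma ballK_nested a b k j : (k <= j)%N -> ballK a k `&` ballK b j !=set0 ->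
  ballK b j `<=` ballK a k.
Proof.
move=> kj [c [ac /(ballK_le kj) bc]]; rewrite (ballK_eq ac) -(ballK_eq bc).
exact: ballK_le.
Qed.

Lemma nbhs_normK a (S : set 'rV[K]_n) :
  nbhs a S <-> exists k, ballK a k `<=` S.
Proof.
split.
  move=> [P Pa PS].
  have /choice[f fP] : forall i : 'I_n, exists k, forall y : K,
      absK (y - a 0 i) <= rho ^+ k -> P 0 i y.
    by move=> i; apply/nbhs_absK.
  exists (\max_i f i) => z az; apply: PS => i j; rewrite ord1; apply: fP.
  apply: le_trans (rhoX_le (leq_bigmax j)).
  by apply: le_trans az; have := absK_le_normK (z - a) j; rewrite !mxE.
move=> [k kS]; exists (fun i j => [set y | absK (y - a i j) <= rho ^+ k]).
  by move=> i j; apply/nbhs_absK; exists k.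
move=> z /= h; apply: kS; apply/normK_le => [|i]; first exact: ltW.
by have := h 0 i; rewrite !mxE.
Qed.

Lemma open_normK (S : set 'rV[K]_n) :
  open S <-> forall a, S a -> exists k, ballK a k `<=` S.
Proof.
by rewrite openE; split=> h a /h /nbhs_normK.
Qed.

Lemma ballK_open a k : open (ballK a k).
Proof. by apply/open_normK => b ab; exists k; rewrite (ballK_eq ab). Qed.

Lemma ballK_nbhs a k : nbhs a (ballK a k).
Proof. by apply/nbhs_normK; exists k. Qed.

Lemma ballK_closed a k : closed (ballK a k).
Proof.
rewrite -[ballK a k]setCK; apply: open_closedC; apply/open_normK => b ab.
exists k => c bc ac; apply: ab; apply: ballK_trans ac _; exact: ballK_sym.
Qed.

Lemma rV_hausdorff : hausdorff_space 'rV[K]_n.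
Proof.
move=> a b /= ab; apply: contrapT => /eqP; rewrite -subr_eq0 -normK_gt0.
move=> /(rhoX_small (K := K))[k].
have [c [ac bc]] := ab _ _ (ballK_nbhs a k) (ballK_nbhs b k).
by rewrite ltNge; apply/negP/negPn/(ballK_trans bc)/ballK_sym.
Qed.

End NormVector.
End Norm.

#[global] Hint Resolve normK_ge0 ballK_center : core.

(** * Haar measure and linear maps *)

Section Volume.
Context {R : realType} {K : padicFieldType R} {n : nat}.
Context {mu : {measure set (borelK K n) -> \bar R}}.
Hypothesis mu_haar : normalized_haar mu.
Notation q := (@resq R K).
Notation rho := (rhoK K).

(** The sigma-algebra lives on the copy [borelK K n] of the space of row vectors; [borel_set] and
    [vol] hide this change of type. *)
Definition borel_set (S : set 'rV[K]_n) : Prop :=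
  measurable (S : set (borelK K n)).

Definition vol (S : set 'rV[K]_n) : \bar R := mu (S : set (borelK K n)).

Lemma open_borel S : open S -> borel_set S.
Proof. by move=> oS; exact: sub_sigma_algebra. Qed.

Lemma borel_setC S : borel_set S -> borel_set (~` S).
Proof. exact: (@measurableC _ (borelK K n)). Qed.

Lemma borel_setD S S' : borel_set S -> borel_set S' -> borel_set (S `\` S').
Proof. exact: (@measurableD _ (borelK K n)). Qed.

Lemma borel_setU S S' : borel_set S -> borel_set S' -> borel_set (S `|` S').
Proof. exact: (@measurableU _ (borelK K n)). Qed.

Lemma closed_borel S : closed S -> borel_set S.
Proof.
move=> cS; rewrite -[S]setCK; apply: borel_setC; apply: open_borel.
exact: closed_openC.
Qed.

Lemma compact_borel S : compact S -> borel_set S.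
Proof. move=> cS; apply: closed_borel; apply: compact_closed => //; exact: rV_hausdorff. Qed.

Lemma vol_set0 : vol set0 = 0%E. Proof. exact: measure0. Qed.

Lemma vol_ge0 S : (0 <= vol S)%E. Proof. exact: measure_ge0. Qed.

Lemma vol_le S S' : borel_set S -> borel_set S' -> S `<=` S' -> (vol S <= vol S')%E.
Proof. by move=> mS mS' SS'; apply: le_measure => //; rewrite inE. Qed.

Lemma volU S S' : borel_set S -> borel_set S' -> S `&` S' = set0 ->
  vol (S `|` S') = (vol S + vol S')%E.
Proof. by move=> mS mS' SS'; exact: measureU. Qed.

Lemma vol_seq (I : choiceType) (s : seq I) (F : I -> set 'rV[K]_n) :
  uniq s -> (forall i, borel_set (F i)) ->
  {in s &, forall i j, F i `&` F j !=set0 -> i = j} ->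
  vol (\bigcup_(i in [set` s]) F i) = (\sum_(i <- s) vol (F i))%E.
Proof.
move=> us mF dF; rewrite [LHS](measure_fin_bigcup _ (F := F : I -> set (borelK K n)))//.
  by rewrite -fsbig_seq.
by move=> i _; exact: mF.
Qed.

Lemma vol_seq_le (I : choiceType) (s : seq I) (F : I -> set 'rV[K]_n) S :
  borel_set S -> (forall i, borel_set (F i)) ->
  S `<=` \bigcup_(i in [set` s]) F i ->
  (vol S <= \sum_(i <- s) vol (F i))%E.
Proof.
move=> mS mF; elim: s S mS => [|i s IH] S mS sub.
  rewrite big_nil; suff -> : S = set0 by rewrite /vol measure0.
  by apply/seteqP; split => // x /sub[].
rewrite big_cons.
have mSF : borel_set (S `\` F i) by exact: borel_setD.
have le1 : S `<=` F i `|` (S `\` F i).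
  by move=> x Sx; case: (pselect (F i x)) => h; [left|right].
have mU : borel_set (F i `|` (S `\` F i)) by exact: borel_setU.
apply: le_trans (vol_le mS mU le1) _.
apply: le_trans (measureU2 _ (mF i) mSF) _.
apply: leeD => //; apply: IH => // x [/sub[j /= js Fj] Fi].
by move: js; rewrite inE => /orP[/eqP ji|js]; [case: Fi; rewrite -ji|exists j].
Qed.

Definition translate (a : 'rV[K]_n) (S : set 'rV[K]_n) : set 'rV[K]_n :=
  [set (a + x) | x in S].

Lemma vol_translate a S : borel_set S -> vol (translate a S) = vol S.
Proof. by case: mu_haar => h _; exact: h. Qed.

Lemma translate_open a S : open S -> open (translate a S).
Proof.
move=> /open_normK oS; apply/open_normK => _ [x /oS[k kS] <-].
exists k => y; rewrite /ballK /mkset => ya; exists (y - a); last by rewrite addrC subrK.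
by apply: kS; rewrite /ballK /mkset -addrA -opprD.
Qed.

Definition unit_ball : set 'rV[K]_n := [set z | (normK z <= 1)].

Lemma vol_unit_ball : vol unit_ball = 1%E.
Proof. by case: mu_haar. Qed.

(** The R_K-module spanned by the rows of A. *)
Definition lattice (A : 'M[K]_n) : set 'rV[K]_n := [set z *m A | z in unit_ball].

Lemma lattice1 : lattice 1%:M = unit_ball.
Proof.
apply/seteqP; split => [_ [z h <-]|z h]; first by rewrite mulmx1.
by exists z => //; rewrite mulmx1.
Qed.

Lemma lattice_open (A : 'M[K]_n) : A \in unitmx -> open (lattice A).
Proof.
move=> Au; apply/open_normK => _ [z z1 <-].
have [C C0 hC] := normK_mx_bound (invmx A).
have [k hk] : exists k, (rho ^+ k < C^-1) by apply: rhoX_small; rewrite invr_gt0.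
exists k => w; rewrite /ballK /mkset => hw.
exists (w *m invmx A); last by rewrite mulmxKV.
rewrite /unit_ball /mkset -[w](subrK (z *m A)) mulmxDl mulmxK//.
apply: normKD_le => //; apply: le_trans (hC _) _.
rewrite -ler_pdivlMl// mulr1; apply: le_trans hw _; exact: ltW.
Qed.

Lemma lattice_borel A : A \in unitmx -> borel_set (lattice A).
Proof. by move=> Au; apply: open_borel; exact: lattice_open. Qed.

Lemma iter_adde_nat k (x : \bar R) : (0 <= x)%E ->
  (iter k (adde x) 0 = k%:R%:E * x)%E.
Proof.
move=> x0; elim: k => [|k IH]; first by rewrite mul0e.
by rewrite iterS IH -natr1 EFinD ge0_muleDl ?lee_fin// mul1e addeC.
Qed.

(** Quantifying over all B, and not only B = 1, makes the property stable under products and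
    inverses, so that it can be checked on the factors of an LU decomposition. *)
Definition scales (A : 'M[K]_n) : Prop := A \in unitmx /\
  forall B, B \in unitmx ->
    vol (lattice (A *m B)) = ((absK (\det A))%:E * vol (lattice B))%E.

Lemma scalesM A A' : scales A -> scales A' -> scales (A *m A').
Proof.
move=> [uA sA] [uA' sA']; split=> [|B uB]; first by rewrite unitmx_mul uA.
rewrite -mulmxA sA ?unitmx_mul ?uA'// sA'// det_mulmx absKM EFinM muleA//.
Qed.

Lemma scalesV A : scales A -> scales (invmx A).
Proof.
move=> [uA sA]; split=> [|B uB]; first by rewrite unitmx_inv.
have dA : (absK (\det A) != 0) by rewrite absK_eq0 -unitfE -unitmxE.
have := sA (invmx A *m B); rewrite mulKVmx// => -> ; last by rewrite unitmx_mul unitmx_inv uA.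
rewrite muleA -EFinM det_inv absKV mulVf// mul1e//.
Qed.

Lemma det_integral m (A : 'M[K]_m) : (forall i j, absK (A i j) <= 1) ->
  (absK (\det A) <= 1).
Proof.
move=> hA; apply: absK_sum_le => // s _; rewrite absKM absKX absKN1 expr1n mul1r.
rewrite absK_prod; elim: (index_enum _) => [|i r IH]; rewrite ?big_nil// big_cons.
by rewrite mulr_ile1 ?absK_ge0// -absK_prod absK_ge0.
Qed.

Lemma integral_unit_ball (A : 'M[K]_n) z : (forall i j, absK (A i j) <= 1) ->
  unit_ball z -> unit_ball (z *m A).
Proof.
move=> hA hz; apply/normK_le => // i; rewrite mxE; apply: absK_sum_le => // j _.
rewrite absKM mulr_ile1 ?absK_ge0//; exact: le_trans (absK_le_normK z j) hz.
Qed.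

(** By the cofactor formula the inverse is integral too, so A maps the unit ball onto itself. *)
Lemma scales_integral (A : 'M[K]_n) : (forall i j, absK (A i j) <= 1) ->
  absK (\det A) = 1 -> scales A.
Proof.
move=> hA dA; have uA : A \in unitmx.
  by rewrite unitmxE unitfE -absK_eq0 dA oner_eq0.
split=> // B uB; rewrite dA mul1e; congr vol; apply/seteqP; split.
  move=> _ [z hz <-]; exists (z *m A); last by rewrite mulmxA.
  exact: integral_unit_ball.
move=> _ [z hz <-]; exists (z *m invmx A); last by rewrite mulmxA mulmxKV.
apply: integral_unit_ball => // i j.
rewrite /invmx uA !mxE absKM absKV dA invr1 mul1r /cofactor absKM absKX absKN1.
by rewrite expr1n mul1r; apply: det_integral => i' j'; rewrite !mxE.
Qed.

Definition diag1 (i : 'I_n) (c : K) : 'M[K]_n :=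
  diag_mx (\row_j (if j == i then c else 1)).

Lemma mul_diag1 (z : 'rV[K]_n) i c j :
  ((z *m diag1 i c) 0 j = if j == i then z 0 j * c else z 0 j).
Proof. by rewrite mul_mx_diag !mxE; case: eqP; rewrite ?mulr1. Qed.

Lemma det_diag1 i c : \det (diag1 i c) = c.
Proof.
rewrite det_diag (bigD1 i)//= mxE eqxx big1 ?mulr1// => j /negbTE ji.
by rewrite mxE ji.
Qed.

Lemma diag1_unit i c : c != 0 -> diag1 i c \in unitmx.
Proof. by move=> c0; rewrite unitmxE unitfE det_diag1. Qed.

Lemma diag1M i c d : (diag1 i (c * d) = diag1 i c *m diag1 i d).
Proof.
rewrite mulmx_diag; congr diag_mx; apply/rowP => j.
by rewrite !mxE; case: eqP; rewrite ?mulr1.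
Qed.

Lemma diag1_1 i : diag1 i 1 = 1%:M.
Proof.
rewrite /diag1 -diag_const_mx; congr diag_mx; apply/rowP => j.
by rewrite !mxE; case: eqP.
Qed.

(** Sorting the points of the unit ball by the residue class of their i-th coordinate splits
    [lattice B] into q disjoint translates of [lattice (D *m B)]; translation invariance then gives
    the factor 1/q. *)
Lemma scales_uniformizer i (pi : K) : absK pi = rho -> scales (diag1 i pi).
Proof.
move=> hpi; have pi0 : pi != 0 by rewrite -absK_gt0 hpi.
have uD := diag1_unit i pi0.
split=> // B uB; set D := diag1 i pi.
have [r [r1 rP]] := @residue_card R K.
pose e (c : 'I_q) : 'rV[K]_n := (r c *: delta_mx 0 i).
pose F (c : 'I_q) := translate (e c *m B) (lattice (D *m B)).
have oDB : open (lattice (D *m B)) by apply: lattice_open; rewrite unitmx_mul uD.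
have LE : lattice B = \bigcup_(c in [set` enum 'I_q]) F c.
  apply/seteqP; split.
    move=> _ [z hz <-].
    have zi : abs_of_ord R ordv q (z 0 i) <= 1 by exact: le_trans (absK_le_normK z i) hz.
    have [c [hc _]] := rP _ zi.
    exists c; first by rewrite /= mem_enum.
    exists ((z - e c) *m B); last by rewrite mulmxBl addrC subrK.
    exists (\row_j (if j == i then (z 0 i - r c) / pi else z 0 j)); last first.
      rewrite mulmxA; congr (_ *m _); apply/rowP => j; rewrite mul_diag1 !mxE eqxx /=.
      by case: eqP => [->|_]; rewrite ?mulr1 ?mulfVK// mulr0 subr0.
    apply/normK_le => // j; rewrite mxE; case: eqP => _.
      rewrite absKM absKV hpi ler_pdivrMr ?rho_gt0// mul1r -[rho]expr1.
      exact: (@absK_ltS _ _ _ 0).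
    exact: le_trans (absK_le_normK z j) hz.
  move=> _ [c _ [_ [z hz <-] <-]]; exists (e c + z *m D); last first.
    by rewrite mulmxDl mulmxA.
  apply: normKD_le.
    apply/normK_le => // j; rewrite !mxE eqxx/=.
    by case: eqP => _; rewrite ?mulr1 ?r1// mulr0 absK0.
  apply/normK_le => // j; rewrite mul_diag1.
  have zj := le_trans (absK_le_normK z j) hz.
  by case: eqP => // _; rewrite absKM hpi mulr_ile1 ?absK_ge0 ?rho_ge0// ltW// rho_lt1.
rewrite LE vol_seq; last 3 first.
- exact: enum_uniq.
- by move=> c; apply: open_borel; exact: translate_open.
- move=> c c' _ _ [_ [[_ [z hz <-] <-] [_ [z' hz' <-]]]].
  rewrite !mulmxA -!mulmxDl => /(can_inj (mulmxK uB))/rowP/(_ i).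
  rewrite mxE [RHS]mxE !mul_diag1 !mxE !eqxx/= !mulr1 => eq1.
  have [c0 [_ uc]] := rP _ (r1 c).
  rewrite -(uc c) ?(uc c') ?subrr//; last by rewrite [X in X < _]absK0.
  have -> : (r c - r c' = (z' 0 i - z 0 i) * pi).
    by rewrite mulrBl; apply/eqP; rewrite subr_eq addrAC eq_sym subr_eq addrC eq1 addrC.
  rewrite [X in X < _]absKM hpi; apply: le_lt_trans (@rho_lt1 R K).
  rewrite ler_piMl ?rho_ge0//; apply: absKB_le; [move: hz'|move: hz] => h;
    by apply: le_trans h; exact: absK_le_normK.
rewrite (eq_bigr (fun=> vol (lattice (D *m B)))); last first.
  by move=> c _; rewrite /F vol_translate//; exact: open_borel.
rewrite big_const_seq count_predT size_enum_ord iter_adde_nat ?vol_ge0//.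
by rewrite muleA -EFinM det_diag1 hpi mulVf ?mul1e// gt_eqF// resq_gt0.
Qed.

(** The scalar c is a unit times a power of a uniformizer; a negative exponent is handled by
    [scalesV]. *)
Lemma scales_diag1 i c : c != 0 -> scales (diag1 i c).
Proof.
move=> c0; have [pi hpi] := @uniformizer R K.
have pi0 : pi != 0 by rewrite -absK_gt0 hpi rho_gt0.
have scalesX k : scales (diag1 i (pi ^+ k)).
  elim: k => [|k IH].
    rewrite expr0 diag1_1; apply: scales_integral; last by rewrite det1 absK1.
    by move=> i' j'; rewrite !mxE; case: eqP; rewrite ?absK1 ?absK0.
  by rewrite exprS diag1M; apply: scalesM => //; exact: scales_uniformizer.
have scalesXV k : scales (diag1 i (pi ^- k)).
  have -> : diag1 i (pi ^- k) = invmx (diag1 i (pi ^+ k)); last exact: scalesV.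
  have u := diag1_unit i (expf_neq0 k pi0).
  apply: (can_inj (mulKmx u)); rewrite mulmxV// -diag1M mulfV ?diag1_1//.
  exact: expf_neq0.
have scalesU u : absK u = 1 -> scales (diag1 i u).
  move=> u1; apply: scales_integral; last by rewrite det_diag1.
  move=> i' j'; rewrite !mxE; case: (i' == j'); last by rewrite mulr0n absK0.
  by rewrite mulr1n; case: eqP; rewrite ?absK1 ?u1.
have [m hm] := absK_int c0.
case: m hm => k hk.
  rewrite -(mulfVK (expf_neq0 k pi0) c) diag1M; apply: scalesM => //; apply: scalesU.
  by rewrite absKM absKV absKX hk hpi exprnP mulfV// expf_neq0// gt_eqF// rho_gt0.
rewrite -(mulfVK (invr_neq0 (expf_neq0 k.+1 pi0)) c) diag1M.
apply: scalesM => //; apply: scalesU.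
rewrite invrK absKM absKX hk hpi NegzE -exprnN mulVf//.
by rewrite expf_neq0// gt_eqF// rho_gt0.
Qed.

Lemma scales_diag (d : 'rV[K]_n) : (forall i, d 0 i != 0) -> scales (diag_mx d).
Proof.
move=> d0.
suff h k : scales (diag_mx (\row_j (if (j < k)%N then d 0 j else 1))).
  have := h n; congr (scales (diag_mx _)); apply/rowP => j.
  by rewrite !mxE ltn_ord.
elim: k => [|k IH].
  have -> : diag_mx (\row_(j < n) (if (j < 0)%N then d 0 j else 1)) = 1%:M.
    by rewrite -diag_const_mx; congr diag_mx; apply/rowP => j; rewrite !mxE.
  apply: scales_integral; last by rewrite det1 absK1.
  by move=> i' j'; rewrite !mxE; case: eqP; rewrite ?absK1 ?absK0.
have [kn|nk] := ltnP k n; last first.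
  congr (scales (diag_mx _)): IH; apply/rowP => j; rewrite !mxE.
  by have jn := ltn_ord j; rewrite !ifT//; lia.
have -> : diag_mx (\row_j (if (j < k.+1)%N then d 0 j else 1)) =
    diag_mx (\row_j (if (j < k)%N then d 0 j else 1)) *m diag1 (Ordinal kn) (d 0 (Ordinal kn)).
  rewrite mulmx_diag; congr diag_mx; apply/rowP => j; rewrite !mxE.
  have [->|jk] := eqVneq j (Ordinal kn); first by rewrite /= ltnSn ltnn mul1r.
  rewrite mulr1; congr (if _ then _ else _).
  by move: jk; rewrite -val_eqE /= ltnS leq_eqVlt => /negbTE ->.
by apply: scalesM => //; exact: scales_diag1.
Qed.

(* Conjugating by a diagonal matrix of powers of a uniformizer makes a
   triangular matrix integral. *)
Lemma scales_unitriangular (A : 'M[K]_n) (w : 'I_n -> nat) :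
  (forall i j, A i j != 0 -> i != j -> (w j < w i)%N) ->
  \det A = 1 -> (forall i, A i i = 1) -> scales A.
Proof.
move=> wA detA A1; have [pi hpi] := @uniformizer R K.
have pi0 : pi != 0 by rewrite -absK_gt0 hpi rho_gt0.
have [k hk] : exists k, forall i j, absK (A i j) * rho ^+ k <= 1.
  pose M := 1 + \sum_i \sum_j absK (A i j).
  have ge0 i : 0 <= \sum_j absK (A i j) by apply: sumr_ge0 => j _; exact: absK_ge0.
  have M0 : 0 < M by apply: ltr_pwDl => //; apply: sumr_ge0 => i _; exact: ge0.
  have [k hk] : exists k, rhoK K ^+ k < M^-1 by apply: rhoX_small; rewrite invr_gt0.
  exists k => i j; rewrite -(mulfV (lt0r_neq0 M0)).
  apply: ler_pM => //; [exact: absK_ge0|exact: rhoX_ge0| |exact: ltW].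
  have s0 : 0 <= \sum_(i0 < n | i0 != i) \sum_j0 absK (A i0 j0).
    by apply: sumr_ge0 => k' _; exact: ge0.
  have s1 : 0 <= \sum_(j0 < n | j0 != j) absK (A i j0).
    by apply: sumr_ge0 => k' _; exact: absK_ge0.
  by rewrite /M (bigD1 i)//= (bigD1 j)//=; lra.
pose d := \row_i pi ^+ (k * w i) : 'rV[K]_n.
have sD : scales (diag_mx d) by apply: scales_diag => i; rewrite mxE expf_neq0.
have uD : diag_mx d \in unitmx by case: sD.
have -> : A = invmx (diag_mx d) *m (diag_mx d *m A *m invmx (diag_mx d)) *m diag_mx d.
  by rewrite -!mulmxA mulVmx// mulmx1 mulKmx.
apply: scalesM => //; apply: scalesM; first exact: scalesV.
have eD : diag_mx d *m A *m invmx (diag_mx d) =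
    \matrix_(i, j) (pi ^+ (k * w i) * A i j / pi ^+ (k * w j)).
  apply: (can_inj (mulmxK uD)); rewrite mulmxKV//.
  rewrite mul_diag_mx mul_mx_diag; apply/matrixP => i j; rewrite !mxE mulfVK//.
  exact: expf_neq0.
apply: scales_integral; last first.
  by rewrite !det_mulmx detA mulr1 det_inv mulfV ?absK1// -unitfE -unitmxE.
move=> i j; rewrite eD mxE; have [->|ij] := eqVneq i j.
  by rewrite A1 mulr1 mulfV ?absK1// expf_neq0.
have [->|Aij] := eqVneq (A i j) 0; first by rewrite mulr0 mul0r absK0.
have wij := wA _ _ Aij ij.
rewrite !absKM absKV !absKX hpi ler_pdivrMr ?rhoX_gt0// mul1r.
(* As [w j < w i], conjugation multiplies the entry by at least one factor [rho ^+ k], which absorbs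
   the size of [A i j]. *)
have -> : (k * w i = k + (k * (w i - w j).-1 + k * w j))%N by nia.
rewrite !exprD mulrC mulrA -[X in _ <= X]mul1r.
rewrite [X in X <= _](_ : _ = (absK (A i j) * rho ^+ k) *
  rho ^+ (k * (w i - w j).-1) * rho ^+ (k * w j)); last by ring.
rewrite ler_wpM2r ?rhoX_ge0// mulr_ile1 ?rhoX_ge0 ?mulr_ge0 ?absK_ge0 ?rhoX_ge0//.
by rewrite exprn_ile1 ?rho_ge0// ltW// rho_lt1.
Qed.

End Volume.

(** * Volumes of lattices and of balls *)

Section LatticeVolume.
Context {R : realType} {K : padicFieldType R} {n : nat}.
Context {mu : {measure set (borelK K n) -> \bar R}}.
Hypothesis mu_haar : normalized_haar mu.
Notation rho := (rhoK K).

(** A is P^-1 L D U' with P a permutation matrix, L and U' lower and upper unitriangular and D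
    diagonal, and each factor has been treated. The case n = 0 is separate because [cormen_lup]
    takes matrices of positive size. *)
Lemma scales_unit (A : 'M[K]_n) : A \in unitmx -> scales (mu := mu) A.
Proof.
case: n mu mu_haar A => [|m] nu nu_haar A uA.
  apply: scales_integral => //; first by move=> [].
  by rewrite det_mx00 absK1.
have := cormen_lup_correct A; have := cormen_lup_perm A.
have := cormen_lup_detL A; have := @cormen_lup_lower _ _ A.
have := @cormen_lup_upper _ _ A.
case: (cormen_lup A) => [[P L] U] /= upU lowL detL permP PALU.
have sP : scales (mu := nu) P.
  case/is_perm_mxP: permP => s ->; apply: scales_integral => //.
    by move=> i j; rewrite !mxE; case: eqP; rewrite ?absK1 ?absK0.
  by rewrite det_perm absKX absKN1 expr1n.
have uP : P \in unitmx by case: sP.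
have sL : scales (mu := nu) L.
  apply: (scales_unitriangular nu_haar (w := fun i => nat_of_ord i)) => //.
    move=> i j Lij ij; rewrite ltnNge; apply/negP => /lowL.
    by rewrite (negbTE ij) => /eqP; rewrite (negbTE Lij).
  by move=> i; rewrite lowL// eqxx.
have uL : L \in unitmx by case: sL.
have uU : U \in unitmx.
  have : L * U \in unitmx by rewrite -PALU unitmx_mul uP.
  by rewrite unitmx_mul => /andP[].
have trigU : is_trig_mx U^T by apply/is_trig_mxP => i j ij; rewrite mxE upU.
have detU : \det U = \prod_i U i i.
  by rewrite -det_tr det_trig//; apply: eq_bigr => i _; rewrite mxE.
have Uii i : U i i != 0.
  apply: contraTneq uU => Ui0; rewrite unitmxE unitfE detU (bigD1 i)//= Ui0 mul0r.
  by rewrite eqxx.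
pose d := \row_i U i i.
have sD : scales (mu := nu) (diag_mx d).
  by apply: scales_diag => // i; rewrite mxE.
have uD : diag_mx d \in unitmx by case: sD.
pose U' := \matrix_(i, j) ((U i i)^-1 * U i j).
have UE : U = diag_mx d *m U'.
  by apply/matrixP => i j; rewrite mul_diag_mx !mxE mulrA mulfV// mul1r.
have U'ii i : U' i i = 1 by rewrite mxE mulVf.
have trigU' : is_trig_mx U'^T.
  by apply/is_trig_mxP => i j ij; rewrite !mxE (upU j i)// mulr0.
(* The non-zero entries lie above the diagonal here, hence the reversed weights [m - i]. *)
have sU : scales (mu := nu) U'.
  apply: (scales_unitriangular nu_haar (w := fun i : 'I_m.+1 => m - i)%N) => //.
    move=> i j Uij ij; have : (i <= j)%N.
      by rewrite leqNgt; apply/negP => h; move: Uij; rewrite mxE (upU i j)// mulr0 eqxx.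
    by move: ij; rewrite -val_eqE; have := ltn_ord j; move=> /=; lia.
  by rewrite -det_tr det_trig// big1// => i _; rewrite mxE.
have -> : A = invmx P *m (L *m (diag_mx d *m U')).
  by rewrite -UE; apply: (can_inj (mulKmx uP)); rewrite mulKVmx.
by apply: scalesM => //; [exact: scalesV|apply: scalesM => //; exact: scalesM].
Qed.

Lemma vol_lattice (A : 'M[K]_n) : A \in unitmx ->
  vol (mu := mu) (lattice A) = (absK (\det A))%:E.
Proof.
move=> uA; have [_ /(_ _ (unitmx1 _ _))] := scales_unit uA.
by rewrite mulmx1 lattice1 vol_unit_ball// mule1.
Qed.

Lemma lattice_scale (pi : K) k : absK pi = rho ->
  ballK 0 k = lattice (pi ^+ k)%:M :> set 'rV[K]_n.
Proof.
move=> hpi; have pi0 : pi ^+ k != 0 by rewrite expf_neq0// -absK_gt0 hpi rho_gt0.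
apply/seteqP; split => [z|_ [z hz <-]]; rewrite /ballK /mkset subr0.
  move=> hz; exists ((pi ^+ k)^-1 *: z); last first.
    by rewrite mul_mx_scalar scalerA mulfV// scale1r.
  rewrite /unit_ball /mkset normKZ absKV absKX hpi mulrC ler_pdivrMr ?rhoX_gt0//.
  by rewrite mul1r.
by rewrite mul_mx_scalar normKZ absKX hpi ler_piMr// rhoX_ge0.
Qed.

Lemma vol_ball (a : 'rV[K]_n) k : vol (mu := mu) (ballK a k) = (rho ^+ (k * n))%:E.
Proof.
have [pi hpi] := @uniformizer R K.
have -> : ballK a k = translate a (ballK 0 k).
  apply/seteqP; split => [z hz|_ [z hz <-]]; last first.
    by move: hz; rewrite /ballK /mkset subr0 addrAC subrr add0r.
  by exists (z - a); rewrite /ballK /mkset ?subr0//; rewrite addrC subrK.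
rewrite vol_translate//; last by apply: open_borel; exact: ballK_open.
rewrite (lattice_scale _ hpi) vol_lattice ?det_scalar ?absKX ?hpi -?exprM//.
by rewrite unitmxE det_scalar unitfE !expf_neq0// -absK_gt0 hpi rho_gt0.
Qed.

Lemma vol_fin (S : set 'rV[K]_n) : compact S -> (vol (mu := mu) S < +oo)%E.
Proof.
move=> cS; have [a _|s [_ sub]] := compact_finite_cover (f := fun a => ballK a 0) cS.
  exact: ballK_nbhs.
apply: le_lt_trans (vol_seq_le _ _ sub) _; first exact: compact_borel.
  by move=> a; apply: open_borel; exact: ballK_open.
by apply: lte_sum_pinfty => a _; rewrite vol_ball ltry.
Qed.

Lemma vol_open_gt0 (S : set 'rV[K]_n) : open S -> S !=set0 -> (0 < vol (mu := mu) S)%E.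
Proof.
move=> oS [a Sa]; have [k kS] := (iffLR (open_normK _)) oS a Sa.
apply: lt_le_trans (vol_le _ _ kS); last 2 first.
- by apply: open_borel; exact: ballK_open.
- exact: open_borel.
by rewrite vol_ball lte_fin rhoX_gt0.
Qed.

End LatticeVolume.

(** * Volumes of images under differentiable maps *)

Section DisjointBalls.
Context {R : realType} {K : padicFieldType R} {n : nat}.
Implicit Types (k : 'rV[K]_n -> nat) (s : seq 'rV[K]_n).

Definition disjoint_balls k s :=
  {in s &, forall x y, ballK x (k x) `&` ballK y (k y) !=set0 -> x = y}.

Lemma bigcup_setU1_seq (T : eqType) (U : Type) (x : T) (s : seq T) (F : T -> set U) :
  \bigcup_(y in [set` x :: s]) F y = F x `|` \bigcup_(y in [set` s]) F y.
Proof.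
apply/seteqP; split => z.
  by case=> y /=; rewrite inE => /orP[/eqP ->|ys] zy; [left|right; exists y].
by case=> [zx|[y /= ys zy]]; [exists x|exists y] => //=; rewrite inE ?eqxx ?ys ?orbT.
Qed.

(** If the ball at the head lies in another one, it is dropped. Otherwise it contains every ball
    that meets it, by nestedness, and those are dropped. *)
Lemma disjoint_subcover k s : exists s' : seq 'rV[K]_n,
  [/\ uniq s', {subset s' <= s}, disjoint_balls k s' &
    \bigcup_(x in [set` s']) ballK x (k x) = \bigcup_(x in [set` s]) ballK x (k x)].
Proof.
have [m] := ubnP (size s); elim: m s => // m IH [|x s].
  by exists [::]; split.
rewrite ltnS => sm.
have [[y ys xy]|nxy] := pselect (exists2 y, y \in s & ballK x (k x) `<=` ballK y (k y)).
  have [s' [us' sub disj eqU]] := IH s sm.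
  exists s'; split => //; first by move=> z /sub; rewrite inE => ->; rewrite orbT.
  rewrite eqU; apply/seteqP; split=> z [w /= ws zw].
    by exists w => //=; rewrite inE ws orbT.
  move: ws; rewrite inE => /orP[/eqP wx|ws]; last by exists w.
  by exists y => //; apply: xy; rewrite -wx.
pose far y := `[< ballK x (k x) `&` ballK y (k y) = set0 >].
have farP y : far y -> ballK x (k x) `&` ballK y (k y) !=set0 -> False.
  by move=> /asboolP -> [].
have [|s' [us' sub disj eqU]] := IH [seq y <- s | far y].
  by apply: leq_ltn_trans sm; rewrite size_filter count_size.
have sub' y : y \in s' -> (y \in s) && far y.
  by move=> /sub; rewrite mem_filter andbC.
exists (x :: s'); split.
- rewrite /= us' andbT; apply/negP => /sub'/andP[_ /farP]; apply.
  by exists x; split; exact: ballK_center.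
- by move=> y; rewrite !inE => /orP[->//|/sub'/andP[-> _]]; rewrite orbT.
- move=> y z; rewrite !inE => /orP[/eqP ->|ys] /orP[/eqP ->|zs]//.
  + by move=> h; case/andP: (sub' _ zs) => _ /farP; case.
  + by move=> h; case/andP: (sub' _ ys) => _ /farP; case; rewrite setIC.
  + exact: disj.
rewrite !bigcup_setU1_seq eqU; apply/seteqP; split => z; last first.
  case=> [zx|[y /= ys zy]]; first by left.
  have [fy|nfy] := boolP (far y); first by right; exists y => //=; rewrite mem_filter fy.
  left; have xy0 : ballK x (k x) `&` ballK y (k y) !=set0.
    by apply/set0P/negP => /eqP h; case/negP: nfy; apply/asboolP.
  have [kxy|kyx] := leqP (k x) (k y); first exact: (ballK_nested kxy xy0).
  by case: nxy; exists y => //; apply: (ballK_nested (ltnW kyx)); rewrite setIC.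
case=> [zx|[y /=]]; first by left.
by rewrite mem_filter => /andP[_ ys] zy; right; exists y.
Qed.

Lemma compact_open_balls (D : set 'rV[K]_n) k : compact D ->
  (forall x, D x -> ballK x (k x) `<=` D) ->
  exists s, [/\ uniq s, {in s, forall x, D x}, disjoint_balls k s &
     D = \bigcup_(x in [set` s]) ballK x (k x)].
Proof.
move=> cD kD; have [x _|s [sD sub]] := compact_finite_cover (f := fun x => ballK x (k x)) cD.
  exact: ballK_nbhs.
have [s' [us' sub' disj eqU]] := disjoint_subcover k s.
have s'D : {in s', forall x, D x} by move=> x /sub'/sD.
exists s'; split => //; apply/seteqP; split; first by rewrite eqU.
by move=> z [x /= xs']; apply: kD; exact: s'D.
Qed.
End DisjointBalls.

(** * Jacobian matrices and the volume of an image *)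

Section Jacobian.
Context {R : realType} {K : padicFieldType R} {n : nat}.
Context {mu : {measure set (borelK K n) -> \bar R}}.
Hypothesis mu_haar : normalized_haar mu.
Notation rho := (rhoK K).
Notation vol := (vol (mu := mu)).
Implicit Types (D : set 'rV[K]_n) (G H : 'rV[K]_n -> 'rV[K]_n) (J : 'M[K]_n).

(** On a small ball the remainder of the expansion of H, pulled back by J^-1, is no larger than the
    radius (hence the tolerance [C^-1]). By the ultrametric inequality H(x + h) - H(x) lies in the
    J-image of the same ball, with no loss in the radius. *)
Lemma jacobian_image_ball H x J (U : set 'rV[K]_n) : is_jacobian H x J -> J \in unitmx ->
  nbhs x U -> exists k, ballK x k `<=` U /\ exists A : 'M[K]_n,
    [/\ A \in unitmx, absK (\det A) = absK (\det J) * rho ^+ (k * n) &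
      H @` ballK x k `<=` translate (H x) (lattice A)].
Proof.
move=> HJ uJ /nbhs_normK[k0 k0U]; have [pi hpi] := @uniformizer R K.
have pi0 : pi != 0 by rewrite -absK_gt0 hpi rho_gt0.
have [C C0 hC] := normK_mx_bound (invmx J).
have [d d0 hd] : exists2 d : R, 0 < d & forall h : 'rV[K]_n, normK h < d ->
    normK (H (x + h) - H x - h *m J) <= C^-1 * normK h.
  by apply: HJ; rewrite invr_gt0.
have [k1 k1d] := @rhoX_small R K d d0.
pose k := maxn k0 k1; exists k; split.
  by apply: subset_trans k0U; apply: ballK_le; rewrite leq_maxl.
exists (pi ^+ k *: J); split.
- by rewrite unitmxZ// unitfE expf_neq0.
- by rewrite detZ absKM !absKX hpi -exprM mulrC.
move=> _ [z hz <-]; pose h := z - x; have zE : z = x + h by rewrite /h addrC subrK.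
have hk : normK h <= rho ^+ k by exact: hz.
have hr : normK (H (x + h) - H x - h *m J) <= C^-1 * normK h.
  apply: hd; apply: le_lt_trans k1d; apply: le_trans hk _.
  by apply: rhoX_le; rewrite leq_maxr.
exists (H z - H x); last by rewrite addrC subrK.
pose w := (H (x + h) - H x - h *m J) *m invmx J + h.
have wk : normK w <= rho ^+ k.
  apply: normKD_le => //; apply: le_trans (hC _) _; apply: le_trans hk.
  by rewrite -ler_pdivlMl.
have wJ : w *m J = H z - H x by rewrite mulmxDl mulmxKV// subrK zE.
exists ((pi ^+ k)^-1 *: w); last by rewrite -scalemxAl -scalemxAr scalerA mulVf ?scale1r// expf_neq0.
rewrite /unit_ball /mkset normKZ absKV absKX hpi mulrC ler_pdivrMr ?rhoX_gt0//.
by rewrite mul1r.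
Qed.

(* Only an upper bound, but valid for merely differentiable maps: applied to a
   map and to its inverse it gives equality. *)
Lemma vol_image_le D H (c : R) : compact D -> open D -> 0 < c ->
  borel_set (H @` D) ->
  (forall x, D x -> exists2 J, is_jacobian H x J & absK (\det J) = c) ->
  (vol (H @` D) <= c%:E * vol D)%E.
Proof.
move=> cD oD c0 mHD HJ.
have unitJ (J : 'M[K]_n) : absK (\det J) = c -> J \in unitmx.
  by move=> Jc; rewrite unitmxE unitfE -absK_gt0 Jc.
have /choice[kA kAP] : forall x, exists kA : nat * 'M[K]_n, D x ->
    [/\ ballK x kA.1 `<=` D, kA.2 \in unitmx, absK (\det kA.2) = c * rho ^+ (kA.1 * n)
      & H @` ballK x kA.1 `<=` translate (H x) (lattice kA.2)].
  move=> x; have [Dx|nDx] := pselect (D x); last by exists (0%N, 0).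
  have [J HxJ Jc] := HJ x Dx.
  have [k [kD [A [uA Ac HA]]]] := jacobian_image_ball HxJ (unitJ _ Jc) (open_nbhs_nbhs (conj oD Dx)).
  by exists (k, A) => _; rewrite -Jc.
have [x Dx|s [us sD disj DE]] := @compact_open_balls _ _ _ D (fun x => (kA x).1) cD.
  by have [] := kAP x Dx.
(* Outside D nothing is known about [(kA x).2]; the empty set keeps every [F x] Borel. *)
pose F x := if `[< D x >] then translate (H x) (lattice (kA x).2) else set0.
have mF x : borel_set (F x).
  rewrite /F; case: asboolP => [/kAP[_ uA _ _]|_]; last exact: measurable0.
  by apply: open_borel; apply: translate_open; exact: lattice_open.
apply: le_trans (vol_seq_le mHD mF (s := s) _) _.
  rewrite {1}DE => _ [z [x /= xs zx] <-]; exists x => //.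
  have Dx := sD x xs; rewrite /F; case: asboolP => // _.
  by have [_ _ _] := kAP x Dx; apply; exists z.
rewrite {1}DE vol_seq//; last by move=> x; apply: open_borel; exact: ballK_open.
rewrite ge0_sume_distrr; last by move=> x _; exact: vol_ge0.
rewrite le_eqVlt; apply/orP; left; apply/eqP.
rewrite !big_seq; apply: eq_bigr => x xs.
have Dx := sD x xs; have [_ uA Ac _] := kAP x Dx.
rewrite /F; case: asboolP => // _; rewrite vol_translate//; last exact: lattice_borel.
by rewrite vol_lattice// vol_ball// Ac EFinM.
Qed.

Lemma jacobian_continuous G x J : is_jacobian G x J -> {for x, continuous G}.
Proof.
move=> GJ; have [C C0 hC] := normK_mx_bound J.
have [d d0 hd] : exists2 d : R, 0 < d & forall h : 'rV[K]_n, normK h < d ->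
  normK (G (x + h) - G x - h *m J) <= 1 * normK h by exact: GJ.
move=> V /nbhs_normK[k kV]; apply/nbhs_normK.
have [k1 k1d] := @rhoX_small R K _ d0.
have [k2 k2d] : exists k2, rho ^+ k2 < C^-1 * rho ^+ k.
  by apply: rhoX_small; rewrite mulr_gt0 ?invr_gt0// rhoX_gt0.
exists (maxn k (maxn k1 k2)) => z hz; apply: kV; rewrite /ballK /mkset.
pose h := z - x; have zE : z = x + h by rewrite /h addrC subrK.
have hh j : (j <= maxn k (maxn k1 k2))%N -> normK h <= rho ^+ j.
  by move=> jk; apply: le_trans hz _; exact: rhoX_le.
have -> : G z - G x = (G (x + h) - G x - h *m J) + h *m J by rewrite subrK zE.
apply: normKD_le.
  apply: le_trans (hd _ _) _; first by apply: le_lt_trans k1d; apply: hh; lia.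
  by rewrite mul1r; apply: hh; lia.
apply: le_trans (hC _) _; rewrite -ler_pdivlMl//.
by apply: le_trans (ltW k2d); apply: hh; lia.
Qed.

(** Put u = H(G x + h) - x. The expansion of G makes u - h J^-1 smaller than u, so u and h J^-1 have
    the same norm; this bounds u by C times h, and the error in the expansion of G becomes one in
    h. *)
Lemma jacobian_inverse G H x J (D : set 'rV[K]_n) :
  is_jacobian G x J -> J \in unitmx -> nbhs (G x) D ->
  {for G x, continuous H} -> H (G x) = x -> (forall y, D y -> G (H y) = y) ->
  is_jacobian H (G x) (invmx J).
Proof.
move=> GJ uJ /nbhs_normK[k1 k1D] cH Hx GH e e0.
have [C C0 hC] := normK_mx_bound (invmx J).
(* The first bound makes the final error at most e times the norm of h; the second gives a factor
   1/2 in front of the norm of u. *)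
pose e' := Num.min (e / C / C) (2 * C)^-1.
have e'0 : 0 < e' by rewrite lt_min !divr_gt0 ?invr_gt0 ?mulr_gt0//.
have [d d0 hd] := GJ e' e'0.
have [k2 k2d] := @rhoX_small R K _ d0.
have : nbhs (G x) (H @^-1` ballK x k2) by apply: cH; rewrite Hx; exact: ballK_nbhs.
move=> /nbhs_normK[k3 k3H].
exists (rho ^+ maxn k1 k3); first exact: rhoX_gt0.
move=> h hh; have hj j : (j <= maxn k1 k3)%N -> ballK (G x) j (G x + h).
  move=> jk; rewrite /ballK /mkset addrAC subrr add0r (le_trans (ltW hh))//.
  exact: rhoX_le.
have GHh : G (H (G x + h)) = G x + h by apply/GH/k1D/hj; rewrite leq_maxl.
pose u : 'rV[K]_n := H (G x + h) - x.
have xu : H (G x + h) = x + u by rewrite /u [RHS]addrC subrK.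
have ud : normK u < d by apply: le_lt_trans k2d; apply: k3H; apply: hj; rewrite leq_maxr.
have uD : H (G x + h) - x = u by [].
clearbody u; have hr : normK (h - u *m J) <= e' * normK u.
  by have := hd u ud; rewrite -xu GHh (addrC (G x) h) addrK.
have uE : u - h *m invmx J = - ((h - u *m J) *m invmx J).
  by rewrite mulmxBl mulmxK// opprB.
have e'C : e' * C <= 2^-1.
  by rewrite -ler_pdivlMr// -invfM ge_min lexx orbT.
have le1 : normK (u - h *m invmx J) <= C * (e' * normK u).
  by rewrite uE normKN; apply: le_trans (hC _) _; rewrite ler_wpM2l// ltW.
have le2 : normK (u - h *m invmx J) <= 2^-1 * normK u.
  by apply: le_trans le1 _; rewrite mulrA ler_wpM2r ?normK_ge0// mulrC.
have uh : normK u <= C * normK h.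
  apply: le_trans (hC _); have [->|u0] := eqVneq u 0; first by rewrite normK0 normK_ge0.
  rewrite -normK_gt0 in u0.
  have lt1 : normK (h *m invmx J - u) < normK u.
    by rewrite normKB_sym; apply: le_lt_trans le2 _; rewrite gtr_pMl// invf_lt1// ltr1n.
  by rewrite -[h *m _](subrK u) addrC normKD_eq.
rewrite Hx uD; apply: le_trans le1 _.
have e'1 : e' <= e / C / C by rewrite ge_min lexx.
apply: (@le_trans _ _ (C * (e / C / C * (C * normK h)))).
  rewrite ler_wpM2l ?(ltW C0)//; apply: ler_pM => //; [exact: ltW|exact: normK_ge0].
by rewrite le_eqVlt; apply/orP; left; apply/eqP; field; rewrite gt_eqF.
Qed.

Lemma jacobian_comp G H x J J' : is_jacobian G x J -> is_jacobian H (G x) J' ->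
  is_jacobian (H \o G) x (J *m J').
Proof.
move=> GJ HJ e e0; have [C C0 hC] := normK_mx_bound J.
have [C' C'0 hC'] := normK_mx_bound J'.
pose e1 := e / C'; have e10 : 0 < e1 by rewrite divr_gt0.
pose e2 := e / (e1 + C); have e20 : 0 < e2 by rewrite divr_gt0// addr_gt0.
have [d1 d10 hd1] := GJ _ e10; have [d2 d20 hd2] := HJ _ e20.
exists (Num.min d1 (d2 / (e1 + C))).
  by rewrite lt_min d10 divr_gt0// addr_gt0.
move=> h; rewrite lt_min => /andP[h1 h2].
pose u : 'rV[K]_n := G (x + h) - G x; have uE : G (x + h) = G x + u by rewrite /u [RHS]addrC subrK.
have ru : normK (u - h *m J) <= e1 * normK h by exact: hd1.
clearbody u.
have uh : normK u <= (e1 + C) * normK h.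
  rewrite -(subrK (h *m J) u); apply: normKD_le.
    by apply: le_trans ru _; rewrite ler_wpM2r ?normK_ge0// lerDl ltW.
  by apply: le_trans (hC _) _; rewrite ler_wpM2r ?normK_ge0// lerDr ltW.
have ud : normK u < d2.
  by apply: le_lt_trans uh _; rewrite -ltr_pdivlMl ?addr_gt0// mulrC.
have := hd2 u ud; rewrite -uE => rH.
have -> : (H \o G) (x + h) - (H \o G) x - h *m (J *m J') =
  (H (G (x + h)) - H (G x) - u *m J') + (u - h *m J) *m J'.
  by rewrite mulmxBl mulmxA [RHS]addrA subrK.
apply: normKD_le.
  apply: le_trans rH _; apply: (@le_trans _ _ (e2 * ((e1 + C) * normK h))).
    by rewrite ler_wpM2l// ltW.
  by rewrite mulrA /e2 mulfVK// gt_eqF// addr_gt0.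
apply: le_trans (hC' _) _; apply: (@le_trans _ _ (C' * (e1 * normK h))).
  by rewrite ler_wpM2l// ltW.
by rewrite mulrA /e1 mulrCA mulfV ?mulr1// gt_eqF.
Qed.

Lemma jacobian_linear (A : 'M[K]_n) x : is_jacobian (fun z => z *m A) x A.
Proof.
move=> e e0; exists 1 => // h _.
by rewrite mulmxDl [X in X - _]addrAC subrr add0r subrr normK0 mulr_ge0 ?normK_ge0// ltW.
Qed.

(** The map G' o G^-1 has a Jacobian determinant of constant absolute value c even where those of G
    and G' vary, so [vol_image_le] applies to it. *)
Lemma vol_transition D G G' (c : R) : compact D -> open D -> 0 < c ->
  {in D &, injective G} ->
  (forall O : set 'rV[K]_n, open O -> O `<=` D -> open (G @` O)) ->
  borel_set (G' @` D) ->
  (forall z, D z -> exists J J', [/\ is_jacobian G z J, is_jacobian G' z J',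
     \det J != 0 & absK (\det J') = c * absK (\det J)]) ->
  (vol (G' @` D) <= c%:E * vol (G @` D))%E.
Proof.
move=> cD oD c0 injG oG mG' JJ.
have /choice[k kP] : forall y, exists x, (G @` D) y -> D x /\ G x = y.
  by move=> y; have [[x Dx <-]|ny] := pselect ((G @` D) y); [exists x|exists 0].
have kG x : D x -> k (G x) = x.
  move=> Dx; have [Dk Gk] : D (k (G x)) /\ G (k (G x)) = G x by apply: kP; exists x.
  by apply: injG; rewrite ?inE.
have imE : G' @` D = (G' \o k) @` (G @` D).
  apply/seteqP; split => [_ [x Dx <-]|_ [_ [x Dx <-] <-]].
    by exists (G x) => /=; [exists x|rewrite kG].
  by exists x => //=; rewrite kG.
rewrite imE; apply: vol_image_le => //.
- apply: continuous_compact => //; apply: continuous_in_subspaceT => x.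
  by rewrite inE => /JJ[J [J' [GJ _ _ _]]]; exact: jacobian_continuous GJ.
- exact: oG.
- by rewrite -imE.
move=> _ [x Dx <-]; have [J [J' [GJ GJ' dJ Jc]]] := JJ x Dx.
have uJ : J \in unitmx by rewrite unitmxE unitfE.
exists (invmx J *m J'); last first.
  by rewrite det_mulmx det_inv absKM absKV Jc mulrCA mulVf ?mulr1// absK_eq0.
apply: jacobian_comp; last by rewrite kG.
apply: (jacobian_inverse (D := G @` D)) => //.
- by apply: open_nbhs_nbhs; split; [exact: oG|exists x].
(* The inverse [k] is continuous because G maps open subsets of D to open sets. *)
- move=> V; rewrite kG// => /nbhs_normK[j jV]; apply/nbhs_normK.
  have oB : open (ballK x j `&` D) by apply: openI => //; exact: ballK_open.
  have /open_normK/(_ (G x)) [|i iB] := oG _ oB (@subIsetr _ _ _).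
    by exists x => //; split => //; exact: ballK_center.
  by exists i => y /iB[z [zj Dz] <-]; rewrite /= kG//; exact: jV.
- exact: kG.
- by move=> y /kP[].
Qed.
End Jacobian.

(** * Continuity of analytic functions; local constancy of absolute values *)

Section AnalyticContinuous.
Context {R : realType} {K : padicFieldType R}.
Notation rho := (rhoK K).

(** Terms close to l have the same distance to c as l itself. The hypothesis starts at index 1
    because a box of side 0 is empty in positive dimension and misses the constant term of a power
    series. *)
Lemma limit_absK_le (u : nat -> K) (l c : K) (r : R) : u @ \oo --> l ->
  (forall N, absK (u N.+1 - c) <= r) -> absK (l - c) <= r.
Proof.
move=> ul ur; rewrite leNgt; apply/negP => rl.
have l0 : 0 < absK (l - c).
  by apply: le_lt_trans rl; apply: le_trans (ur 0%N); exact: absK_ge0.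
have [k kl] := @rhoX_small R K _ l0.
have : nbhs l [set y | absK (y - l) <= rho ^+ k] by apply/nbhs_absK; exists k.
move=> /ul[N _ /(_ N.+1 (leqnSn N))] /= uN.
have := ur N; rewrite -(subrK l (u _)) -addrA addrC absKD_eq.
  by rewrite leNgt rl.
exact: le_lt_trans uN kl.
Qed.

Lemma continuous_normK (n : nat) (X : topologicalType) (h : X -> 'rV[K]_n) b :
  (forall j, {for b, continuous (fun x => h x 0 j)}) ->
  {for b, continuous h}.
Proof.
move=> hc V [P hP PV].
have : \forall x \near b, forall j, P 0 j (h x 0 j).
  by apply: filter_forall => j; exact: hc (hP 0 j).
by apply: filterS => x hx; apply: PV => i j; rewrite ord1.
Qed.

Lemma near_normK_eq (n : nat) (X : topologicalType) (h : X -> 'rV[K]_n) b :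
  {for b, continuous h} -> h b != 0 ->
  \forall x \near b, normK (h x) = normK (h b).
Proof.
move=> hc; rewrite -normK_gt0 => hb0; have [k kh] := @rhoX_small R K _ hb0.
have : \forall x \near b, ballK (h b) k (h x) by exact: hc (ballK_nbhs (h b) k).
apply: filterS => x hx.
rewrite -(subrK (h b) (h x)) addrC normKD_eq//.
exact: le_lt_trans kh.
Qed.

Lemma near_absK_eq (X : topologicalType) (h : X -> K) b :
  {for b, continuous h} -> h b != 0 ->
  \forall x \near b, absK (h x) = absK (h b).
Proof.
move=> hc; rewrite -absK_gt0 => hb0; have [k kh] := @rhoX_small R K _ hb0.
have hk : nbhs (h b) [set y | absK (y - h b) <= rho ^+ k] by apply/nbhs_absK; exists k.
have : \forall x \near b, absK (h x - h b) <= rho ^+ k by exact: hc hk.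
apply: filterS => x hx.
rewrite -(subrK (h b) (h x)) addrC absKD_eq//.
exact: le_lt_trans kh.
Qed.

(** A monomial of positive degree contains a factor bounded by the norm of z, and the remaining
    factors are at most r; hence the distance from g(a + z) to the constant coefficient is at most
    M/r times the norm of z. *)
Lemma analytic_continuous (n : nat) (g : 'rV[K]_n -> K) a :
  analytic_at g a -> {for a, continuous g}.
Proof.
move=> [c [r [M [r0 cM sg]]]].
pose k0 : {ffun 'I_n -> nat} := [ffun=> 0%N].
have M0 : 0 <= M.
  by apply: le_trans (cM k0); rewrite mulr_ge0 ?absK_ge0// exprn_ge0// ltW.
have key z : normK z < r -> absK (g (a + z) - c k0) <= M * normK z / r.
  move=> zr; apply: (limit_absK_le (sg z zr)) => N.
  have ge0 : 0 <= M * normK z / r by rewrite !mulr_ge0 ?invr_ge0 ?normK_ge0// ltW.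
  pose z0 : {ffun 'I_n -> 'I_N.+1} := [ffun=> ord0].
  rewrite (bigD1 z0)//=.
  have -> : [ffun i => val (z0 i)] = k0 by apply/ffunP => i; rewrite !ffunE.
  have -> : monomial z k0 = 1.
    by rewrite /monomial big1// => i _; rewrite ffunE expr0.
  rewrite mulr1 addrAC subrr add0r; apply: absK_sum_le => // k kz0.
  set k' := [ffun i => val (k i)].
  have mon : absK (monomial z k') <= normK z ^+ (\sum_i k' i)%N.
    rewrite /monomial absK_prod -prodrXr; apply: ler_prod => i _.
    rewrite absK_ge0 absKX; apply: lerXn2r; rewrite ?nnegrE ?absK_ge0 ?normK_ge0//.
    exact: absK_le_normK.
  have [s sE] : exists s, (\sum_i k' i = s.+1)%N.
    apply: contrapT => ns; case/eqP: kz0; apply/ffunP => i; apply/val_inj.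
    have : (\sum_i k' i)%N = 0%N by case: (\sum_i k' i)%N ns => // s []; exists s.
    by move/eqP; rewrite sum_nat_eq0 => /forallP/(_ i)/eqP; rewrite !ffunE.
  rewrite absKM; apply: le_trans (_ : absK (c k') * (r * r ^+ s) * (normK z / r) <= _).
    rewrite -!mulrA; apply: ler_wpM2l; first exact: absK_ge0.
    apply: le_trans mon _; rewrite sE exprS mulrCA mulrC.
    rewrite [X in _ <= X](_ : _ = r ^+ s * normK z); last first.
      by field; rewrite gt_eqF.
    rewrite ler_wpM2r ?normK_ge0//; apply: lerXn2r; rewrite ?nnegrE ?normK_ge0 ?ltW//.
  rewrite -exprS -sE -[leRHS]mulrA; apply: ler_wpM2r => //.
  by rewrite divr_ge0 ?normK_ge0// ltW.
have ga : g a = c k0.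
  apply/eqP; rewrite -subr_eq0 -absK_eq0 eq_le absK_ge0 andbT.
  by have := key 0; rewrite normK0 addr0 mulr0 mul0r; apply.
move=> V /nbhs_absK[k kV]; apply/nbhs_normK.
pose e := Num.min r (rho ^+ k * r / (M + 1)).
have M1 : 0 < M + 1 by rewrite ltr_wpDl.
have e0 : 0 < e by rewrite lt_min r0 !mulr_gt0 ?invr_gt0 ?rhoX_gt0.
have [j je] := @rhoX_small R K _ e0.
exists j => z hz; have := le_lt_trans hz je; rewrite lt_min => /andP[zr zk].
have zE : z = a + (z - a) by rewrite addrC subrK.
apply: (kV (g z)); rewrite {1}zE ga; apply: le_trans (key _ zr) _.
rewrite ler_pdivrMr//; apply: le_trans (_ : (M + 1) * normK (z - a) <= _).
  by rewrite ler_wpM2r ?normK_ge0// lerDl.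
by rewrite mulrC -ler_pdivlMr// ltW.
Qed.

End AnalyticContinuous.

(** * Power series with rational sums *)

Section GeometricSums.
Context {F : numFieldType}.
Implicit Types (a b : nat -> F) (c t z w : F).

(* With |t| < 1 this says that z is the sum of a_m t^m; the explicit rate makes
   limits unnecessary. *)
Definition has_sum a t z := exists2 D : F, 0 <= D &
  forall M, `|z - \sum_(m < M) a m * t ^+ m| <= D * `|t| ^+ M.

Lemma has_sum0 t : has_sum (fun=> 0) t 0.
Proof.
exists 0 => // M; rewrite big1 => [|m _]; last by rewrite mul0r.
by rewrite subrr normr0 mul0r.
Qed.

Lemma eq_has_sum a b t z : a =1 b -> has_sum a t z -> has_sum b t z.
Proof.
move=> ab [D D0 h]; exists D => // M; apply: le_trans (h M).
by under eq_bigr do rewrite -ab.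
Qed.

Lemma has_sumD a b t z w : has_sum a t z -> has_sum b t w ->
  has_sum (fun m => a m + b m) t (z + w).
Proof.
move=> [D D0 hD] [E E0 hE]; exists (D + E); first exact: addr_ge0.
move=> M; under eq_bigr do rewrite mulrDl.
rewrite big_split opprD addrACA mulrDl (le_trans (ler_normD _ _))//.
exact: lerD.
Qed.

Lemma has_sum_delta (B : F) m0 t : `|t| <= 1 ->
  has_sum (fun m => if m == m0 then B else 0) t (B * t ^+ m0).
Proof.
move=> t1; exists `|B| => // M; have [mM|Mm] := ltnP m0 M.
  rewrite (bigD1 (Ordinal mM))//= eqxx big1 => [|i im]; last first.
    by rewrite ifF ?mul0r//; apply: contra_neqF im => /eqP im; apply/val_inj.
  by rewrite addr0 subrr normr0 mulr_ge0 ?exprn_ge0.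
rewrite big1 => [|i _]; last first.
  by rewrite ifF ?mul0r//; apply/negbTE; rewrite neq_ltn (leq_trans (ltn_ord i) Mm).
rewrite subr0 normrM normrX ler_wpM2l// -(subnK Mm) exprD ler_piMl ?exprn_ge0//.
exact: exprn_ile1.
Qed.

(* This says (1 - c t^N) (sum_m a_m t^m) = sum_m b_m t^m. *)
Definition lag a b c N := forall m, a m = b m + (if (N <= m)%N then c * a (m - N)%N else 0).

Lemma lag_partial_sum a b c N t M : lag a b c N -> \sum_(m < M) a m * t ^+ m =
  \sum_(m < M) b m * t ^+ m +
  (if (N <= M)%N then c * t ^+ N * \sum_(m < M - N) a m * t ^+ m else 0).
Proof.
move=> ab; under eq_bigr do rewrite ab mulrDl.
rewrite big_split; congr (_ + _); have [NM|MN] := leqP N M; last first.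
  by rewrite big1// => i _; rewrite ifF ?mul0r// leqNgt (ltn_trans (ltn_ord i) MN).
have [k ->] : exists k, M = (N + k)%N by exists (M - N)%N; rewrite subnKC.
rewrite big_split_ord addKn /= big1 ?add0r => [|i _]; last first.
  by rewrite /= ifF ?mul0r// leqNgt ltn_ord.
rewrite mulr_sumr; apply: eq_bigr => i _; rewrite /= leq_addr addKn.
by rewrite exprD; ring.
Qed.

(** The value z solves z = w + c t^N z, and for M >= N the remainder after M terms satisfies a
    recursion of the same shape. The constant [D'] solves D' = D + |z| + |c| D': this closes the
    induction for M >= N, and covers M < N, where all of c t^N z belongs to the remainder. *)
Lemma has_sum_lag a b c N t w : (0 < N)%N -> `|t| < 1 -> `|c| < 1 ->
  lag a b c N -> has_sum b t w -> has_sum a t (w / (1 - c * t ^+ N)).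
Proof.
move=> N0 t1 c1 ab [D D0 hD].
have ct : 1 - c * t ^+ N != 0.
  rewrite subr_eq0; apply/eqP => ct; have : `|1 : F| < 1; last by rewrite normr1 ltxx.
  by rewrite {1}ct normrM normrX; apply: le_lt_trans c1; rewrite ler_piMr ?exprn_ile1// ltW.
set z := w / _; have zE : z = w + c * t ^+ N * z.
  by rewrite /z; field.
have c1' : 0 < 1 - `|c| by rewrite subr_gt0.
pose D' : F := (D + `|z|) / (1 - `|c|).
have D'0 : 0 <= D' by apply: divr_ge0; [exact: addr_ge0|exact: ltW].
have D'E : (1 - `|c|) * D' = D + `|z| by rewrite /D' mulrC mulfVK// gt_eqF.
exists D' => // M; have [m] := ubnP M; elim: m M => // m IH M; rewrite ltnS => Mm.
rewrite (lag_partial_sum _ _ ab) {1}zE.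
have [NM|MN] := leqP N M.
  have {}IH := IH (M - N)%N _.
  rewrite [X in `|X|](_ : _ = (w - \sum_(m < M) b m * t ^+ m) +
    c * t ^+ N * (z - \sum_(m < M - N) a m * t ^+ m)); last by ring.
  apply: le_trans (ler_normD _ _) _; apply: le_trans (lerD (hD M) (lexx _)) _.
  rewrite normrM normrM normrX.
  apply: (@le_trans _ _ (D * `|t| ^+ M + `|c| * `|t| ^+ N * (D' * `|t| ^+ (M - N)))).
    rewrite lerD2l ler_wpM2l ?mulr_ge0 ?exprn_ge0//; apply: IH; lia.
  rewrite [X in X <= _](_ : _ = (D + `|c| * D') * `|t| ^+ M); last first.
    have -> : `|t| ^+ M = `|t| ^+ N * `|t| ^+ (M - N) by rewrite -exprD subnKC.
    by ring.
  rewrite ler_wpM2r ?exprn_ge0// -lerBrDr -[X in X - _]mul1r -mulrBl D'E.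
  by rewrite lerDl.
rewrite addr0 addrAC; apply: le_trans (ler_normD _ _) _.
apply: (@le_trans _ _ (D * `|t| ^+ M + `|z| * `|t| ^+ M)).
  apply: lerD => //; rewrite !normrM normrX mulrC ler_wpM2l//.
  apply: le_trans (_ : 1 * `|t| ^+ N <= _); first by rewrite ler_wpM2r ?exprn_ge0// ltW.
  by rewrite mul1r; apply: ler_wiXn2l => //; [exact: ltW|exact: ltnW].
rewrite -mulrDl -D'E ler_wpM2r ?exprn_ge0// ler_piMl// gerBl//.
Qed.

Lemma has_sum_unique a t z w (t0 : 0 < `|t|) :
  (forall e, 0 < e -> exists M, `|t| ^+ M < e) ->
  has_sum a t z -> has_sum a t w -> z = w.
Proof.
move=> small [D D0 hD] [E E0 hE]; apply/eqP; rewrite -subr_eq0.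
apply: contraT => zw; have zw0 : 0 < `|z - w| by rewrite normr_gt0.
have DE0 : 0 < D + E + 1 by rewrite ltr_wpDl ?addr_ge0.
have [M hM] := small (`|z - w| / (D + E + 1)) (divr_gt0 zw0 DE0).
have : `|z - w| < `|z - w|; last by rewrite ltxx.
apply: (@le_lt_trans _ _ ((D + E + 1) * `|t| ^+ M)); last first.
  by rewrite mulrC -ltr_pdivlMr.
apply: le_trans (ler_distD (\sum_(m < M) a m * t ^+ m) z w) _.
rewrite [X in _ + X]distrC; apply: le_trans (lerD (hD M) (hE M)) _.
by rewrite -mulrDl ler_wpM2r ?exprn_ge0// lerDl.
Qed.

End GeometricSums.

(** * Terms with geometric denominators: size of the coefficients and value of the sum *)

Section Terms.
Context {R : realType} {T : eqType}.
Variables (c : T -> R) (N : T -> nat).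
Implicit Types (B : R) (m : nat) (I : seq T) (a b : nat -> R).

(* a is the coefficient sequence of
   B t^m0 / prod_(i in I) (1 - c_i t^(N_i)). *)
Fixpoint is_term B m0 I a : Prop :=
  if I is i :: I' then exists2 b, is_term B m0 I' b & lag a b (c i) (N i)
  else a =1 (fun m => if m == m0 then B else 0).

Fixpoint is_sum_of_terms (ts : seq (R * nat * seq T)) a : Prop :=
  if ts is t :: ts' then exists a1 a2, [/\ is_term t.1.1 t.1.2 t.2 a1,
    is_sum_of_terms ts' a2 & a =1 (fun m => a1 m + a2 m)]
  else a =1 (fun=> 0).

Lemma eq_is_sum_of_terms ts a b : a =1 b -> is_sum_of_terms ts a -> is_sum_of_terms ts b.
Proof.
case: ts => [|t ts] ab /=; first by move=> h m; rewrite -ab h.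
by move=> [a1 [a2 [h1 h2 h]]]; exists a1, a2; split => // m; rewrite -ab h.
Qed.

Lemma is_sum_of_terms_cat ts ts' a a' : is_sum_of_terms ts a ->
  is_sum_of_terms ts' a' -> is_sum_of_terms (ts ++ ts') (fun m => a m + a' m).
Proof.
elim: ts a => [|t ts IH] a /=.
  by move=> a0 h; apply: eq_is_sum_of_terms h => m; rewrite a0 add0r.
move=> [a1 [a2 [h1 h2 h]]] h'; exists a1, (fun m => a2 m + a' m); split => //.
  exact: IH.
by move=> m; rewrite h addrA.
Qed.

Hypothesis c01 : forall i, 0 < c i < 1.
Hypothesis N0 : forall i, (0 < N i)%N.

Lemma lag_ge a b i : lag a b (c i) (N i) -> (forall m, 0 <= b m) ->
  forall m, 0 <= a m /\ b m <= a m.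
Proof.
move=> ab b0; have ci0 : 0 <= c i by case/andP: (c01 i) => /ltW.
suff a0 m : 0 <= a m.
  by move=> m; split => //; rewrite ab lerDl; case: ifP => // _; rewrite mulr_ge0.
have [k] := ubnP m; elim: k m => // k IH m mk; rewrite ab addr_ge0//.
case: ifP => // Nm; rewrite mulr_ge0// IH//; have := N0 i; lia.
Qed.

Lemma term_ge B m0 I a : 0 <= B -> is_term B m0 I a ->
  (forall m, 0 <= a m) /\ B <= a m0.
Proof.
move=> B0; elim: I a => [|i I IH] a /=.
  by move=> aE; split=> [m|]; rewrite aE ?eqxx//; case: ifP.
move=> [b /IH[b0 Bb] ab]; have h := lag_ge ab b0; split=> [m|].
  by have [] := h m.
by apply: le_trans Bb _; have [] := h m0.
Qed.

(** A lag recursion only adds non-negative quantities, so along the progression m0 + N_i e the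
    coefficients lose at most a factor c_i at each step. *)
Lemma term_lower_bound B m0 I a i e : 0 <= B -> is_term B m0 I a -> i \in I ->
  B * c i ^+ e <= a (m0 + N i * e)%N.
Proof.
move=> B0; elim: I a => // j I IH a /= [b tb ab] ij.
have [b0 Bb] := term_ge B0 tb; have h := lag_ge ab b0.
move: ij; rewrite inE => /orP[/eqP ->{IH}|iI]; last first.
  by apply: le_trans (IH _ tb iI) _; have [] := h (m0 + N i * e)%N.
elim: e => [|e IHe]; first by rewrite expr0 mulr1 muln0 addn0 (le_trans Bb)//; have [] := h m0.
rewrite ab ifT; last by rewrite mulnS; lia.
rewrite -[X in X <= _]add0r lerD// exprS mulrCA ler_wpM2l//.
  by case/andP: (c01 j) => /ltW.
by rewrite (_ : (_ - _)%N = (m0 + N j * e)%N)//; rewrite mulnS; lia.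
Qed.

(** The partial sums A_M are monotone in M, so a lag gives A_M <= D + c tau^N A_M, which bounds A_M
    because c tau^N < 1. *)
Lemma term_bounded B m0 I a (tau : R) : 0 <= B -> 0 < tau ->
  (forall i, c i * tau ^+ N i < 1) -> is_term B m0 I a ->
  exists D : R, forall M, \sum_(m < M) a m * tau ^+ m <= D.
Proof.
move=> B0 tau0 ctau; elim: I a => [|i I IH] a /=.
  move=> aE; exists (B * tau ^+ m0) => M.
  have [mM|Mm] := ltnP m0 M.
    rewrite (bigD1 (Ordinal mM))//= aE eqxx big1 ?addr0// => k km.
    rewrite aE ifF ?mul0r//; apply: contra_neqF km => /eqP km; exact/val_inj.
  rewrite big1 ?mulr_ge0 ?exprn_ge0 ?(ltW tau0)// => k _; rewrite aE ifF ?mul0r//.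
  by apply/negbTE; rewrite neq_ltn (leq_trans (ltn_ord k) Mm).
move=> [b tb ab]; have [D hD] := IH _ tb.
have [b0 _] := term_ge B0 tb; have h := lag_ge ab b0.
have ct1 : 0 < 1 - c i * tau ^+ N i by rewrite subr_gt0.
have ct0 : 0 <= c i * tau ^+ N i.
  by rewrite mulr_ge0 ?exprn_ge0 ?(ltW tau0)//; case/andP: (c01 i) => /ltW.
have ge0 m : 0 <= a m * tau ^+ m.
  by rewrite mulr_ge0 ?exprn_ge0 ?(ltW tau0)//; have [] := h m.
exists (D / (1 - c i * tau ^+ N i)) => M; pose A k := \sum_(m < k) a m * tau ^+ m.
have A0 k : 0 <= A k by exact: sumr_ge0.
have AA k k' : (k <= k')%N -> A k <= A k'.
  move=> kk'; rewrite /A -!(big_mkord xpredT (fun m => a m * tau ^+ m)).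
  by rewrite (big_cat_nat _ kk')//= lerDl sumr_ge0.
have : A M <= D + c i * tau ^+ N i * A M.
  rewrite {1}/A (lag_partial_sum _ _ ab); apply: lerD; first exact: hD.
  by case: ifP => [NM|_]; [apply: (ler_wpM2l ct0); apply: AA; exact: leq_subr|exact: mulr_ge0].
by rewrite -/(A M) ler_pdivlMr// mulrBr mulr1 lerBlDr (mulrC (A M)).
Qed.

Lemma sum_of_terms_ge0 ts a : (forall t : R * nat * seq T, t \in ts -> 0 <= t.1.1) ->
  is_sum_of_terms ts a -> forall m, 0 <= a m.
Proof.
elim: ts a => [|t ts IH] a Bts /=; first by move=> h m; rewrite h.
move=> [a1 [a2 [h1 h2 h]]] m; rewrite h addr_ge0//.
  by have [] := term_ge (Bts t (mem_head _ _)) h1.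
by apply: (IH a2) => // u uts; apply: Bts; rewrite inE uts orbT.
Qed.

Lemma sum_of_terms_lower_bound ts a t i e : (forall t : R * nat * seq T, t \in ts -> 0 <= t.1.1) ->
  is_sum_of_terms ts a -> t \in ts -> i \in t.2 ->
  t.1.1 * c i ^+ e <= a (t.1.2 + N i * e)%N.
Proof.
elim: ts a => // u ts IH a Bts [a1 [a2 [h1 h2 h]]].
have Bts' v : v \in ts -> 0 <= v.1.1 by move=> vts; apply: Bts; rewrite inE vts orbT.
have Bu := Bts u (mem_head _ _).
have [a10 _] := term_ge Bu h1; have a20 := sum_of_terms_ge0 Bts' h2.
rewrite inE => /orP[/eqP ->|tts] iI; rewrite h.
  by apply: le_trans (term_lower_bound e Bu h1 iI) _; rewrite lerDl.
by apply: le_trans (IH _ Bts' h2 tts iI) _; rewrite lerDr.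
Qed.

Lemma sum_of_terms_bounded ts a (tau : R) : (forall t : R * nat * seq T, t \in ts -> 0 <= t.1.1) ->
  0 < tau -> (forall i, c i * tau ^+ N i < 1) -> is_sum_of_terms ts a ->
  exists D : R, forall M, \sum_(m < M) a m * tau ^+ m <= D.
Proof.
move=> + tau0 ctau; elim: ts a => [|t ts IH] a Bts /=.
  by move=> h; exists 0 => M; rewrite big1// => m _; rewrite h mul0r.
move=> [a1 [a2 [h1 h2 h]]].
have [D1 hD1] := term_bounded (Bts t (mem_head _ _)) tau0 ctau h1.
have [|D2 hD2] := IH a2 _ h2.
  by move=> v vts; apply: Bts; rewrite inE vts orbT.
exists (D1 + D2) => M; under eq_bigr do rewrite h mulrDl.
by rewrite big_split /=; apply: lerD; [exact: hD1|exact: hD2].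
Qed.

Local Open Scope complex_scope.

Definition term_value (u : R * nat * seq T) (t : R[i]) : R[i] :=
  u.1.1%:C * t ^+ u.1.2 * \prod_(i <- u.2) (1 - (c i)%:C * t ^+ N i)^-1.

Lemma has_sum_term B m0 I a (t : R[i]) : `|t| < 1 -> is_term B m0 I a ->
  has_sum (fun m => (a m)%:C) t (term_value (B, m0, I) t).
Proof.
move=> t1; elim: I a => [|i I IH] a /=.
  move=> aE; rewrite /term_value big_nil mulr1 /=.
  apply: eq_has_sum (has_sum_delta B%:C m0 (ltW t1)) => m /=.
  by rewrite aE; case: ifP.
move=> [b /IH hb ab]; rewrite /term_value /= big_cons mulrCA mulrC.
apply: (has_sum_lag (N0 i)) hb => //.
  rewrite ger0_norm; last by rewrite lecR; case/andP: (c01 i) => /ltW.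
  by rewrite (ltcR _ 1); case/andP: (c01 i).
by move=> m; rewrite ab rmorphD/=; case: ifP => // _; rewrite rmorphM.
Qed.

Lemma has_sum_sum_of_terms ts a (t : R[i]) : `|t| < 1 -> is_sum_of_terms ts a ->
  has_sum (fun m => (a m)%:C) t (\sum_(u <- ts) term_value u t).
Proof.
move=> t1; elim: ts a => [|u ts IH] a /=.
  by move=> h; rewrite big_nil; apply: eq_has_sum (has_sum0 t) => m; rewrite h.
move=> [a1 [a2 [h1 h2 h]]]; rewrite big_cons.
have hu : has_sum (fun m => (a1 m)%:C) t (term_value u t).
  by case: u h1 => [[B m0] I]; exact: has_sum_term.
by apply: eq_has_sum (has_sumD hu (IH _ h2)) => m; rewrite h rmorphD.
Qed.

End Terms.

(** * The complex exponential *)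

Section RealTaylor.
Context {R : realType}.

(** By the mean value theorem a bound of order k on the derivative becomes one of order k + 1; the
    Taylor estimates below iterate this. *)
Lemma le_norm_antiderivative (f df : R -> R) (C : R) (k : nat) :
  (forall x : R, is_derive x 1 f (df x)) -> f 0 = 0 ->
  (forall x : R, `|x| <= 1 -> `|df x| <= C * `|x| ^+ k) ->
  forall x : R, `|x| <= 1 -> `|f x| <= C * `|x| ^+ k.+1.
Proof.
move=> fdf f0 hdf x x1.
have cf : continuous f.
  by move=> y; apply/differentiable_continuous/derivable1_diffP; have [] := fdf y.
have C0 : 0 <= C by have := hdf 1; rewrite normr1 expr1n mulr1 => /(_ (lexx _)); exact: le_trans.
have bound c : `|c| <= `|x| -> `|df c * x| <= C * `|x| ^+ k.+1.
  move=> cx; rewrite normrM exprSr mulrA ler_wpM2r//.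
  apply: le_trans (hdf c (le_trans cx x1)) _; rewrite ler_wpM2l//.
  by apply: lerXn2r; rewrite ?nnegrE.
have [x0|x0] := leP 0 x.
  have [|c] := MVT_segment x0 (fun y _ => fdf y); first exact: continuous_subspaceT.
  rewrite in_itv/= f0 !subr0 => /andP[c0 cx] ->; apply: bound.
  by rewrite !ger0_norm.
have [|c] := MVT_segment (ltW x0) (fun y _ => fdf y); first exact: continuous_subspaceT.
rewrite in_itv/= f0 !sub0r => /andP[c0 cx] fx.
rewrite -normrN fx mulrN normrN; apply: bound.
by rewrite !ler0_norm ?lerN2// ltW.
Qed.

Lemma sin_taylor1 (x : R) : `|x| <= 1 -> `|sin x| <= `|x|.
Proof.
move=> x1; rewrite -[leRHS]mul1r -[`|x| in leRHS]expr1.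
apply: (le_norm_antiderivative (df := cos)) => //; first exact: sin0.
by move=> y _; rewrite expr0 mulr1; exact: cos_max.
Qed.

Lemma cos_taylor2 (x : R) : `|x| <= 1 -> `|1 - cos x| <= `|x| ^+ 2.
Proof.
move=> x1; rewrite -[leRHS]mul1r.
apply: (le_norm_antiderivative (f := fun x => 1 - cos x) (df := sin)) => //.
- move=> y; apply: is_derive_eq; rewrite add0r opprK; exact: mul1r.
- by rewrite cos0 subrr.
- by move=> y y1; rewrite expr1 mul1r; exact: sin_taylor1.
Qed.

Lemma sin_taylor3 (x : R) : `|x| <= 1 -> `|x - sin x| <= `|x| ^+ 3.
Proof.
move=> x1; rewrite -[leRHS]mul1r.
apply: (le_norm_antiderivative (f := fun x => x - sin x) (df := fun x => 1 - cos x)) => //.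
- by rewrite sin0 subrr.
- by move=> y y1; rewrite mul1r; exact: cos_taylor2.
Qed.

Lemma cos_taylor4 (x : R) : `|x| <= 1 -> `|cos x - 1 + x ^+ 2 / 2| <= `|x| ^+ 3.
Proof.
move=> x1; apply: (@le_trans _ _ (1 * `|x| ^+ 4)); last first.
  by rewrite mul1r; apply: ler_wiXn2l.
apply: (le_norm_antiderivative (f := fun x => cos x - 1 + x ^+ 2 / 2)
  (df := fun x => x - sin x)) => //.
- move=> y; apply: is_derive_eq; rewrite /GRing.scale /=.
  by field.
- by rewrite cos0 subrr expr0n mul0r addr0.
- by move=> y y1; rewrite mul1r; exact: sin_taylor3.
Qed.

Lemma expR_taylor3 (x : R) : `|x| <= 1 ->
  `|expR x - 1 - x - x ^+ 2 / 2| <= expR 1 * `|x| ^+ 3.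
Proof.
move=> x1.
apply: (le_norm_antiderivative (f := fun x => expR x - 1 - x - x ^+ 2 / 2)
  (df := fun x => expR x - 1 - x)) x1.
- move=> y; apply: is_derive_eq; rewrite /GRing.scale /=.
  by field.
- by rewrite expR0 subrr expr0n mul0r !subr0.
apply: (le_norm_antiderivative (df := fun x => expR x - 1)).
- move=> y; apply: is_derive_eq; by rewrite subr0.
- by rewrite expR0 subrr subr0.
apply: (le_norm_antiderivative (df := expR)).
- move=> y; apply: is_derive_eq; by rewrite subr0.
- by rewrite expR0 subrr.
move=> y y1; rewrite expr0 mulr1 ger0_norm ?expR_ge0// ler_expR.
exact: le_trans (ler_norm _) y1.
Qed.
End RealTaylor.

Section ComplexExponential.
Context {R : realType}.
Local Open Scope complex_scope.
Implicit Types z w : R[i].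

Definition cexp z : R[i] :=
  expR (complex.Re z) * cos (complex.Im z) +i* (expR (complex.Re z) * sin (complex.Im z)).

Lemma cexpD z w : cexp (z + w) = cexp z * cexp w.
Proof.
case: z w => [a b] [c d]; rewrite /cexp /= expRD cosD sinD.
by apply/eqP; rewrite eq_complex /=; apply/andP; split; apply/eqP; ring.
Qed.

Lemma cexp_real (x : R) : cexp x%:C = (expR x)%:C.
Proof. by rewrite /cexp /= cos0 sin0 mulr1 mulr0. Qed.

Lemma cexp0 : cexp 0 = 1.
Proof. by rewrite (cexp_real 0) expR0. Qed.

Lemma cexpNz z : cexp (- z) * cexp z = 1.
Proof. by rewrite -cexpD addNr cexp0. Qed.

Lemma cexp_neq0 z : cexp z != 0.
Proof. by apply: contra_eq_neq (cexpNz z) => ->; rewrite mulr0 eq_sym oner_neq0. Qed.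

Lemma cexpN z : cexp (- z) = (cexp z)^-1.
Proof.
by apply: (mulIf (cexp_neq0 z)); rewrite cexpNz mulVf ?cexp_neq0.
Qed.

Lemma cexp_natl z k : cexp (k%:R * z) = cexp z ^+ k.
Proof.
elim: k => [|k IH]; first by rewrite mul0r cexp0.
by rewrite -natr1 mulrDl mul1r cexpD IH exprSr.
Qed.

Lemma norm_cexp z : `|cexp z| = (expR (complex.Re z))%:C.
Proof.
rewrite normc_def /cexp /=; congr (_%:C).
by rewrite !exprMn -mulrDr cos2Dsin2 mulr1 sqrtr_sqr ger0_norm ?expR_ge0.
Qed.

Lemma normC_Re z : (`|complex.Re z|)%:C <= `|z|. Proof. exact: normc_ge_Re. Qed.

Lemma normC_real (x : R) : `|x%:C| = `|x|%:C.
Proof. by rewrite normc_def /= expr0n addr0 sqrtr_sqr. Qed.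

Lemma normC_i : `|'i%C : R[i]| = 1.
Proof. by rewrite normc_def /= expr0n expr1n add0r sqrtr1. Qed.

Lemma normC_Im z : (`|complex.Im z|)%:C <= `|z|.
Proof.
case: z => a b; rewrite normc_def /= lecR -sqrtr_sqr ler_wsqrtr//.
by rewrite lerDr sqr_ge0.
Qed.

Lemma normC_le (a b : R) : `|a +i* b| <= (`|a| + `|b|)%:C.
Proof.
have -> : a +i* b = a%:C + 'i%C * b%:C by exact: complexE (a +i* b).
apply: le_trans (ler_normD _ _) _.
by rewrite normrM normC_i mul1r !normC_real rmorphD.
Qed.

(** Third order is what differentiating (e^w - 1)/w at 0 requires. Here [r1'], [r2], [r3] are the
    Taylor remainders of exp, cos and sin up to sign, while [s1] and [s2] collect the monomials of
    degree at least 3 in the product of the Taylor polynomials. *)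
Lemma cexp_taylor : exists2 C : R, 0 <= C &
  forall w, `|w| <= 1 -> `|cexp w - 1 - w - w ^+ 2 / 2| <= C%:C * `|w| ^+ 3.
Proof.
(* The three groups of errors [n1], [n2], [n3] contribute [expR 1], 6 and 3; the constant 100 leaves
   room. *)
exists (expR 1 + 100); first by rewrite addr_ge0// expR_ge0.
case=> x y w1; set w := x +i* y in w1 *.
have [r rE] : exists r : R, `|w| = r%:C by rewrite normc_def; eexists.
have xr : `|x| <= r by rewrite -lecR -rE; exact: (normC_Re w).
have yr : `|y| <= r by rewrite -lecR -rE; exact: (normC_Im w).
have r1 : r <= 1 by rewrite -(lecR _ 1) -rE.
have r0 : 0 <= r by apply: le_trans xr.
pose r1' := expR x - 1 - x - x ^+ 2 / 2.
pose r2 := cos y - 1 + y ^+ 2 / 2.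
pose r3 := sin y - y.
have h1 : `|r1'| <= expR 1 * r ^+ 3.
  apply: le_trans (expR_taylor3 (le_trans xr r1)) _.
  by rewrite ler_wpM2l ?expR_ge0//; apply: lerXn2r; rewrite ?nnegrE.
have h2 : `|r2| <= r ^+ 3.
  by apply: le_trans (cos_taylor4 (le_trans yr r1)) _; apply: lerXn2r; rewrite ?nnegrE.
have h3 : `|r3| <= r ^+ 3.
  rewrite /r3 distrC; apply: le_trans (sin_taylor3 (le_trans yr r1)) _.
  by apply: lerXn2r; rewrite ?nnegrE.
have E1 : expR x = 1 + x + x ^+ 2 / 2 + r1' by rewrite /r1'; ring.
pose P := 1 + x + x ^+ 2 / 2.
pose s1 := - (x * y ^+ 2 / 2) - x ^+ 2 * y ^+ 2 / 4.
pose s2 := x ^+ 2 * y / 2.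
have -> : cexp w - 1 - w - w ^+ 2 / 2 =
  r1'%:C * (cos y +i* sin y) + P%:C * (r2 +i* r3) + (s1 +i* s2).
  have -> : w ^+ 2 / 2 = (2^-1)%:C * (w * w).
    by rewrite fmorphV rmorph_nat mulrC expr2.
  apply/eqP; rewrite eq_complex /= E1 /r2 /r3 /P /s1 /s2.
  by apply/andP; split; apply/eqP; field.
have r3E : `|w| ^+ 3 = (r ^+ 3)%:C by rewrite rE rmorphXn.
have r30 : 0 <= r ^+ 3 by rewrite exprn_ge0.
have P3 : `|P| <= 3.
  have x2 : `|x| ^+ 2 <= 1 by rewrite exprn_ile1// (le_trans xr).
  apply: le_trans (ler_normD _ _) _; apply: le_trans (lerD (ler_normD _ _) (lexx _)) _.
  rewrite normr1 normrM normrX (ger0_norm (_ : 0 <= 2^-1)) ?invr_ge0//.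
  by have := le_trans xr r1; lra.
have sq (a : R) : `|a| <= r -> `|a| ^+ 2 <= r ^+ 2.
  by move=> ar; apply: lerXn2r; rewrite ?nnegrE.
have m12 : `|x * y ^+ 2 / 2| <= r ^+ 3.
  rewrite normrM (ger0_norm (_ : 0 <= 2^-1)) ?invr_ge0// normrM normrX.
  rewrite -[leRHS]mulr1; apply: ler_pM; rewrite ?invr_ge0 ?mulr_ge0 ?exprn_ge0//.
    by rewrite (exprS r 2); apply: ler_pM; rewrite ?exprn_ge0 ?sq.
  by rewrite invf_le1// ler1n.
have m21 : `|s2| <= r ^+ 3.
  rewrite normrM (ger0_norm (_ : 0 <= 2^-1)) ?invr_ge0// normrM normrX.
  rewrite -[leRHS]mulr1; apply: ler_pM; rewrite ?invr_ge0 ?mulr_ge0 ?exprn_ge0//.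
    by rewrite (exprSr r 2); apply: ler_pM; rewrite ?exprn_ge0 ?sq.
  by rewrite invf_le1// ler1n.
have m22 : `|x ^+ 2 * y ^+ 2 / 4| <= r ^+ 3.
  rewrite normrM (ger0_norm (_ : 0 <= 4^-1)) ?invr_ge0// normrM !normrX.
  rewrite -[leRHS]mulr1; apply: ler_pM; rewrite ?invr_ge0 ?mulr_ge0 ?exprn_ge0//.
    rewrite (exprS r 2); apply: ler_pM; rewrite ?exprn_ge0 ?sq//.
    by rewrite expr2; apply: le_trans (xr); rewrite ler_piMr// (le_trans xr).
  by rewrite invf_le1// ler1n.
have n1 : `|r1'%:C * (cos y +i* sin y)| <= (expR 1 * r ^+ 3)%:C.
  have e1 : `|cos y +i* sin y| = 1 by rewrite normc_def /= cos2Dsin2 sqrtr1.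
  by rewrite normrM normC_real e1 mulr1 lecR.
have n2 : `|P%:C * (r2 +i* r3)| <= (3 * (r ^+ 3 + r ^+ 3))%:C.
  rewrite normrM normC_real rmorphM; apply: ler_pM => //; rewrite ?lecR//.
  by rewrite -lecR; apply: le_trans (normC_le _ _) _; rewrite lecR lerD.
have n3 : `|s1 +i* s2| <= (3 * r ^+ 3)%:C.
  apply: le_trans (normC_le _ _) _; rewrite lecR.
  have : `|s1| <= r ^+ 3 + r ^+ 3.
    by apply: le_trans (ler_normB _ _) _; rewrite normrN lerD.
  by move: m21; lra.
rewrite r3E -rmorphM/=; apply: le_trans (ler_normD _ _) _.
apply: le_trans (lerD (ler_normD _ _) n3) _.
apply: le_trans (lerD (lerD n1 n2) (lexx _)) _.
rewrite -!rmorphD lecR /=; move: r30; lra.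
Qed.

(** The entire function (e^w - 1)/w with its removable singularity filled in. It isolates the zero
    of 1 - c t^N at a pole. *)
Definition cexp_quot (w : R[i]) : R[i] := if w == 0 then 1 else (cexp w - 1) / w.

End ComplexExponential.

(** * Complex differentiability of the exponential *)

Section Derivable.
Context {R : realType}.
Local Open Scope complex_scope.
Local Notation C := (R[i]^o).
Implicit Types (f g : C -> C) (s z w : C).

Lemma derivable_of_bound f s (l : R[i]) (D d : R) : 0 <= D -> 0 < d ->
  (forall h : R[i], h != 0 -> `|h| < d%:C -> `|(f (s + h) - f s) / h - l| <= D%:C * `|h|) ->
  derivable f s 1.
Proof.
move=> D0 d0 H; apply/cvg_ex; exists l.
apply/cvgrPdist_lt => e e0.
have D1 : 0 < D%:C + 1 :> R[i] by rewrite ltr_wpDl// lecR.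
near=> h.
have h0 : h != 0 by near: h; exact: nbhs_dnbhs_neq.
have hd : `|h| < d%:C.
  near: h; apply: dnbhs0_lt; by rewrite ltcR.
have he : `|h| < e / (D%:C + 1).
  near: h; apply: dnbhs0_lt; by rewrite divr_gt0.
rewrite distrC /= /GRing.scale /= mulr1 mulrC [h + s]addrC.
apply: le_lt_trans (H h h0 hd) _.
apply: (@le_lt_trans _ _ ((D%:C + 1) * `|h|)).
  by rewrite ler_wpM2r// lerDl.
by rewrite mulrC -ltr_pdivlMr.
Unshelve. all: by end_near. Qed.

Lemma cexp_bound1 : exists2 D : R, 0 <= D &
  forall w : R[i], `|w| <= 1 -> `|cexp w - 1 - w| <= D%:C * `|w| ^+ 2.
Proof.
have [D D0 hD] := @cexp_taylor R; exists (D + 1); first by rewrite addr_ge0.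
move=> w w1; rewrite -(subrK (w ^+ 2 / 2) (cexp w - 1 - w)).
apply: le_trans (ler_normD _ _) _; rewrite rmorphD mulrDl mul1r.
apply: lerD.
  apply: le_trans (hD w w1) _; rewrite ler_wpM2l ?lecR//.
  exact: ler_wiXn2l.
rewrite normrM normrX ler_piMr ?exprn_ge0// normfV invf_le1 ?normr_gt0//.
  by rewrite ger0_norm// ler1n.
Qed.

Lemma derivable_cexp (al : R[i]) s : derivable (fun s : C => cexp (al * s) : C) s 1.
Proof.
have [D D0 hD] := cexp_bound1.
have [A AE] : exists A : R, `|al| = A%:C by rewrite normc_def; eexists.
have A0 : 0 <= A by rewrite -ler0c -AE.
have [S SE] : exists S : R, `|cexp (al * s)| = S%:C by rewrite normc_def; eexists.
have S0 : 0 <= S by rewrite -ler0c -SE.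
(* The radius keeps the norm of [al * h] at most 1, where the Taylor bound applies; the + 1 covers
   [al = 0]. *)
apply: (@derivable_of_bound _ _ (cexp (al * s) * al) (S * (D * A ^+ 2)) (A + 1)^-1).
- by rewrite !mulr_ge0 ?exprn_ge0.
- by rewrite invr_gt0 ltr_wpDl.
move=> h h0 hd; rewrite mulrDr cexpD.
have -> : (cexp (al * s) * cexp (al * h) - cexp (al * s)) / h - cexp (al * s) * al =
  cexp (al * s) * ((cexp (al * h) - 1 - al * h) / h) by field.
rewrite normrM SE rmorphM -mulrA ler_wpM2l ?lecR// normrM normfV.
rewrite ler_pdivrMr ?normr_gt0//.
have A1 : 0 < A + 1 by rewrite ltr_wpDl.
have ah : `|al * h| <= 1.
  rewrite normrM AE; apply: (@le_trans _ _ (A%:C * ((A + 1)^-1)%:C)).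
    by apply: ler_wpM2l; [rewrite ler0c|exact: ltW].
  by rewrite -rmorphM (lecR _ 1) ler_pdivrMr// mul1r lerDl.
apply: le_trans (hD _ ah) _; rewrite normrM AE rmorphM rmorphXn exprMn.
by rewrite -!mulrA -expr2.
Qed.

End Derivable.

(** * Orders and leading coefficients of poles *)

Section Poles.
Context {R : realType}.
Local Open Scope complex_scope.
Local Notation C := (R[i]^o).
Implicit Types (f g h F G : C -> C) (s z w u : C).

Lemma derivable_continuous f s : derivable f s 1 -> {for s, continuous f}.
Proof.
move=> fs; apply: (@differentiable_continuous R[i] C C s f).
by have [+ _] := @derivable1_diffP R[i] C f s; apply.
Qed.

Lemma holomorphic_cst u s : holomorphic_at (fun=> u) s.
Proof. by near=> z; exact: derivable_cst. Unshelve. all: by end_near. Qed.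

Lemma holomorphicD f g s : holomorphic_at f s -> holomorphic_at g s ->
  holomorphic_at (fun z => f z + g z) s.
Proof. by move=> hf hg; apply: filterS2 hf hg => z; exact: derivableD. Qed.

Lemma holomorphicM f g s : holomorphic_at f s -> holomorphic_at g s ->
  holomorphic_at (fun z => f z * g z) s.
Proof. by move=> hf hg; apply: filterS2 hf hg => z; exact: (@derivableM R[i] C f g). Qed.

Lemma holomorphicV f s : holomorphic_at f s -> f s != 0 ->
  holomorphic_at (fun z => (f z)^-1) s.
Proof.
move=> hf fs0; have cf := derivable_continuous (nbhs_singleton hf).
have f0 : \forall z \near s, f z != 0 by exact: cvgr_neq0 cf fs0.
by apply: filterS2 hf f0 => z hz fz; exact: (@derivableV R[i] C f).
Qed.

Lemma holomorphic_cexp (al : R[i]) s : holomorphic_at (fun z : C => cexp (al * z) : C) s.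
Proof. by near=> z; exact: derivable_cexp. Unshelve. all: by end_near. Qed.

Lemma holomorphic_subX s z k : holomorphic_at (fun w : C => (w - s) ^+ k) z.
Proof.
elim: k => [|k IH]; first exact: holomorphic_cst.
have -> : (fun w : C => (w - s) ^+ k.+1) = (fun w => (w - s) * (w - s) ^+ k).
  by apply/funext => w; rewrite exprS.
apply: holomorphicM; last exact: IH.
apply: holomorphicD; last exact: holomorphic_cst.
by near=> w; exact: derivable_id.
Unshelve. all: by end_near. Qed.

(** The coefficient u may be 0, in which case m is only an upper bound for the order. This keeps the
    property stable under sums and products without case distinctions; [pole_orderP] asks for u !=
    0. *)
Definition pole_order F s (m : nat) u := exists h, [/\ holomorphic_at h s, h s = u
  & \forall z \near s^', F z = h z / (z - s) ^+ m].

Lemma pole_order_holomorphic F s : holomorphic_at F s -> pole_order F s 0 (F s).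
Proof.
move=> hF; exists F; split; [exact: hF|by []|].
by near=> z; rewrite expr0 divr1.
Unshelve. all: by end_near. Qed.

Lemma pole_orderM F G s m k u w : pole_order F s m u -> pole_order G s k w ->
  pole_order (fun z => F z * G z) s (m + k) (u * w).
Proof.
move=> [f [hf <- hF]] [g [hg <- hG]]; exists (fun z => f z * g z).
split; [exact: holomorphicM hf hg|by []|].
by apply: filterS2 hF hG => z -> ->; rewrite exprD invfM mulrACA.
Qed.

Lemma pole_orderD F G s m u w : pole_order F s m u -> pole_order G s m w ->
  pole_order (fun z => F z + G z) s m (u + w).
Proof.
move=> [f [hf <- hF]] [g [hg <- hG]]; exists (fun z => f z + g z).
split; [exact: holomorphicD hf hg|by []|].
by apply: filterS2 hF hG => z -> ->; rewrite mulrDl.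
Qed.

Lemma pole_order_raise F s m k u : pole_order F s m u ->
  (m < k)%N -> pole_order F s k 0.
Proof.
move=> [f [hf _ hF]] mk; have -> : k = (m + (k - m).-1.+1)%N by lia.
move: (k - m).-1 => {mk}k.
exists (fun z => f z * (z - s) ^+ k.+1); split.
- by apply: holomorphicM; [exact: hf|exact: holomorphic_subX].
- by rewrite subrr expr0n mulr0.
have : \forall z \near s^', z != s by exact: nbhs_dnbhs_neq.
apply: filterS2 hF => z -> zs; rewrite exprD; field.
by rewrite !expf_neq0 ?subr_eq0.
Unshelve. all: by end_near. Qed.

Lemma pole_order_meromorphic F s m u : pole_order F s m u -> meromorphic_at F s.
Proof. by move=> [h [hh _ hF]]; exists m, h. Qed.

Lemma pole_orderP F s m u : (0 < m)%N -> u != 0 -> pole_order F s m u -> is_pole F s.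
Proof. move=> m0 u0 [h [hh hs hF]]; exists m, h; split; [exact: m0|exact: hh|by rewrite hs|exact: hF]. Qed.

(* Leading coefficients that are positive reals cannot cancel. *)
Lemma pole_orderD_pos F G s m k u w : 0 < u -> 0 < w ->
  pole_order F s m u -> pole_order G s k w ->
  exists2 v : C, 0 < v & pole_order (fun z => F z + G z) s (maxn m k) v.
Proof.
move=> u0 w0 pF pG; have [mk|km|mk] := ltngtP m k.
- by exists w => //; rewrite -[w]add0r; apply: pole_orderD pG; exact: pole_order_raise pF mk.
- by exists u => //; rewrite -[u]addr0; apply: (pole_orderD pF); exact: pole_order_raise pG km.
- by exists (u + w); [exact: addr_gt0|apply: (pole_orderD pF); rewrite mk].
Qed.

End Poles.

(** * Poles of sums of terms as functions of s *)

Section TermPoles.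
Context {R : realType}.
Local Open Scope complex_scope.
Local Notation C := (R[i]^o).
Implicit Types (f g h F G : C -> C) (s z w u : C).

(** Away from s0 this is a quotient of derivable functions; at s0 the third order Taylor bound gives
    the derivative al / 2. *)
Lemma derivable_cexp_quot_affine (al : R[i]) s0 s : al != 0 ->
  derivable (fun z : C => cexp_quot (al * (z - s0)) : C) s 1.
Proof.
move=> al0; have [->{s}|ss0] := eqVneq s s0; last first.
  have z0 : \forall z \near s, z - s0 != 0.
    have : {for s, continuous (fun z : C => z - s0)}.
      by apply: derivable_continuous; apply: derivableB; [exact: derivable_id|exact: derivable_cst].
    by move=> /cvgr_neq0; apply; rewrite subr_eq0.
  have eqf : \forall z \near s, (cexp (- (al * s0)) * cexp (al * z) - 1) *
      (al * (z - s0))^-1 = cexp_quot (al * (z - s0)).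
    apply: filterS z0 => z z0; rewrite /cexp_quot mulf_eq0 (negbTE al0) (negbTE z0) /=.
    by rewrite -cexpD; have -> : - (al * s0) + al * z = al * (z - s0) by rewrite mulrBr addrC.
  apply: (@near_eq_derivable R[i] C C _ _ s 1 eqf).
  apply: (@derivableM R[i] C (fun z : C => cexp (- (al * s0)) * cexp (al * z) - 1)
    (fun z : C => (al * (z - s0))^-1)).
    apply: (@derivableB R[i] C C (fun z : C => cexp (- (al * s0)) * cexp (al * z)) (fun=> 1) s 1);
      last exact: derivable_cst.
    apply: (@derivableM R[i] C (fun=> cexp (- (al * s0))) (fun z : C => cexp (al * z))).
      exact: derivable_cst.
    exact: derivable_cexp.
  apply: (@derivableV R[i] C (fun z : C => al * (z - s0))).
    by rewrite mulf_neq0 ?subr_eq0.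
  apply: (@derivableM R[i] C (fun=> al) (fun z : C => z - s0)).
    exact: derivable_cst.
  by apply: derivableB; [exact: derivable_id|exact: derivable_cst].
have [D D0 hD] := @cexp_taylor R.
have [A AE] : exists A : R, `|al| = A%:C by rewrite normc_def; eexists.
have A0 : 0 < A by rewrite -(ltcR 0) -AE normr_gt0.
apply: (@derivable_of_bound _ _ _ (al / 2 : R[i]) (D * A ^+ 2) A^-1).
- by apply: mulr_ge0 => //; apply: exprn_ge0; exact: ltW.
- by rewrite invr_gt0.
move=> h h0 hA; rewrite addrAC subrr add0r mulr0 /cexp_quot eqxx.
rewrite mulf_eq0 (negbTE al0) (negbTE h0) /=.
have w1 : `|al * h| <= 1.
  rewrite normrM AE mulrC -ler_pdivlMr ?ltcR// mul1r -fmorphV.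
  exact: ltW hA.
have -> : ((cexp (al * h) - 1) / (al * h) - 1) / h - al / 2 =
  (cexp (al * h) - 1 - al * h - (al * h) ^+ 2 / 2) / (al * h ^+ 2).
  by field; rewrite al0 h0.
rewrite normrM normfV ler_pdivrMr; last by rewrite normr_gt0 mulf_neq0 ?expf_neq0.
apply: le_trans (hD _ w1) _; rewrite (normrM al h) (normrM al (h ^+ 2)) normrX AE rmorphM rmorphXn exprMn.
rewrite [X in _ <= X](_ : _ = D%:C * (A%:C ^+ 3 * `|h| ^+ 3)); last by ring.
exact: lexx.
Qed.

Context {T : eqType}.
Variables (L : R) (c : T -> R) (N : T -> nat).
Hypothesis L0 : 0 < L.
Hypothesis c01 : forall i, 0 < c i < 1.
Hypothesis N0 : forall i, (0 < N i)%N.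

(** For L = ln q this is t = q^(-s). *)
Definition qpow (s : C) : C := cexp (- L%:C * s).

Lemma qpowX s k : qpow s ^+ k = cexp (- (L *+ k)%:C * s).
Proof. by rewrite /qpow -cexp_natl rmorphMn -mulr_natl; congr cexp; ring. Qed.

Lemma holomorphic_qpowX s k : holomorphic_at (fun z => qpow z ^+ k) s.
Proof.
have -> : (fun z => qpow z ^+ k) = (fun z : C => cexp (- (L *+ k)%:C * z) : C).
  by apply/funext => z; rewrite qpowX.
exact: holomorphic_cexp.
Qed.

Definition factor i s : C := (1 - (c i)%:C * qpow s ^+ N i)^-1.

Lemma pole_factor_regular i s : (c i)%:C * qpow s ^+ N i != 1 ->
  pole_order (factor i) s 0 (factor i s).
Proof.
move=> h; apply: pole_order_holomorphic; apply: holomorphicV; last first.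
  by rewrite subr_eq0 eq_sym.
have -> : (fun z => 1 - (c i)%:C * qpow z ^+ N i) =
  (fun z => 1 + (- (c i)%:C) * qpow z ^+ N i) by apply/funext => z; rewrite mulNr.
apply: holomorphicD; first exact: holomorphic_cst.
by apply: holomorphicM; [exact: holomorphic_cst|exact: holomorphic_qpowX].
Qed.

(** As c t^N = 1 at s, it equals e^w with w = al (z - s) and al = - L N. The factor 1/(1 - e^w) is
    then - 1/w divided by (e^w - 1)/w, which takes the value 1 at w = 0. *)
Lemma pole_factor_singular i s : (c i)%:C * qpow s ^+ N i = 1 ->
  pole_order (factor i) s 1 ((L *+ N i)%:C^-1).
Proof.
move=> ct; set al : R[i] := - (L *+ N i)%:C.
have LN0 : (L *+ N i)%:C != 0 :> R[i].
  by rewrite fmorph_eq0 gt_eqF// pmulrn_lgt0.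
have al0 : al != 0 by rewrite oppr_eq0.
exists (fun z : C => (- al)^-1 * (cexp_quot (al * (z - s)))^-1); split.
- apply: holomorphicM; first exact: holomorphic_cst.
  apply: holomorphicV; last by rewrite subrr mulr0 /cexp_quot eqxx oner_eq0.
  by near=> z; exact: derivable_cexp_quot_affine.
- by rewrite subrr mulr0 /cexp_quot eqxx invr1 mulr1 opprK.
have : \forall z \near s^', z != s by exact: nbhs_dnbhs_neq.
apply: filterS => z zs; have zs0 : z - s != 0 by rewrite subr_eq0.
have cE : (c i)%:C * qpow z ^+ N i = cexp (al * (z - s)).
  rewrite mulrBr cexpD cexpN mulrC /al -!qpowX.
  apply: (mulIf (expf_neq0 (N i) (cexp_neq0 (- L%:C * s)))).
  by rewrite -/(qpow s) mulfVK ?expf_neq0 ?cexp_neq0// -mulrA ct mulr1.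
rewrite /factor cE /cexp_quot mulf_eq0 (negbTE al0) (negbTE zs0) /= expr1.
(* If e^w = 1 at some z != s, both sides vanish, since the inverse of 0 is 0. *)
have [->|e1] := eqVneq (cexp (al * (z - s))) 1.
  by rewrite subrr invr0 mul0r invr0 mulr0 mul0r.
have e1' : cexp (al * (z - s)) - 1 != 0 by rewrite subr_eq0.
have key (e a w : R[i]) : e - 1 != 0 -> a != 0 -> w != 0 ->
    (1 - e)^-1 = (- a)^-1 / ((e - 1) / (a * w)) / w.
  move=> e0 a0 w0; have e0' : 1 - e != 0 by rewrite -opprB oppr_eq0.
  by field; rewrite ?a0 ?w0 ?e0 ?e0'.
exact: key.
Unshelve. all: by end_near. Qed.

Lemma pole_term (u : R * nat * seq T) s :
  exists m v, pole_order (fun z => term_value c N u (qpow z)) s m v.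
Proof.
case: u => [[B m0] I]; rewrite /term_value /=.
suff [m [v h]] : exists m v, pole_order (fun z => \prod_(i <- I) factor i z) s m v.
  exists (0 + m)%N, (B%:C * qpow s ^+ m0 * v); apply: pole_orderM h.
  apply: (pole_order_holomorphic (F := fun z => B%:C * qpow z ^+ m0)).
  by apply: holomorphicM; [exact: holomorphic_cst|exact: holomorphic_qpowX].
elim: I => [|i I [m [v h]]].
  exists 0%N, 1; have -> : (fun z => \prod_(i <- [::]) factor i z) = (fun=> 1).
    by apply/funext => z; rewrite big_nil.
  by apply: (pole_order_holomorphic (F := fun=> 1)); exact: holomorphic_cst.
have -> : (fun z => \prod_(j <- i :: I) factor j z) =
  (fun z => factor i z * \prod_(j <- I) factor j z).
  by apply/funext => z; rewrite big_cons.
have [ct|ct] := eqVneq ((c i)%:C * qpow s ^+ N i) 1.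
  by eexists; eexists; apply: pole_orderM h; exact: pole_factor_singular.
by eexists; eexists; apply: pole_orderM h; exact: pole_factor_regular.
Qed.

(** Only meromorphy at every s is wanted here, so both orders are raised beyond their maximum, at
    the price of the leading coefficient 0. *)
Lemma pole_sum_of_terms (ts : seq (R * nat * seq T)) s :
  exists m v, pole_order (fun z => \sum_(u <- ts) term_value c N u (qpow z)) s m v.
Proof.
elim: ts => [|u ts [m [v h]]].
  exists 0%N, 0; have -> : (fun z => \sum_(u <- [::]) term_value c N u (qpow z)) = (fun=> 0).
    by apply/funext => z; rewrite big_nil.
  by apply: (pole_order_holomorphic (F := fun=> 0)); exact: holomorphic_cst.
have -> : (fun z => \sum_(v <- u :: ts) term_value c N v (qpow z)) =
  (fun z => term_value c N u (qpow z) + \sum_(v <- ts) term_value c N v (qpow z)).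
  by apply/funext => z; rewrite big_cons.
have [k [w hu]] := pole_term u s.
by exists (maxn m k).+1, (0 + 0); apply: pole_orderD;
  [apply: pole_order_raise hu _|apply: pole_order_raise h _]; lia.
Qed.

(** * Positivity of the leading coefficients at a real point *)

Variable x : R.
Notation tau := (expR (- (L * x))).
Hypothesis ctau : forall i, c i * tau ^+ N i <= 1.

Lemma qpow_real : qpow x%:C = tau%:C.
Proof. by rewrite /qpow -rmorphN -rmorphM cexp_real mulNr. Qed.

(** At a real point c t^N is real and at most 1. Either it is less than 1 and the factor is a
    positive number, or it is 1 and the pole has the leading coefficient 1/(L N). *)
Lemma pole_factor_real i : exists m v, [/\ pole_order (factor i) x%:C m v,
  0 < v & c i * tau ^+ N i = 1 -> (0 < m)%N].
Proof.
have cE : (c i)%:C * qpow x%:C ^+ N i = (c i * tau ^+ N i)%:C.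
  by rewrite qpow_real rmorphM rmorphXn.
have [ct|ct] := eqVneq (c i * tau ^+ N i) 1.
  exists 1%N, (L *+ N i)%:C^-1; split=> //.
    by apply: pole_factor_singular; rewrite cE ct.
  by rewrite invr_gt0 (ltcR 0) pmulrn_lgt0.
have h := @pole_factor_regular i x%:C; rewrite cE in h.
have ct1 : (c i * tau ^+ N i)%:C != 1 :> R[i].
  by apply: contra_neq ct => /(@complexI R).
exists 0%N, (factor i x%:C); split; first exact: h.
  rewrite /factor invr_gt0 cE subr_gt0 (ltcR _ 1) lt_neqAle ct; exact: ctau.
by move=> e; rewrite e eqxx in ct.
Qed.

Lemma pole_term_real (u : R * nat * seq T) : 0 < u.1.1 ->
  exists m v, [/\ pole_order (fun z => term_value c N u (qpow z)) x%:C m v,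
  0 < v & forall i, i \in u.2 -> c i * tau ^+ N i = 1 -> (0 < m)%N].
Proof.
case: u => [[B m0] I] /= B0; rewrite /term_value /=.
suff [m [v [h v0 hm]]] : exists m v, [/\ pole_order (fun z => \prod_(i <- I) factor i z) x%:C m v,
    0 < v & forall i, i \in I -> c i * tau ^+ N i = 1 -> (0 < m)%N].
  exists (0 + m)%N, (B%:C * qpow x%:C ^+ m0 * v); split.
  - apply: pole_orderM h.
    apply: (pole_order_holomorphic (F := fun z => B%:C * qpow z ^+ m0)).
    by apply: holomorphicM; [exact: holomorphic_cst|exact: holomorphic_qpowX].
  - by rewrite !mulr_gt0// ?(ltcR 0)// qpow_real exprn_gt0// (ltcR 0) expR_gt0.
  - by move=> i iI /(hm i iI).
elim: I => [|i I [m [v [h v0 hm]]]].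
  exists 0%N, 1; split=> //.
  have -> : (fun z => \prod_(i <- [::]) factor i z) = (fun=> 1).
    by apply/funext => z; rewrite big_nil.
  by apply: (pole_order_holomorphic (F := fun=> 1)); exact: holomorphic_cst.
have -> : (fun z => \prod_(j <- i :: I) factor j z) =
  (fun z => factor i z * \prod_(j <- I) factor j z).
  by apply/funext => z; rewrite big_cons.
have [k [w [hi w0 hk]]] := pole_factor_real i.
exists (k + m)%N, (w * v); split; [exact: pole_orderM hi h|exact: mulr_gt0|].
move=> j; rewrite inE => /orP[/eqP ->/hk|jI /(hm j jI)]; lia.
Qed.

Lemma pole_sum_of_terms_real (ts : seq (R * nat * seq T)) :
  (forall u : R * nat * seq T, u \in ts -> 0 < u.1.1) -> ts != [::] ->
  exists m v, [/\ pole_order (fun z => \sum_(u <- ts) term_value c N u (qpow z)) x%:C m v,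
  0 < v & forall (u : R * nat * seq T) i, u \in ts -> i \in u.2 ->
    c i * tau ^+ N i = 1 -> (0 < m)%N].
Proof.
elim: ts => // u ts IH Bts _.
have [k [w [hu w0 hk]]] := pole_term_real (Bts u (mem_head _ _)).
have [ts0|ts0] := eqVneq ts [::].
  exists k, w; split=> //.
    rewrite ts0; have -> : (fun z => \sum_(u <- [:: u]) term_value c N u (qpow z)) =
      (fun z => term_value c N u (qpow z)) by apply/funext => z; rewrite big_seq1.
    exact: hu.
  by rewrite ts0 => v i; rewrite inE => /eqP ->; exact: hk.
have [|//|m [v [h v0 hm]]] := IH.
  by move=> v vts; apply: Bts; rewrite inE vts orbT.
have -> : (fun z => \sum_(v <- u :: ts) term_value c N v (qpow z)) =
  (fun z => term_value c N u (qpow z) + \sum_(v <- ts) term_value c N v (qpow z)).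
  by apply/funext => z; rewrite big_cons.
have [y y0 hy] := pole_orderD_pos w0 v0 hu h.
exists (maxn k m), y; split; [exact: hy|exact: y0|].
move=> u' i; rewrite inE => /orP[/eqP ->|u'ts] iI e.
  by have := hk i iI e; lia.
by have := hm u' i u'ts iI e; lia.
Qed.

End TermPoles.

(** * The resolved space *)

Lemma compact_set_type (X : topologicalType) (U : set X) :
  compact U -> compact [set: set_type U].
Proof.
move=> cU F FF _; have GU : (set_val @ F) U.
  change (F (set_val @^-1` U)); have -> : set_val @^-1` U = [set: set_type U].
    by apply/seteqP; split => // x _; exact: set_valP.
  exact: filterT.
have [p [Up clp]] := cU _ _ GU.
exists (exist _ p (mem_set Up)); split => // A B FA.
rewrite nbhsE => -[W [[W' oW' W'W] Wp] WB].
have GA : (set_val @ F) (set_val @` A).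
  change (F (set_val @^-1` (set_val @` A))).
  by apply: filterS FA => x Ax; exists x.
have W'p : nbhs p W'.
  by apply: open_nbhs_nbhs; split => //; move: Wp; rewrite -W'W.
have [_ [[x Ax <-] W'x]] := clp _ _ GA W'p.
by exists x; split => //; apply: WB; rewrite -W'W.
Qed.

(** By compactness b has a closed neighborhood inside V and P. For a ball contained in the image of
    its interior, W lies in this closed set, which makes W closed in the whole space and not merely
    in V. *)
Lemma chart_ball_nbhs (R : realType) (K : padicFieldType R) (n : nat)
    (X : topologicalType) (V P : set X) (y : X -> 'rV[K]_n) b :
  hausdorff_space X -> compact [set: X] -> is_chart V y -> V b -> nbhs b P ->
  exists k, let W := V `&` (y @^-1` ballK (y b) k) in
    [/\ open W, closed W, W `<=` P & y @` W = ballK (y b) k].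
Proof.
move=> hX cX [oV yinj ycont yopen] Vb bP.
have bVP : nbhs b (V `&` P) by apply: filterI => //; exact: open_nbhs_nbhs.
have [B bB clB] := @compact_regular X b _ hX cX filterT _ bVP.
have oB : open (y @` (closure B)°).
  apply: yopen; first exact: open_interior.
  by move=> x /interior_subset/clB[].
have [k kB] : exists k, ballK (y b) k `<=` y @` (closure B)°.
  have /open_normK/(_ (y b)) [|k kB] := oB; last by exists k.
  by exists b => //; apply: filterS bB; exact: subset_closure.
have WB : V `&` y @^-1` ballK (y b) k `<=` closure B.
  move=> x [Vx /kB[c cB yc]]; have /interior_subset cB' := cB.
  by have [Vc _] := clB _ cB'; rewrite -(yinj _ _ Vc Vx yc).
exists k; split.
- rewrite openE => x [Vx yx]; apply: filterI; first exact: open_nbhs_nbhs.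
  by apply: ycont => //; apply: open_nbhs_nbhs; split => //; exact: ballK_open.
- have -> : V `&` y @^-1` ballK (y b) k = ~` (~` closure B `|` (V `&` y @^-1` (~` ballK (y b) k))).
    apply/seteqP; split => x.
      move=> [Vx yx] [|[_]]; last by apply.
      by apply; apply: WB.
    move=> nx; have Bx : closure B x by apply: contrapT => h; apply: nx; left.
    have [Vx _] := clB _ Bx; split => //.
    by apply: contrapT => h; apply: nx; right.
  apply: open_closedC; apply: openU; first by apply: closed_openC; exact: closed_closure.
  rewrite openE => x [Vx yx]; apply: filterI; first exact: open_nbhs_nbhs.
  apply: ycont => //; apply: open_nbhs_nbhs; split => //.
  by apply: closed_openC; exact: ballK_closed.
- by move=> x /WB/clB[].
apply/seteqP; split => [_ [x [_ yx] <-]//|z zk].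
have [x /interior_subset xB xz] := kB z zk.
by exists x => //; split; [have [] := clB _ xB|rewrite /preimage /mkset xz].
Qed.

Section Resolution.
Context {R : realType} {K : padicFieldType R} {n l : nat}.
Context {U : set 'rV[K]_n} {f : 'rV[K]_n -> 'rV[K]_l}.
Hypothesis U_compact : compact U.
Hypothesis U_open : open U.
Hypothesis f_analytic : analytic_map_on U f.
Hypothesis f_nontrivial : forall W : set 'rV[K]_n, open W -> W !=set0 -> W `<=` U ->
  exists2 x, W x & f x != 0.
Context {X : @charted_space R K n} {sigma : X -> open_manifold U}.
Context {T : finType} {E : T -> set X} {N v : T -> nat}.
Hypothesis log_res : log_principalization f sigma E N v.
Notation rho := (rhoK K).

Definition resolve (x : X) : 'rV[K]_n := set_val (sigma x).
Notation s := resolve.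

Lemma resolve_in x : U (s x). Proof. exact: set_valP. Qed.

Lemma resolve_continuous : continuous s.
Proof.
have [[_ _ [cs _] _ _] _ _ _] := log_res.
move=> x; apply: continuous_comp; first exact: cs.
exact: initial_continuous.
Qed.

Lemma resolved_compact : compact [set: X].
Proof.
have [[_ _ [_ ps] _ _] _ _ _] := log_res.
by have := ps _ (compact_set_type U_compact); rewrite preimage_setT.
Qed.

Lemma resolved_hausdorff : hausdorff_space X.
Proof. by have [[[hX _ _ _] _ _ _ _] _ _ _] := log_res. Qed.

Lemma exceptionalE x : f (s x) = 0 <-> exists i, E i x.
Proof.
have [_ ZE _ _] := log_res.
have h : (sigma @^-1` zero_set f) x = (\bigcup_i E i) x by rewrite ZE.
split=> [fx|[i Eix]].
  have : (\bigcup_i E i) x by rewrite -h.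
  by case=> i _ Eix; exists i.
have : (sigma @^-1` zero_set f) x by rewrite h; exists i.
by [].
Qed.

Lemma resolve_inj x x' : f (s x) != 0 -> s x = s x' -> x = x'.
Proof.
have [[_ _ _ _ [k [k1 k2 _ _]]] _ _ _] := log_res.
move=> fx sxx'; have sx : sigma x = sigma x' by exact: val_inj.
have [|_ <-] := k1 x; first by move=> h; move: fx; rewrite h eqxx.
have [|_ {1}<-] := k1 x'; first by rewrite /preimage /= -sx => h; move: fx; rewrite h eqxx.
by rewrite sx.
Qed.

Lemma resolve_image_closed (A : set X) : closed A -> closed (s @` A).
Proof.
move=> cA; apply: compact_closed; first exact: rV_hausdorff.
apply: continuous_compact; first exact/continuous_subspaceT/resolve_continuous.
exact: subclosed_compact cA resolved_compact _.
Qed.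

Lemma resolve_image_compact (A : set X) : closed A -> compact (s @` A).
Proof.
move=> cA.
apply: continuous_compact; first exact/continuous_subspaceT/resolve_continuous.
exact: subclosed_compact cA resolved_compact _.
Qed.

(** The image is closed. If it missed a point of U, the open complement would contain a point with f
    != 0, and over such points sigma is an isomorphism. *)
Lemma resolve_surjective z : U z -> exists x, s x = z.
Proof.
move=> Uz; apply: contrapT => nz.
have oW : open (U `&` ~` (s @` [set: X])).
  apply: openI => //; apply: closed_openC; apply: resolve_image_closed.
  exact: closedT.
have [|x [Ux nx] fx] := f_nontrivial oW _ (@subIsetl _ _ _).
  by exists z; split => // -[x _ xz]; apply: nz; exists x.
have [[_ _ _ _ [k [k1 k2 _ _]]] _ _ _] := log_res.
pose x' : open_manifold U := exist _ x (mem_set Ux).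
have [|_ kx] := k2 x'; first by move=> h; move/eqP: fx; apply.
by apply: nx; exists (k x') => //; rewrite /resolve kx.
Qed.

(** A point of B shares its image with no other point of X, since f does not vanish there. Hence the
    image of B is the complement in U of the closed image of the complement of B. *)
Lemma resolve_image_open (B : set X) : open B -> (forall x, B x -> f (s x) != 0) ->
  open (s @` B).
Proof.
move=> oB fB; have -> : s @` B = U `&` ~` (s @` (~` B)).
  apply/seteqP; split => [_ [x Bx <-]|z [Uz nz]].
    split; first exact: resolve_in.
    by move=> [x' nx' /esym xx']; apply: nx'; rewrite -(resolve_inj (fB x Bx) xx').
  have [x xz] := resolve_surjective Uz.
  by exists x => //; apply: contrapT => nx; apply: nz; exists x.
apply: openI => //; apply: closed_openC; apply: resolve_image_closed.
exact: open_closedC.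
Qed.

Lemma f_continuous z : U z -> {for z, continuous f}.
Proof.
by move=> Uz; apply: continuous_normK => j; apply: analytic_continuous; exact: f_analytic.
Qed.

Lemma pullback_continuous : continuous (fun x => f (s x)).
Proof.
move=> x; apply: (@continuous_comp _ _ _ s f); first exact: resolve_continuous.
by apply: f_continuous; exact: resolve_in.
Qed.

Definition level (r : R) : set X := [set x | normK (f (s x)) = r].

Lemma level_open r : 0 < r -> open (level r).
Proof.
move=> r0; rewrite openE => x /= xr.
have fx : f (s x) != 0 by rewrite -normK_gt0 xr.
have := near_normK_eq (@pullback_continuous x) fx.
by apply: filterS => z; rewrite /level /mkset xr.
Qed.

Lemma level_closed r : 0 < r -> closed (level r).
Proof.
move=> r0; rewrite -[level r]setCK; apply: open_closedC; rewrite openE => x /= xr.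
have [fx|fx] := eqVneq (f (s x)) 0; last first.
  have := near_normK_eq (@pullback_continuous x) fx.
  by apply: filterS => z /= e h; apply: xr; rewrite /level /mkset -e.
have [k kr] := @rhoX_small R K _ r0.
have : \forall z \near x, ballK (f (s x)) k (f (s z)).
  exact: (@pullback_continuous x) (ballK_nbhs _ k).
apply: filterS => z; rewrite fx /ballK /mkset subr0 => h /= e.
by move: h; rewrite e leNgt kr.
Qed.

(** The origin lifts to a zero of f o sigma, which lies on some divisor; so the minimum lambda is
    taken over a non-empty set. *)
Lemma index_exists : f 0 = 0 -> U 0 -> exists i : T, True.
Proof.
move=> f0 U0; have [x sx] := resolve_surjective U0.
have [i _] : exists i, E i x by apply/exceptionalE; rewrite sx.
by exists i.
Qed.

Lemma mfd_analytic_continuous (h : X -> K) b : mfd_analytic_at h b ->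
  {for b, continuous h}.
Proof.
have [[[_ atl isc _] _ _ _ _] _ _ _] := log_res.
have [c [ac cb]] := atl b; have [_ _ cc _] := isc c ac.
move=> /(_ c ac cb)[g ga hg].
have gc : {for b, continuous (g \o c.2)}.
  by apply: continuous_comp; [exact: cc|exact: analytic_continuous].
have hb : h b = g (c.2 b) by exact: nbhs_singleton hg.
move=> A; rewrite hb => /gc gA.
have gA' : \forall x \near b, A (g (c.2 x)) by exact: gA.
have : \forall x \near b, A (h x) by apply: filterS2 hg gA' => x -> .
by [].
Qed.

(** * Monomial form of the norm of f o sigma and of the Jacobian near a point *)

Section LocalModel.
Variable b : X.
Let I := [pred i | `[< E i b >]].

(** Adding a high power of a uniformizer to every coordinate of [y b] leaves all divisors through b.
    At such points the generator of the pulled back ideal can be cancelled. *)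
Lemma generic_point (V : set X) (y : X -> 'rV[K]_n) (k : T -> 'I_n) (Q : set X) :
  is_chart V y -> V b -> nbhs b Q -> (forall i, I i -> y b 0 (k i) = 0) ->
  exists x, [/\ Q x, V x & forall i, I i -> y x 0 (k i) != 0].
Proof.
move=> yc Vb Qb yb0.
have [m [_ _ WQ yW]] := chart_ball_nbhs resolved_hausdorff resolved_compact yc Vb Qb.
have [pi hpi] := @uniformizer R K.
have : ballK (y b) m (y b + const_mx (pi ^+ m)).
  rewrite /ballK /mkset addrAC subrr add0r; apply/normK_le; first exact: rhoX_ge0.
  by move=> i; rewrite mxE absKX hpi.
rewrite -yW => -[x Wx yx]; exists x; split; [exact: WQ|by case: Wx|].
move=> i Ii; rewrite yx !mxE yb0// add0r expf_neq0//.
by rewrite -absK_gt0 hpi rho_gt0.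
Qed.

(** Near b, f o sigma is the generator times a vector [alpha] of analytic functions. Once
    [alpha b != 0] is known, the absolute values of [eps] and [eta] and the norm of [alpha] are
    constant near b, which leaves the monomials. *)
Lemma local_model : exists (W : set X) (y : X -> 'rV[K]_n) (g : 'rV[K]_n -> 'rV[K]_n)
    (k : T -> 'I_n) (A eta : R),
  [/\ [/\ open W, closed W & W b],
      [/\ forall x x', W x -> W x' -> y x = y x' -> x = x',
         forall x, W x -> {for x, continuous y} &
         forall O, open O -> O `<=` W -> open (y @` O)],
      [/\ 0 < A, 0 < eta, forall i j, I i -> I j -> k i = k j -> i = j &
        forall i x, W x -> (E i x <-> I i /\ y x 0 (k i) = 0)],
      forall x, W x ->
        normK (f (s x)) = A * \prod_(i | I i) absK (y x 0 (k i)) ^+ N i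
    & forall x, W x -> s x = g (y x) /\ exists2 J, is_jacobian g (y x) J &
        absK (\det J) = eta * \prod_(i | I i) absK (y x 0 (k i)) ^+ (v i).-1].
Proof.
have [_ _ Ehyp lp] := log_res; have := lp b.
move=> [V [y [k [eps [eta]]]]] /= [[[yc _] Vb] [kinj kE] [epsa eps0 etaa eta0]].
pose gen x := eps x * \prod_(i | `[< E i b >]) y x 0 (k i) ^+ N i.
move=> [/(_ _)/cid2-/all_sig2[a aan agen] [c can cgen]] [g _ gJ].
have yb0 i : I i -> y b 0 (k i) = 0 by move=> /asboolP Ei; apply/kE.
pose alpha x : 'rV[K]_l := \row_j a j x.
have alphac : {for b, continuous alpha}.
  apply: continuous_normK => j; have -> : (fun x => alpha x 0 j) = a j by apply/funext => x; rewrite mxE.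
  exact: mfd_analytic_continuous.
have agenN : \forall x \near b, f (s x) = gen x *: alpha x.
  have : \forall x \near b, forall j, f (s x) 0 j = a j x * gen x.
    by apply: filter_forall => j; exact: agen.
  by apply: filterS => x h; apply/rowP => j; rewrite h !mxE mulrC.
(* Conversely the generator is a combination of the f_j o sigma with bounded coefficients. If
   [alpha b = 0], its absolute value near b would be at most [C * rho ^+ m < 1] times itself, which
   fails at a generic point. *)
have alpha0 : alpha b != 0.
  apply/eqP => ab0.
  pose gam x : 'rV[K]_l := \row_j c j x.
  have gamc : {for b, continuous gam}.
    apply: continuous_normK => j.
    have -> : (fun x => gam x 0 j) = c j by apply/funext => x; rewrite mxE.
    exact: mfd_analytic_continuous.
  pose C := Num.max (normK (gam b)) 1.
  have C0 : 0 < C by rewrite lt_max ltr01 orbT.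
  have [m mC] : exists m, rho ^+ m < C^-1 by apply: rhoX_small; rewrite invr_gt0.
  have gamN : \forall x \near b, ballK (gam b) 0 (gam x).
    exact: gamc (ballK_nbhs _ 0).
  have alphaN : \forall x \near b, ballK (alpha b) m (alpha x).
    exact: alphac (ballK_nbhs _ m).
  have epsN := near_absK_eq (mfd_analytic_continuous epsa) eps0.
  have Q : \forall x \near b, [/\ f (s x) = gen x *: alpha x,
      gen x = \sum_j c j x * f (s x) 0 j, ballK (gam b) 0 (gam x),
      ballK (alpha b) m (alpha x) & absK (eps x) = absK (eps b)].
    by near=> x; split; near: x.
  have [x [[fx gx gamx alphax ex] Vx yx]] := generic_point yc Vb Q yb0.
  have gen0 : gen x != 0.
    rewrite mulf_neq0//; first by rewrite -absK_gt0 ex absK_gt0.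
    by apply/prodf_neq0 => i /yx yi; rewrite expf_neq0.
  have : absK (gen x) <= absK (gen x) * (C * rho ^+ m).
    rewrite {1}gx; apply: absK_sum_le => [|j _].
      by rewrite mulr_ge0 ?absK_ge0// mulr_ge0 ?rhoX_ge0// ltW.
    rewrite fx !mxE (absKM (c j x)) (absKM (gen x)) mulrCA ler_wpM2l ?absK_ge0//.
    apply: ler_pM; rewrite ?absK_ge0//.
      have := absK_le_normK (gam x) j; rewrite mxE => /le_trans; apply.
      rewrite -[gam x](subrK (gam b)); apply: normKD_le; last by rewrite le_max lexx.
      by rewrite (le_trans gamx)// expr0 le_max lexx orbT.
    have := absK_le_normK (alpha x) j; rewrite mxE => /le_trans; apply.
    by move: alphax; rewrite ab0 /ballK /mkset subr0.
  apply/negP; rewrite -ltNge gtr_pMr ?absK_gt0//.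
  by rewrite mulrC -ltr_pdivlMr// mul1r.
have epsN := near_absK_eq (mfd_analytic_continuous epsa) eps0.
have etaN := near_absK_eq (mfd_analytic_continuous etaa) eta0.
have alphaN := near_normK_eq alphac alpha0.
have EN : \forall x \near b, forall i, ~~ I i -> ~ E i x.
  apply: filter_forall => i; have [Ii|nIi] := boolP (I i); first exact: nearW.
  have [_ [cE _] _ _] := Ehyp i.
  have : nbhs b (~` E i).
    apply: open_nbhs_nbhs; split; first exact: closed_openC.
    by move=> Eib; case/negP: nIi; apply/asboolP.
  by apply: filterS => x nE _.
have Q : \forall x \near b, [/\ [/\ f (s x) = gen x *: alpha x, absK (eps x) = absK (eps b)
   & absK (eta x) = absK (eta b)], normK (alpha x) = normK (alpha b),
   forall i, ~~ I i -> ~ E i x &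
   s x = g (y x) /\ exists2 J, is_jacobian g (y x) J &
     \det J = eta x * \prod_(i | I i) y x 0 (k i) ^+ (v i).-1].
  near=> x; split; [split|..]; near: x => //.
have [m [oW cW WQ yW]] := chart_ball_nbhs resolved_hausdorff resolved_compact yc Vb Q.
have [oV yinj ycont yopen] := yc.
exists (V `&` y @^-1` ballK (y b) m), y, g, k, (absK (eps b) * normK (alpha b)), (absK (eta b)).
split.
- by split => //; split => //; exact: ballK_center.
- split; first by move=> x x' [Vx _] [Vx' _]; exact: yinj.
    by move=> x [Vx _]; exact: ycont.
  by move=> O oO OW; apply: yopen => // x /OW[].
- split; [by rewrite mulr_gt0 ?absK_gt0 ?normK_gt0|by rewrite absK_gt0|..].
    by move=> i j /asboolP Ei /asboolP Ej; exact: kinj.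
  move=> i x Wx; have [Vx _] := Wx; have [_ _ nE _] := WQ x Wx.
  split=> [Eix|[/asboolP Ei yx]]; last by apply/(kE i Ei x Vx).
  have Ii : I i by apply: contrapT => /negP nIi; exact: nE i nIi Eix.
  by split => //; apply/(kE i _ x Vx) => //; exact/asboolP.
- move=> x Wx; have [[fx ex _] ax _ _] := WQ x Wx.
  rewrite fx normKZ ax absKM ex absK_prod mulrAC; congr (_ * _ * _).
  by apply: eq_bigr => i _; rewrite absKX.
move=> x Wx; have [[_ _ ex] _ _ [sx [J gx dJ]]] := WQ x Wx.
split => //; exists J => //; rewrite dJ absKM ex absK_prod; congr (_ * _).
by apply: eq_bigr => i _; rewrite absKX.
Unshelve. all: by end_near. Qed.

End LocalModel.

End Resolution.

(** * Volumes of the level sets *)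

Lemma clopenI (X : topologicalType) (A B : set X) : clopen A -> clopen B -> clopen (A `&` B).
Proof. by move=> [oA cA] [oB cB]; split; [exact: openI|exact: closedI]. Qed.

Lemma clopenU (X : topologicalType) (A B : set X) : clopen A -> clopen B -> clopen (A `|` B).
Proof. by move=> [oA cA] [oB cB]; split; [exact: openU|exact: closedU]. Qed.

Lemma clopenD (X : topologicalType) (A B : set X) : clopen A -> clopen B -> clopen (A `\` B).
Proof.
by move=> [oA cA] [oB cB]; split; [apply: openI => //; exact: closed_openC
  |apply: closedI => //; exact: open_closedC].
Qed.

Section LevelVolumes.
Context {R : realType} {K : padicFieldType R} {n l : nat}.
Context {mu : {measure set (borelK K n) -> \bar R}}.
Hypothesis mu_haar : normalized_haar mu.
Context {U : set 'rV[K]_n} {f : 'rV[K]_n -> 'rV[K]_l}.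
Hypothesis U_compact : compact U.
Hypothesis U_open : open U.
Hypothesis f_analytic : analytic_map_on U f.
Hypothesis f_nontrivial : forall W : set 'rV[K]_n, open W -> W !=set0 -> W `<=` U ->
  exists2 x, W x & f x != 0.
Context {X : @charted_space R K n} {sigma : X -> open_manifold U}.
Context {T : finType} {E : T -> set X} {N v : T -> nat}.
Hypothesis log_res : log_principalization f sigma E N v.
Variable m0 : nat.
Hypothesis f_bound : forall x, U x -> normK (f x) <= rhoK K ^- m0.
Notation rho := (rhoK K).
Notation s := (resolve (sigma := sigma)).
Notation vol := (vol (mu := mu)).
Notation level := (level (f := f) (sigma := sigma)).

Let v_gt0 i : (0 < v i)%N. Proof. by have [_ _ /(_ i)[]] := log_res. Qed.

(** The possible non-zero values of the norm of f on U, listed downwards from the bound [f_bound];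
    the shift m0 lets m range over natural numbers. *)
Definition normval m : R := rho ^- m0 * rho ^+ m.

Lemma normval_gt0 m : 0 < normval m.
Proof. by rewrite mulr_gt0 ?invr_gt0 ?rhoX_gt0. Qed.

Lemma normvalD m k : normval (m + k) = normval m * rho ^+ k.
Proof. by rewrite /normval exprD mulrA. Qed.

Lemma normval_inj : injective normval.
Proof.
move=> m k /(mulfI _); rewrite invr_eq0 expf_neq0 ?gt_eqF ?rho_gt0// => /(_ isT).
by apply/ieexprIn; [exact: rho_gt0|rewrite lt_eqF// rho_lt1].
Qed.

Lemma normK_normval x : U x -> f x != 0 -> exists m, normK (f x) = normval m.
Proof.
move=> Ux fx; have [k kE] := normK_int fx; have := f_bound Ux.
have q1 : 1 < rho^-1 by rewrite invf_gt1 ?rho_gt0 ?rho_lt1.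
have kE' : rho ^ k = rho^-1 ^ (- k) by rewrite exprz_inv opprK.
rewrite {1}kE kE' -exprVn exprnP ler_eXz2l// => km.
have km0 : 0 <= k + m0%:Z by lia.
have r0 : rho != 0 by rewrite gt_eqF ?rho_gt0.
exists (absz (k + m0%:Z)%R); rewrite kE /normval [rho ^+ absz _]exprnP gez0_abs// expfzDr//.
by rewrite mulrCA -exprnP mulVf ?mulr1// expf_neq0.
Qed.

Lemma level_clopen m : clopen (level (normval m)).
Proof.
split; [apply: (level_open f_analytic log_res)|apply: (level_closed f_analytic log_res)];
  exact: normval_gt0.
Qed.

Lemma level_f_neq0 m x : level (normval m) x -> f (s x) != 0.
Proof. by move=> h; rewrite -normK_gt0 h normval_gt0. Qed.

Lemma image_borel (A : set X) : closed A -> borel_set (s @` A).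
Proof. by move=> cA; apply: compact_borel; exact: (resolve_image_compact U_compact log_res). Qed.

Lemma image_vol_fin (A : set X) : closed A -> vol (s @` A) \is a fin_num.
Proof.
move=> cA; rewrite ge0_fin_numE ?vol_ge0//; apply: (vol_fin mu_haar).
exact: (resolve_image_compact U_compact log_res).
Qed.

(** The volume is that of the image in U. Additivity in S survives because sigma is injective where
    f does not vanish. *)
Definition vseq (S : set X) (m : nat) : R := fine (vol (s @` (S `&` level (normval m)))).

Lemma vseqU (S S' : set X) m : clopen S -> clopen S' -> S `&` S' = set0 ->
  vseq (S `|` S') m = vseq S m + vseq S' m.
Proof.
move=> cS cS' SS'; have [_ cl] := clopenI cS (level_clopen m).
have [_ cl'] := clopenI cS' (level_clopen m).
rewrite /vseq setIUl image_setU volU; last 3 first.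
- exact: image_borel.
- exact: image_borel.
- rewrite -subset0 => _ [[x [Sx xm] <-] [x' [Sx' _] /esym xx']].
  have : (S `&` S') x by split => //; rewrite (resolve_inj log_res (level_f_neq0 xm) xx').
  by rewrite SS'.
by rewrite fineD// image_vol_fin.
Qed.

Lemma vseq0 m : vseq set0 m = 0.
Proof. by rewrite /vseq set0I image_set0 vol_set0. Qed.

Let c i : R := rho ^+ v i.

(** The last clause records that each divisor meeting S contributes a denominator; it ensures that
    an index realizing lambda occurs in some term. *)
Definition good (S : set X) := exists ts : seq (R * nat * seq T),
  [/\ forall u : R * nat * seq T, u \in ts -> 0 < u.1.1, is_sum_of_terms c N ts (vseq S) &
   forall i x, E i x -> S x -> exists2 u : R * nat * seq T, u \in ts & i \in u.2].

Lemma good0 : good set0.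
Proof. by exists [::]; split => // m; rewrite vseq0. Qed.

Lemma goodU S S' : clopen S -> clopen S' -> S `&` S' = set0 -> good S -> good S' ->
  good (S `|` S').
Proof.
move=> cS cS' SS' [ts [B1 h1 e1]] [ts' [B2 h2 e2]]; exists (ts ++ ts'); split.
- by move=> u; rewrite mem_cat => /orP[/B1|/B2].
- by apply: eq_is_sum_of_terms (is_sum_of_terms_cat h1 h2) => m; rewrite vseqU.
move=> i x Ei [Sx|Sx].
  by have [u uts iu] := e1 i x Ei Sx; exists u => //; rewrite mem_cat uts.
by have [u uts iu] := e2 i x Ei Sx; exists u => //; rewrite mem_cat uts orbT.
Qed.

(** * The contribution of one chart *)

Section ChartTerm.
Context {W : set X} {y : X -> 'rV[K]_n} {g : 'rV[K]_n -> 'rV[K]_n} {k : T -> 'I_n}.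
Context {A eta : R} {I : pred T}.
Hypothesis cW : clopen W.
Hypothesis yinj : forall x x', W x -> W x' -> y x = y x' -> x = x'.
Hypothesis ycont : forall x, W x -> {for x, continuous y}.
Hypothesis yopen : forall O, open O -> O `<=` W -> open (y @` O).
Hypothesis A_gt0 : 0 < A.
Hypothesis eta_gt0 : 0 < eta.
Hypothesis kinj : forall i j, I i -> I j -> k i = k j -> i = j.
Hypothesis kE : forall i x, W x -> (E i x <-> I i /\ y x 0 (k i) = 0).
Hypothesis normf : forall x, W x ->
  normK (f (s x)) = A * \prod_(i | I i) absK (y x 0 (k i)) ^+ N i.
Hypothesis jacg : forall x, W x -> s x = g (y x) /\ exists2 J, is_jacobian g (y x) J &
  absK (\det J) = eta * \prod_(i | I i) absK (y x 0 (k i)) ^+ (v i).-1.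

Lemma chart_preimage_open (O : set 'rV[K]_n) : open O -> open (W `&` y @^-1` O).
Proof.
move=> oO; rewrite openE => x [Wx yx]; apply: filterI.
  by apply: open_nbhs_nbhs; split => //; case: cW.
by apply: ycont => //; apply: open_nbhs_nbhs.
Qed.

(** A union of balls of one fixed radius has a complement of the same kind, so both are open. *)
Lemma chart_preimage_clopen (O : set 'rV[K]_n) j : (forall z, O z -> ballK z j `<=` O) ->
  clopen (W `&` y @^-1` O).
Proof.
move=> Oj; split.
  by apply: chart_preimage_open; apply/open_normK => z Oz; exists j; exact: Oj.
have -> : W `&` y @^-1` O = W `\` (W `&` y @^-1` (~` O)).
  apply/seteqP; split => x; first by move=> [Wx Ox]; split => // -[].
  by move=> [Wx nx]; split => //; apply: contrapT => h; apply: nx.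
apply: closedI; first by case: cW.
apply: open_closedC; apply: chart_preimage_open; apply/open_normK => z nz.
by exists j => w zw Ow; apply: nz; apply: (Oj w Ow); exact: ballK_sym.
Qed.

(** In the coordinates y the resolution map is g, so g inherits injectivity and openness from sigma,
    which has them where f does not vanish. *)
Lemma chart_piece (P : set X) : clopen P -> P `<=` W -> (forall x, P x -> f (s x) != 0) ->
  [/\ compact (y @` P), open (y @` P), {in y @` P &, injective g},
      forall O, open O -> O `<=` y @` P -> open (g @` O) & g @` (y @` P) = s @` P].
Proof.
move=> [oP cP] PW Pf; split.
- apply: continuous_compact.
    by apply: continuous_in_subspaceT => x; rewrite inE => /PW; exact: ycont.
  exact: subclosed_compact cP (resolved_compact U_compact log_res) _.
- exact: yopen.
- move=> z z'; rewrite !inE => -[x Px <-] [x' Px' <-].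
  have [<- _] := jacg (PW _ Px); have [<- _] := jacg (PW _ Px').
  by move=> /(resolve_inj log_res (Pf x Px)) ->.
- move=> O oO OP; have -> : g @` O = s @` (W `&` y @^-1` O).
    apply/seteqP; split => [_ [z Oz <-]|_ [x [Wx Ox] <-]].
      have [x Px xz] := OP z Oz; exists x; last by rewrite -xz; case: (jacg (PW _ Px)).
      by split; [exact: PW|rewrite /preimage /mkset xz].
    by exists (y x) => //; case: (jacg Wx).
  apply: (resolve_image_open U_compact U_open f_nontrivial log_res).
    exact: chart_preimage_open.
  move=> x [Wx /OP[x' Px' yx]]; rewrite -(yinj (PW _ Px') Wx yx); exact: Pf.
apply/seteqP; split => [_ [_ [x Px <-] <-]|_ [x Px <-]].
  by exists x => //; case: (jacg (PW _ Px)).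
by exists (y x); [exists x|case: (jacg (PW _ Px))].
Qed.

(** * One ball in a chart *)

Section Ball.
Variables (a : 'rV[K]_n) (kap : nat).
Hypothesis ball_sub : ballK a kap `<=` y @` W.
(* Thus |y_(k i)| is constant on the ball unless its center lies on E i. *)
Hypothesis a_cases : forall i, I i -> a 0 (k i) = 0 \/ rho ^+ kap < absK (a 0 (k i)).

(** The divisors through the center of the ball. The coordinates of the others have constant
    absolute value on the ball and are absorbed into [A'] and [eta']. *)
Let I0 i := I i && (a 0 (k i) == 0).
Let A' := A * \prod_(i | I i && (a 0 (k i) != 0)) absK (a 0 (k i)) ^+ N i.
Let eta' := eta * \prod_(i | I i && (a 0 (k i) != 0)) absK (a 0 (k i)) ^+ (v i).-1.

Let ball_coord i x : W x -> ballK a kap (y x) -> I i -> a 0 (k i) != 0 ->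
  absK (y x 0 (k i)) = absK (a 0 (k i)).
Proof.
move=> Wx xa Ii ai; apply: absK_near_eq.
have [/eqP|] := a_cases Ii; first by rewrite (negbTE ai).
apply: le_lt_trans; apply: le_trans xa.
by have := absK_le_normK (y x - a) (k i); rewrite !mxE.
Qed.

Let normf' x : W x -> ballK a kap (y x) ->
  normK (f (s x)) = A' * \prod_(i | I0 i) absK (y x 0 (k i)) ^+ N i.
Proof.
move=> Wx xa; rewrite normf// (bigID (fun i => a 0 (k i) == 0))/= /A' -mulrA; congr (_ * _).
rewrite mulrC; congr (_ * _); apply: eq_bigr => i /andP[Ii ai].
by rewrite (ball_coord Wx xa Ii ai).
Qed.

Let jacg' x : W x -> ballK a kap (y x) -> exists2 J, is_jacobian g (y x) J &
  absK (\det J) = eta' * \prod_(i | I0 i) absK (y x 0 (k i)) ^+ (v i).-1.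
Proof.
move=> Wx xa; have [_ [J gJ dJ]] := jacg Wx; exists J => //.
rewrite dJ (bigID (fun i => a 0 (k i) == 0))/= /eta' mulrCA mulrC; congr (_ * _).
congr (_ * _); apply: eq_bigr => i /andP[Ii ai].
by rewrite (ball_coord Wx xa Ii ai).
Qed.
Let A'_gt0 : 0 < A'.
Proof.
rewrite mulr_gt0// prodr_gt0// => i /andP[_ ai].
by rewrite exprn_gt0// absK_gt0.
Qed.

Let eta'_gt0 : 0 < eta'.
Proof.
rewrite mulr_gt0// prodr_gt0// => i /andP[_ ai].
by rewrite exprn_gt0// absK_gt0.
Qed.

(** J lists the coordinates already fixed at the maximal absolute value; adding one index to J peels
    off one denominator. *)
Let piece (J : seq T) : set X := W `&` y @^-1`
  [set z | ballK a kap z /\ {in J, forall i, absK (z 0 (k i)) = rho ^+ kap}].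

Let near_coord (z w : 'rV[K]_n) j : ballK z kap.+1 w -> absK (z 0 j) = rho ^+ kap ->
  absK (w 0 j) = rho ^+ kap.
Proof.
move=> zw zj; rewrite -zj; apply: absK_near_eq; rewrite zj.
apply: le_lt_trans (rhoXzS kap); apply: le_trans zw.
by have := absK_le_normK (w - z) j; rewrite !mxE.
Qed.

Let piece_clopen J : clopen (piece J).
Proof.
apply: (chart_preimage_clopen (j := kap.+1)) => z [za zJ] w zw; split.
  by apply: ballK_trans za _; apply: ballK_le zw.
by move=> i iJ; apply: near_coord zw _; exact: zJ.
Qed.

Let small i : set X := W `&` y @^-1` [set z | absK (z 0 (k i)) < rho ^+ kap].

Let small_clopen i : clopen (small i).
Proof.
apply: (chart_preimage_clopen (j := kap.+1)) => z zi w zw /=.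
rewrite -(subrK (z 0 (k i)) (w 0 (k i))).
apply: le_lt_trans (absKD _ _) _; rewrite gt_max zi andbT.
apply: le_lt_trans (rhoXzS kap); apply: le_trans zw.
by have := absK_le_normK (w - z) (k i); rewrite !mxE.
Qed.

Let coord_le i x : I0 i -> ballK a kap (y x) -> absK (y x 0 (k i)) <= rho ^+ kap.
Proof.
move=> /andP[_ /eqP ai] xa; apply: le_trans xa.
by have := absK_le_normK (y x - a) (k i); rewrite !mxE ai subr0.
Qed.

Let pieceU i J : I0 i -> piece J = piece (i :: J) `|` (piece J `&` small i).
Proof.
move=> Ii; apply/seteqP; split => x; last first.
  by case=> [[Wx [xa xJ]]|[]//]; split => //; split => // j jJ; apply: xJ; rewrite inE jJ orbT.
move=> [Wx [xa xJ]]; have := coord_le Ii xa.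
rewrite le_eqVlt => /orP[/eqP xi|xi]; last by right; split.
by left; split => //; split => // j; rewrite inE => /orP[/eqP ->|/xJ].
Qed.

Let piece_disj i J : piece (i :: J) `&` (piece J `&` small i) = set0.
Proof.
rewrite -subset0 => x [[_ [_ xJ]] [_ [_ /=]]].
by rewrite (xJ i (mem_head _ _)) ltxx.
Qed.

(* Multiplication of y_i by a uniformizer maps the part ||f|| = normval m of a
   piece onto the part |y_i| < rho^kap, ||f|| = normval (m + N i) of the same
   piece, and multiplies volumes by rho^(v i). *)
Section Scaling.
Variables (i : T) (J : seq T) (pi : K).
Hypothesis I0i : I0 i.
Hypothesis JI : {in J, forall j, I j}.
Hypothesis iJ : i \notin J.
Hypothesis hpi : absK pi = rho.

Let pi_neq0 : pi != 0. Proof. by rewrite -absK_gt0 hpi rho_gt0. Qed.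
Let ai0 : a 0 (k i) = 0. Proof. by case/andP: I0i => _ /eqP. Qed.

Let scale (d : K) (z : 'rV[K]_n) := z *m diag1 (k i) d.

(** The factor d is general because both a uniformizer and its inverse are used. As the i-th divisor
    passes through the center of the ball, the bound on the scaled coordinate keeps the point in the
    ball. *)
Let scale_piece (d : K) x : d != 0 -> absK d * absK (y x 0 (k i)) <= rho ^+ kap ->
  piece J x -> exists x', [/\ piece J x', y x' = scale d (y x),
    normK (f (s x')) = absK d ^+ N i * normK (f (s x)) &
    \prod_(j | I0 j) absK (y x' 0 (k j)) ^+ (v j).-1 =
    absK d ^+ (v i).-1 * \prod_(j | I0 j) absK (y x 0 (k j)) ^+ (v j).-1].
Proof.
move=> d0 dx [Wx [xa xJ]].
have za : ballK a kap (scale d (y x)).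
  apply/normK_le; first exact: rhoX_ge0.
  move=> j; rewrite mxE [in X in absK (_ + X)]mxE mul_diag1.
  have [->|ji] := eqVneq j (k i).
    by rewrite ai0 subr0 absKM mulrC.
  by have := le_trans (absK_le_normK (y x - a) j) xa; rewrite !mxE.
have [x' Wx' yx'] := ball_sub za.
have coord j : I j -> j != i -> y x' 0 (k j) = y x 0 (k j).
  move=> Ij ji; rewrite yx' mul_diag1 ifF//; apply: contra_neqF ji => /eqP.
  by apply: kinj => //; case/andP: I0i.
have coordi : y x' 0 (k i) = y x 0 (k i) * d by rewrite yx' mul_diag1 eqxx.
exists x'; split => //.
- split => //; split; first by rewrite yx'.
  move=> j jJ; rewrite coord ?xJ//; first exact: JI.
  by apply: contraNneq iJ => <-.
- rewrite normf' ?yx'// normf'//.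
  rewrite (bigD1 i)//= [X in _ = _ * (_ * X)](bigD1 i)//= -yx' coordi absKM exprMn.
  rewrite [X in _ * (_ * X) = _](eq_bigr (fun j => absK (y x 0 (k j)) ^+ N j)); last first.
    by move=> j /andP[/andP[Ij _] ji]; rewrite coord.
  by ring.
rewrite (bigD1 i)//= [X in _ = _ * X](bigD1 i)//= coordi absKM exprMn.
rewrite [X in _ * X = _](eq_bigr (fun j => absK (y x 0 (k j)) ^+ (v j).-1)); last first.
  by move=> j /andP[/andP[Ij _] ji]; rewrite coord.
by ring.
Qed.

Let P m := piece J `&` level (normval m).
Let P' m := piece J `&` small i `&` level (normval m).

Let weight x := \prod_(j | I0 j) absK (y x 0 (k j)) ^+ (v j).-1.

Let scale_sym d x x' : d != 0 -> y x' = scale d (y x) -> y x = scale d^-1 (y x').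
Proof. by move=> d0 ->; rewrite /scale -mulmxA -diag1M mulfV// diag1_1 mulmx1. Qed.

Let scale_up m x : P m x -> exists x', [/\ P' (m + N i) x', y x' = scale pi (y x) &
  weight x' = absK pi ^+ (v i).-1 * weight x].
Proof.
move=> [px xm]; have [Wx [xa xJ]] := px.
have le1 := coord_le I0i xa.
have lt1 : absK pi * absK (y x 0 (k i)) < rho ^+ kap.
  rewrite hpi; apply: le_lt_trans (rhoXzS kap); rewrite exprS ler_wpM2l// rho_ge0//.
have [x' [px' yx' nx' jx']] := scale_piece pi_neq0 (ltW lt1) px.
exists x'; split => //; split.
  split => //; split; first by case: px'.
  by rewrite /preimage /mkset yx' mul_diag1 eqxx absKM mulrC.
by rewrite /level /mkset nx' hpi xm normvalD mulrC.
Qed.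

Let scale_down m x' : P' m x' -> (N i <= m)%N /\ exists x, [/\ P (m - N i) x,
  y x = scale pi^-1 (y x') & weight x = absK pi^-1 ^+ (v i).-1 * weight x'].
Proof.
move=> [[px' [Wx' xi]] xm].
have le1 : absK pi^-1 * absK (y x' 0 (k i)) <= rho ^+ kap.
  by rewrite absKV hpi ler_pdivrMl ?rho_gt0// -exprS; exact: absK_ltS xi.
have [x [px yx nx jx]] := scale_piece (invr_neq0 pi_neq0) le1 px'.
have rN : rho ^+ N i != 0 by rewrite gt_eqF ?rhoX_gt0.
have nx' : normK (f (s x)) * rho ^+ N i = normval m.
  rewrite nx xm absKV hpi exprVn mulrAC mulVf ?mul1r//.
(* Otherwise the norm of f at [s x], which is [normval m] divided by [rho ^+ N i], would exceed the
   bound [rho ^- m0]. *)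
have Nm : (N i <= m)%N.
  rewrite leqNgt; apply/negP => mN.
  have := f_bound (resolve_in (sigma := sigma) x).
  rewrite -(ler_pM2r (rhoX_gt0 (K := K) (N i))) nx' /normval.
  rewrite ler_pM2l ?invr_gt0 ?rhoX_gt0// leNgt => /negP; apply.
  by rewrite ltr_iXn2l ?rho_gt0 ?rho_lt1.
split => //; exists x; split => //; split => //.
by apply: (mulIf rN); rewrite nx' -normvalD subnK.
Qed.

Let P_clopen m : clopen (P m).
Proof. by apply: clopenI => //; exact: level_clopen. Qed.

Let P'_clopen m : clopen (P' m).
Proof. by apply: clopenI; [exact: clopenI|exact: level_clopen]. Qed.

(** On y(Q) the map g is compared with g o [scale d], whose image is that of Q'. The exponent v_i is
    1 from the determinant of the scaling plus v_i - 1 from the change of [weight]. *)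
Let scale_vol (d : K) (Q Q' : set X) : d != 0 -> clopen Q -> clopen Q' ->
  Q `<=` piece J -> Q' `<=` piece J -> (forall x, Q x -> f (s x) != 0) ->
  (forall x, Q x -> exists x', [/\ Q' x', y x' = scale d (y x) &
    weight x' = absK d ^+ (v i).-1 * weight x]) ->
  (forall x', Q' x' -> exists2 x, Q x & y x' = scale d (y x)) ->
  (vol (s @` Q') <= (absK d ^+ v i)%:E * vol (s @` Q))%E.
Proof.
move=> d0 cQ cQ' QJ Q'J Qf up down.
have QW : Q `<=` W by move=> x /QJ[].
have [cD oD gD gop gQ] := chart_piece cQ QW Qf.
have eqQ' : (g \o scale d) @` (y @` Q) = s @` Q'.
  apply/seteqP; split => [_ [_ [x Qx <-] <-]|_ [x' Q'x' <-]].
    have [x' [Q'x' yx' _]] := up x Qx; exists x' => //=; rewrite -yx'.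
    by have [Wx' _] := Q'J _ Q'x'; case: (jacg Wx').
  have [x Qx yx'] := down x' Q'x'; exists (y x); first by exists x.
  by rewrite /= -yx'; have [Wx' _] := Q'J _ Q'x'; case: (jacg Wx').
rewrite -eqQ' -gQ; apply: (vol_transition mu_haar) => //.
- by rewrite exprn_gt0// absK_gt0.
- by rewrite eqQ'; apply: image_borel; case: cQ'.
move=> _ [x Qx <-]; have [x' [Q'x' yx' wx']] := up x Qx.
have [Wx [xa _]] := QJ x Qx; have [Wx' [xa' _]] := Q'J x' Q'x'.
have [G gG dG] := jacg' Wx xa; have [G' gG' dG'] := jacg' Wx' xa'.
exists G, (diag1 (k i) d *m G'); split => //.
- by apply: jacobian_comp; [exact: jacobian_linear|rewrite -/(scale d (y x)) -yx'].
- rewrite -absK_gt0 dG mulr_gt0// prodr_gt0// => j /andP[Ij _]; rewrite exprn_gt0// absK_gt0.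
  apply: contra_neq (Qf x Qx) => yx0; apply/(exceptionalE log_res).
  by exists j; apply/kE.
rewrite det_mulmx det_diag1 absKM dG' dG -/(weight x) -/(weight x') wx'.
by rewrite -[in RHS](prednK (v_gt0 i)) exprS; ring.
Qed.

(** The bound [scale_vol] is applied to the uniformizer and to its inverse. *)
Let scaled_vol m : fine (vol (s @` P' (m + N i))) = c i * fine (vol (s @` P m)).
Proof.
have PJ k0 : P k0 `<=` piece J by move=> x [].
have P'J k0 : P' k0 `<=` piece J by move=> x [[]].
have Pf k0 x : P k0 x -> f (s x) != 0 by move=> [_ /level_f_neq0].
have P'f k0 x : P' k0 x -> f (s x) != 0 by move=> [_ /level_f_neq0].
have piV : pi^-1 != 0 by rewrite invr_eq0.
have up m1 x : P m1 x -> exists x', [/\ P' (m1 + N i) x', y x' = scale pi (y x) &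
  weight x' = absK pi ^+ (v i).-1 * weight x] := @scale_up m1 x.
have down x' : P' (m + N i) x' -> exists x, [/\ P m x, y x = scale pi^-1 (y x') &
    weight x = absK pi^-1 ^+ (v i).-1 * weight x'].
  by move=> /scale_down[_]; rewrite addnK.
have le1 : (vol (s @` P' (m + N i)) <= (absK pi ^+ v i)%:E * vol (s @` P m))%E.
  apply: scale_vol => //; [exact: Pf|exact: scale_up|].
  move=> x' /down[x [Px yx _]]; exists x => //.
  by rewrite -[pi]invrK; exact: scale_sym.
have le2 : (vol (s @` P m) <= (absK pi^-1 ^+ v i)%:E * vol (s @` P' (m + N i)))%E.
  apply: scale_vol => //; [exact: P'f|].
  by move=> x /scale_up[x' [P'x' yx' _]]; exists x' => //; exact: scale_sym.
have [_ cP] := P_clopen m; have [_ cP'] := P'_clopen (m + N i).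
move: le1 le2; rewrite -(fineK (image_vol_fin cP)) -(fineK (image_vol_fin cP')) -!EFinM !lee_fin.
rewrite hpi absKV hpi [rho^-1 ^+ _]exprVn => le1 le2.
by apply/le_anti; rewrite le1 /= mulrC -ler_pdivlMr ?rhoX_gt0// mulrC.
Qed.

Lemma lag_piece : lag (vseq (piece J)) (vseq (piece (i :: J))) (c i) (N i).
Proof.
move=> m; rewrite {1}(pieceU J I0i) vseqU//; last exact: clopenI.
congr (_ + _); case: ifPn => [Nm|Nm].
  by rewrite -{1}(subnK Nm) -scaled_vol.
(* A level m < N i has no part with small i-th coordinate, since dividing by the uniformizer would
   leave the range of the norm of f. *)
rewrite /vseq -/(P' m); suff -> : P' m = set0 by rewrite image_set0 vol_set0.
by rewrite -subset0 => x /scale_down[]; rewrite (negbTE Nm).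
Qed.

End Scaling.

Let I' := [seq i <- enum T | I0 i].

(** Here every varying coordinate has its maximal size, so the norm of f is constant and only one
    level is met. Its volume is positive: the image is open, and it is non-empty because of the
    point with coordinates [a + const_mx (pi ^+ kap)]. *)
Let full_piece J : (forall i, I0 i -> i \in J) -> {in J, forall i, I0 i} ->
  exists (B : R) (m1 : nat), 0 < B /\ vseq (piece J) =1 (fun m => if m == m1 then B else 0).
Proof.
move=> J_full JI0; have [pi hpi] := @uniformizer R K.
have [x0 Wx0 yx0] : (y @` W) (a + const_mx (pi ^+ kap)).
  apply: ball_sub; rewrite /ballK /mkset addrAC subrr add0r; apply/normK_le; first exact: rhoX_ge0.
  by move=> j; rewrite mxE absKX hpi.
have px0 : piece J x0.
  split => //; rewrite /preimage /mkset yx0; split.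
    rewrite /ballK /mkset addrAC subrr add0r; apply/normK_le; first exact: rhoX_ge0.
    by move=> j; rewrite mxE absKX hpi.
  by move=> i /JI0/andP[_ /eqP ai]; rewrite !mxE ai add0r absKX hpi.
pose r0 := A' * \prod_(i | I0 i) (rho ^+ kap) ^+ N i.
have pr0 x : piece J x -> normK (f (s x)) = r0.
  move=> [Wx [xa xJ]]; rewrite normf'//; congr (_ * _); apply: eq_bigr => i Ii.
  by rewrite xJ// J_full.
have r0_gt0 : 0 < r0 by rewrite mulr_gt0// prodr_gt0// => i _; rewrite !exprn_gt0 ?rho_gt0.
have pf x : piece J x -> f (s x) != 0 by move=> px; rewrite -normK_gt0 pr0.
have [m1 m1E] := normK_normval (resolve_in (sigma := sigma) x0) (pf _ px0).
have [op cp] := piece_clopen J.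
exists (fine (vol (s @` piece J))), m1; split.
  apply: fine_gt0; rewrite vol_open_gt0//=; last 2 first.
  - exact: (resolve_image_open U_compact U_open f_nontrivial log_res).
  - by exists (s x0); exists x0.
  by rewrite -ge0_fin_numE ?vol_ge0// image_vol_fin.
move=> m; rewrite /vseq; have [->|mm1] := eqVneq m m1.
  congr (fine (vol (s @` _))); apply/seteqP; split => [x []//|x px]; split => //.
  by rewrite /level /mkset pr0// -(pr0 _ px0).
suff -> : piece J `&` level (normval m) = set0 by rewrite image_set0 vol_set0.
rewrite -subset0 => x [px xm]; move/negP: mm1; apply; apply/eqP/normval_inj.
by rewrite -m1E -xm (pr0 _ px0) pr0.
Qed.

(** J1 lists the coordinates not yet fixed. Each induction step moves one of them to J and adds the
    corresponding denominator. *)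
Let piece_term J1 J : uniq (J1 ++ J) -> (forall i, I0 i = (i \in J1 ++ J)) ->
  exists (B : R) (m1 : nat), 0 < B /\ is_term c N B m1 J1 (vseq (piece J)).
Proof.
elim: J1 J => [|i J1 IH] J /=.
  by move=> _ IJ; apply: full_piece => i; rewrite IJ.
move=> /andP[iJ uJ] IJ; have [B [m1 [B0 h]]] : exists (B : R) (m1 : nat), 0 < B /\
    is_term c N B m1 J1 (vseq (piece (i :: J))).
  apply: IH => [|j]; last by rewrite IJ !(inE, mem_cat) orbCA.
  by rewrite -cat1s uniq_catCA /= iJ.
have [pi hpi] := @uniformizer R K.
exists B, m1; split => //; exists (vseq (piece (i :: J))) => //.
apply: (lag_piece (pi := pi)) => //.
- by rewrite IJ mem_head.
- by move=> j jJ; have : I0 j by [rewrite IJ inE mem_cat jJ !orbT]; case/andP.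
- by move: iJ; rewrite mem_cat negb_or => /andP[].
Qed.

Lemma good_ball : good (W `&` y @^-1` ballK a kap).
Proof.
have [||B [m1 [B0 h]]] := @piece_term I' [::].
- by rewrite cats0 filter_uniq// enum_uniq.
- by move=> i; rewrite cats0 mem_filter mem_enum andbT.
exists [:: (B, m1, I')]; split.
- by move=> u; rewrite inE => /eqP ->.
- exists (vseq (piece [::])), (fun=> 0); split => // m; rewrite addr0 /piece.
  by congr (vseq (_ `&` _ @^-1` _) _); apply/seteqP; split => z //; case.
(* A divisor that meets the ball passes through its center: otherwise its coordinate would have a
   constant non-zero absolute value on the ball. *)
move=> i x Ei [Wx xa]; exists (B, m1, I'); first exact: mem_head.
have /kE[//|Ii yi] := Ei; rewrite mem_filter mem_enum andbT /I0 Ii /=.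
apply/negPn/negP => ai; have := ball_coord Wx xa Ii ai.
by rewrite yi absK0 => /esym/eqP; rewrite absK_eq0 (negbTE ai).
Qed.
End Ball.

(** The compact open set y(S) is a finite disjoint union of balls so small that each coordinate
    [k i] of a center is either zero or larger than the radius. *)
Lemma good_chart (S : set X) : clopen S -> S `<=` W -> good S.
Proof.
move=> cS SW; have [oS clS] := cS.
have cD : compact (y @` S).
  apply: continuous_compact.
    by apply: continuous_in_subspaceT => x; rewrite inE => /SW; exact: ycont.
  exact: subclosed_compact clS (resolved_compact U_compact log_res) _.
have oD := yopen oS SW.
have /choice[kap kapP] : forall z, exists j, (y @` S) z -> ballK z j `<=` y @` S /\
    forall i, I i -> z 0 (k i) = 0 \/ rho ^+ j < absK (z 0 (k i)).
  move=> z; have [Sz|nSz] := pselect ((y @` S) z); last by exists 0%N.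
  have [j1 j1S] := (iffLR (open_normK _)) oD z Sz.
  have /choice[j2 j2P] : forall i : T, exists j2, z 0 (k i) = 0 \/ rho ^+ j2 < absK (z 0 (k i)).
    move=> i; have [->|zi] := eqVneq (z 0 (k i)) 0; first by exists 0%N; left.
    have zi0 : 0 < absK (z 0 (k i)) by rewrite absK_gt0.
    have [j2 h] := @rhoX_small R K _ zi0.
    by exists j2; right.
  exists (maxn j1 (\max_i j2 i)) => _; split.
    by apply: subset_trans j1S; apply: ballK_le; exact: leq_maxl.
  move=> i _; have [|h] := j2P i; [by left|right]; apply: le_lt_trans h.
  by apply: rhoX_le; apply: leq_trans (leq_maxr _ _); exact: leq_bigmax.
have [zs [uzs zsD disj eqD]] := compact_open_balls cD (fun z zS => (kapP z zS).1).
have -> : S = W `&` y @^-1` (\bigcup_(z in [set` zs]) ballK z (kap z)).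
  rewrite -eqD; apply/seteqP; split => [x Sx|x [Wx [x' Sx' xx']]].
    by split; [exact: SW|exists x].
  by rewrite -(yinj (SW _ Sx') Wx xx').
have cball z : clopen (W `&` y @^-1` ballK z (kap z)).
  by apply: (chart_preimage_clopen (j := kap z)) => w zw u wu; exact: ballK_trans zw wu.
have cballs (s0 : seq 'rV[K]_n) : clopen (W `&` y @^-1` (\bigcup_(z in [set` s0]) ballK z (kap z))).
  elim: s0 => [|z s0 IH].
    have -> : \bigcup_(z in [set` [::]]) ballK z (kap z) = set0.
      by rewrite -subset0 => x [].
    by rewrite preimage_set0 setI0; exact: clopen0.
  rewrite bigcup_setU1_seq preimage_setU setIUr; exact: clopenU.
elim: zs uzs zsD disj {eqD} => [|z zs IH] /=.
  move=> _ _ _.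
  have -> : \bigcup_(z in [set` [::]]) ballK z (kap z) = set0.
    by rewrite -subset0 => x [].
  by rewrite preimage_set0 setI0; exact: good0.
move=> /andP[zzs uzs] zsD disj; rewrite bigcup_setU1_seq preimage_setU setIUr.
apply: goodU => //.
- rewrite -subset0 => x [[_ xz] [_ [z' /= z'zs xz']]]; move/negP: zzs; apply.
  have -> // : z = z'; apply: disj; rewrite ?inE ?eqxx ?z'zs ?orbT//.
  by exists (y x).
- have /kapP[b1 b2] : (y @` S) z by apply: zsD; exact: mem_head.
  by apply: good_ball => //; apply: subset_trans b1 _; exact: image_subset.
apply: IH => //; first by move=> w wzs; apply: zsD; rewrite inE wzs orbT.
by move=> w w' wzs w'zs; apply: disj; rewrite inE ?wzs ?w'zs orbT.
Qed.

End ChartTerm.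

(** Finitely many local models cover X; removing from each chart the union of those already treated
    makes them disjoint and keeps them clopen. *)
Lemma good_setT : good [set: X].
Proof.
have /choice[W WP] : forall b : X, exists W : set X, [/\ clopen W, W b &
    forall S, clopen S -> S `<=` W -> good S].
  move=> b.
  have [W [y [g [k [A [eta [[oW cW Wb] [yi yc yo] [A0 eta0 ki kE] nf jg]]]]]]] :=
    local_model U_compact log_res b.
  by exists W; split => // S cS SW; apply: (good_chart (y := y) (g := g) _ _ _ _ A0 eta0 ki kE).
have [b _|bs [_ bsT]] := compact_finite_cover (f := W) (resolved_compact U_compact log_res).
  by have [[oW _] Wb _] := WP b; apply: open_nbhs_nbhs.
have -> : [set: X] = \bigcup_(b in [set` bs]) W b by apply/seteqP; split.
suff [] : clopen (\bigcup_(b in [set` bs]) W b) /\ good (\bigcup_(b in [set` bs]) W b) by [].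
elim: {bsT} bs => [|b bs [cB gB]].
  have -> : \bigcup_(b in [set` [::]]) W b = set0 by rewrite -subset0 => x [].
  by split; [exact: clopen0|exact: good0].
rewrite bigcup_setU1_seq; set B := \bigcup_(x in _) W x in cB gB *.
have [cW Wb gW] := WP b.
have -> : W b `|` B = (W b `\` B) `|` B.
  apply/seteqP; split => x; last by case=> [[]|]; [left|right].
  by have [Bx|nBx] := pselect (B x); [right|case=> [Wx|//]; left].
have cWB := clopenD cW cB; split.
  exact: clopenU.
apply: goodU => //; last by apply: gW => // x [].
by rewrite setIC setDIK.
Qed.

End LevelVolumes.

(** * The zeta integral as a power series in q^(-s) *)

Lemma complex_sumD (R : realType) (M : nat) (a b : nat -> R) (z : nat -> R[i]) (x y : R) :
  (forall m, z m = Complex (a m) (b m)) ->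
  Complex (\sum_(m < M) a m + x) (\sum_(m < M) b m + y) = \sum_(m < M) z m + Complex x y.
Proof.
move=> zE; suff <- : Complex (\sum_(m < M) a m) (\sum_(m < M) b m) = \sum_(m < M) z m by [].
by elim: M => [|M IH]; rewrite ?big_ord0// !big_ord_recr /= -IH zE.
Qed.

Section ZetaSeries.
Context {R : realType} {K : padicFieldType R} {n l : nat}.
Context {mu : {measure set (borelK K n) -> \bar R}}.
Context {U : set 'rV[K]_n} {f : 'rV[K]_n -> 'rV[K]_l}.
Hypothesis mu_haar : normalized_haar mu.
Hypothesis U_compact : compact U.
Hypothesis U_open : open U.
Hypothesis f_analytic : analytic_map_on U f.
Variable m0 : nat.
Hypothesis f_bound : forall x, U x -> normK (f x) <= rhoK K ^- m0.
Notation rho := (rhoK K).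
Notation vol := (vol (mu := mu)).
Notation normval := (@normval R K m0).

Definition value_set m : set 'rV[K]_n := U `&` [set x | normK (f x) = normval m].
(** The tail contains the zero set of f; the integral over it is controlled by the size of the
    integrand. *)
Definition value_tail m : set 'rV[K]_n := U `&` [set x | normK (f x) <= normval m].

Lemma locally_constant_normf_open (P : R -> Prop) :
  open ([set x | [/\ U x, f x != 0 & P (normK (f x))]] : set 'rV[K]_n).
Proof.
rewrite openE => x [Ux fx Px].
have fc := f_continuous f_analytic Ux.
have xU : nbhs x U by exact: open_nbhs_nbhs.
apply: filterS2 xU (near_normK_eq fc fx) => z Uz fz.
by split => //; [rewrite -normK_gt0 fz normK_gt0|rewrite fz].
Qed.

Lemma U_borel : borel_set U. Proof. exact: open_borel. Qed.

Lemma value_set_borel m : borel_set (value_set m).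
Proof.
apply: open_borel.
have -> : value_set m = [set x | [/\ U x, f x != 0 & normK (f x) = normval m]].
  apply/seteqP; split => x [] // Ux fx; split => //.
  by rewrite -normK_gt0 fx normval_gt0.
exact: (locally_constant_normf_open (P := fun u => u = normval m)).
Qed.

Lemma normval_le m k : (normval k <= normval m) = (m <= k)%N.
Proof.
rewrite /normval ler_pM2l ?invr_gt0 ?rhoX_gt0//.
by rewrite ler_iXn2l ?rho_gt0 ?rho_lt1.
Qed.

Lemma value_tailS m : value_tail m = value_set m `|` value_tail m.+1.
Proof.
apply/seteqP; split => x; last first.
  case=> [[Ux fx]|[Ux fx]]; split => //=; first by rewrite fx.
  by apply: le_trans fx _; rewrite normval_le.
move=> [Ux xm]; have [fx|fx] := eqVneq (f x) 0.
  by right; split => //=; rewrite fx normK0 ltW ?normval_gt0.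
have [k kE] := normK_normval f_bound Ux fx.
move: xm; rewrite /mkset kE normval_le leq_eqVlt => /orP[/eqP mk|mk].
  by left; split => //; rewrite mk.
by right; split => //=; rewrite kE normval_le.
Qed.

Lemma value_tail_disj m : value_set m `&` value_tail m.+1 = set0.
Proof.
rewrite -subset0 => x [[_ xm] [_]].
by rewrite /mkset xm normval_le ltnn.
Qed.

Lemma value_tail0 : value_tail 0 = U.
Proof.
apply/seteqP; split => x; first by case.
by move=> Ux; split => //=; rewrite /normval expr0 mulr1; exact: f_bound.
Qed.

Lemma value_tail_borel m : borel_set (value_tail m).
Proof.
elim: m => [|m IH]; first by rewrite value_tail0; exact: U_borel.
have -> : value_tail m.+1 = value_tail m `\` value_set m.
  rewrite (value_tailS m); apply/seteqP; split => x.
    move=> xm; split; first by right.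
    by move=> xm'; have : (value_set m `&` value_tail m.+1) x by []; rewrite value_tail_disj.
  by case=> [[]].
by apply: borel_setD => //; exact: value_set_borel.
Qed.

Section Integral.
(** Here [psi] stands for the real or the imaginary part of the power u^s, and r for the real part
    of s. *)
Variables (psi : R -> R) (r : R).
Hypothesis r0 : 0 < r.
Hypothesis psi_le : forall u, `|psi u| <= u `^ r.

(** Off the zeros of f its norm is locally constant, so that part of a preimage is open for every B;
    the zeros of f in U form a Borel set. *)
Lemma measurable_psi : measurable_fun (U : set (borelK K n)) (fun x => psi (normK (f x))).
Proof.
move=> _ B _.
have -> : U `&` (fun x => psi (normK (f x))) @^-1` B =
    [set x | [/\ U x, f x != 0 & B (psi (normK (f x)))]] `|`
    (if `[< B (psi 0) >] then U `\` [set x | [/\ U x, f x != 0 & True]] else set0).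
  apply/seteqP; split => x.
    move=> [Ux Bx]; have [fx|fx] := eqVneq (f x) 0; last by left.
    right; rewrite ifT; last by apply/asboolP; move: Bx; rewrite /preimage /mkset fx normK0.
    by split => // -[_]; rewrite fx eqxx.
  case=> [[]//|]; case: asboolP => // B0 [Ux nx]; split => //.
  have [fx|fx] := eqVneq (f x) 0; first by rewrite /preimage /mkset fx normK0.
  by case: nx.
apply: borel_setU; first by apply: open_borel; exact: (locally_constant_normf_open (P := fun u => B (psi u))).
case: ifP => _; last exact: measurable0.
apply: borel_setD; first exact: U_borel.
by apply: open_borel; exact: (locally_constant_normf_open (P := fun=> True)).
Qed.

Lemma psi_bound m x : value_tail m x -> `|psi (normK (f x))| <= normval m `^ r.
Proof.
move=> [Ux xm]; apply: le_trans (psi_le _) _.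
by apply: ge0_ler_powR; rewrite ?nnegrE ?normK_ge0 ?(ltW r0) ?(ltW (normval_gt0 _ _)).
Qed.

Lemma vol_U_fin : (vol U < +oo)%E. Proof. exact: (vol_fin mu_haar). Qed.

Lemma psi_integrable m :
  mu.-integrable (value_tail m) (EFin \o (fun x => psi (normK (f x)))).
Proof.
have UT : value_tail m `<=` U by move=> x [].
apply: measurable_bounded_integrable.
- exact: value_tail_borel.
- by apply: le_lt_trans vol_U_fin; apply: vol_le => //; [exact: value_tail_borel|exact: U_borel].
- by apply: measurable_funS measurable_psi; [exact: U_borel|].
exists (normval m `^ r); split; first exact: num_real.
by move=> M rM x /psi_bound/le_trans; apply; exact: ltW.
Qed.

Lemma integral_value_set m : \int[mu]_(x in value_set m) psi (normK (f x)) =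
  psi (normval m) * fine (vol (value_set m)).
Proof.
rewrite -Rintegral_cst; last exact: value_set_borel.
by apply: eq_Rintegral => x; rewrite inE => -[_ /= ->].
Qed.

Lemma integral_partial_sum M : \int[mu]_(x in U) psi (normK (f x)) =
  \sum_(m < M) psi (normval m) * fine (vol (value_set m)) +
  \int[mu]_(x in value_tail M) psi (normK (f x)).
Proof.
elim: M => [|M ->]; first by rewrite big_ord0 add0r value_tail0.
rewrite big_ord_recr /= -addrA; congr (_ + _); rewrite -integral_value_set.
rewrite {1}value_tailS Rintegral_setU//.
- exact: value_set_borel.
- exact: value_tail_borel.
- by rewrite -value_tailS; exact: psi_integrable.
- by apply/eqP; exact: value_tail_disj.
Qed.

Lemma integral_tail M : `|\int[mu]_(x in value_tail M) psi (normK (f x))| <=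
  normval M `^ r * fine (vol U).
Proof.
have mT := value_tail_borel M.
have vT : (vol (value_tail M) < +oo)%E.
  by apply: le_lt_trans vol_U_fin; apply: vol_le => // [|x []//]; exact: U_borel.
apply: le_trans (le_normr_Rintegral mT (psi_integrable M)) _.
apply: (@le_trans _ _ (\int[mu]_(x in value_tail M) (normval M `^ r))).
  apply: le_Rintegral => //.
  - have := psi_integrable M; move/integrable_abse; apply: eq_integrable => //.
  - apply: measurable_bounded_integrable; [exact: mT|exact: vT|exact: measurable_cst|].
    exists (normval M `^ r); split; first exact: num_real.
    by move=> u ru x _ /=; rewrite ger0_norm ?powR_ge0// ltW.
  - by move=> x /psi_bound.
rewrite Rintegral_cst// ler_wpM2l ?powR_ge0//; apply: fine_le.
- by rewrite ge0_fin_numE// measure_ge0.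
- by rewrite ge0_fin_numE// ?measure_ge0//; exact: vol_U_fin.
- by apply: vol_le => // [|x []//]; exact: U_borel.
Qed.

End Integral.

Local Notation L := (ln ((@resq R K)%:R : R)).

Lemma ln_normval m : ln (normval m) = L * (m0%:R - m%:R).
Proof.
have q0 : 0 < (@resq R K)%:R :> R by exact: resq_gt0.
have lnr : ln rho = - L by rewrite /rhoK lnV ?posrE.
rewrite /normval lnM ?posrE ?invr_gt0 ?rhoX_gt0// lnV ?posrE ?rhoX_gt0// !lnXn ?rho_gt0//.
by rewrite lnr mulrBr !mulr_natr !mulNrn opprK.
Qed.

(** As [normval m] is q^(m0 - m), its power is t^(m - m0); multiplying by t^m0 avoids negative
    exponents. *)
Lemma cpow_normval m (s : R[i]) : cpow (normval m) s * qpow L s ^+ m0 = qpow L s ^+ m.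
Proof.
have -> : cpow (normval m) s = cexp ((ln (normval m))%:C * s)%C.
  rewrite /cpow /cexp /powR gt_eqF ?normval_gt0//=; case: s => a b /=.
  by rewrite !mul0r subr0 addr0 (mulrC a) (mulrC b).
rewrite !qpowX -cexpD ln_normval; congr cexp; rewrite -mulrDl; congr (_ * _).
by apply/eqP; rewrite eq_complex /= !oppr0 addr0 eqxx andbT mulrBr !mulr_natr addrAC subrr add0r.
Qed.

(** The remainder is the integral over the tail, times t^m0. Its real and imaginary parts each
    contribute one volume of U to the constant [A], and the power of [normval M] combines with t^m0
    to the rate |t|^M. *)
Lemma zeta_has_sum (s : R[i]) : 0 < complex.Re s ->
  has_sum (fun m => (fine (vol (value_set m)))%:C%C) (qpow L s)
    (zetaU mu U f s * qpow L s ^+ m0).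
Proof.
move=> s0; pose A := fine (vol U) + fine (vol U).
have U0 : 0 <= fine (vol U) by rewrite fine_ge0// vol_ge0.
have re_le u : `|complex.Re (cpow u s)| <= u `^ complex.Re s.
  by rewrite /= normrM ger0_norm ?powR_ge0// ler_piMr ?powR_ge0// cos_max.
have im_le u : `|complex.Im (cpow u s)| <= u `^ complex.Re s.
  by rewrite /= normrM ger0_norm ?powR_ge0// ler_piMr ?powR_ge0// sin_max.
exists A%:C%C; first by rewrite ler0c addr_ge0.
move=> M.
pose tl := Complex (\int[mu]_(x in value_tail M) complex.Re (cpow (normK (f x)) s))
  (\int[mu]_(x in value_tail M) complex.Im (cpow (normK (f x)) s)).
have -> : zetaU mu U f s = \sum_(m < M) cpow (normval m) s * (fine (vol (value_set m)))%:C%C + tl.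
  rewrite /zetaU (integral_partial_sum s0 re_le M) (integral_partial_sum s0 im_le M).
  rewrite /tl; set a := \int[mu]_(x in _) _; set b := \int[mu]_(x in _) _.
  apply: (@complex_sumD R M (fun m => complex.Re (cpow (normval m) s) * fine (vol (value_set m)))
    (fun m => complex.Im (cpow (normval m) s) * fine (vol (value_set m)))
    (fun m => cpow (normval m) s * (fine (vol (value_set m)))%:C%C)) => m.
  by apply/eqP; rewrite eq_complex /= !mulr0 subr0 add0r !eqxx.
have -> : (\sum_(m < M) cpow (normval m) s * (fine (vol (value_set m)))%:C%C + tl) *
  qpow L s ^+ m0 - \sum_(m < M) (fine (vol (value_set m)))%:C%C * qpow L s ^+ m =
  tl * qpow L s ^+ m0.
  rewrite mulrDl mulr_suml addrAC -sumrB big1 ?add0r// => m _.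
  by rewrite -(cpow_normval m) mulrAC [X in _ - X]mulrC subrr.
have Mnorm : (normval M `^ complex.Re s)%:C%C * `|qpow L s| ^+ m0 = `|qpow L s| ^+ M.
  rewrite -!normrX -(cpow_normval M) normrM; congr (_ * _).
  rewrite /cpow normc_def /= !exprMn -mulrDr cos2Dsin2 mulr1 sqrtr_sqr.
  by rewrite ger0_norm ?powR_ge0.
rewrite normrM normrX -Mnorm mulrA ler_wpM2r ?exprn_ge0//.
apply: le_trans (normC_le _ _) _; rewrite -rmorphM lecR /A mulrDl.
by apply: lerD; rewrite mulrC; [exact: (integral_tail s0 re_le)|exact: (integral_tail s0 im_le)].
Qed.

End ZetaSeries.

(** * The largest pole *)

Lemma is_lambda_exists (R : realType) (T : finType) (i0 : T) (N v : T -> nat) :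
  exists lam : R, is_lambda N v lam.
Proof.
case: (arg_minP (fun i => (v i)%:R / (N i)%:R : R) (erefl (predT i0))) => i _ imin.
by exists ((v i)%:R / (N i)%:R); split; [exists i|move=> j; exact: imin].
Qed.

(** * Bounds on a compact set and comparison of generators of an ideal *)

Section CompactBounds.
Context {R : realType} {K : padicFieldType R} {n : nat}.
Context {U : set 'rV[K]_n}.
Hypothesis U_compact : compact U.
Notation rho := (rhoK K).

Lemma compact_normK_bounded (l : nat) (h : 'rV[K]_n -> 'rV[K]_l) :
  (forall x, U x -> {for x, continuous h}) ->
  exists m0, forall x, U x -> normK (h x) <= rho ^- m0.
Proof.
move=> hc; have [x Ux|xs [_ xsU]] :=
    compact_finite_cover (f := fun x => h @^-1` ballK (h x) 0) U_compact.
  by apply: hc => //; exact: ballK_nbhs.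
pose C := 1 + \sum_(x <- xs) normK (h x).
have C0 : 0 < C by rewrite ltr_wpDr// sumr_ge0// => x _; exact: normK_ge0.
have Ci0 : 0 < C^-1 by rewrite invr_gt0.
have [m0 m0C] := @rhoX_small R K _ Ci0; exists m0 => x Ux.
have {m0C} : C <= rho ^- m0.
  by rewrite -[C]invrK lef_pV2 ?posrE ?rhoX_gt0// ltW.
apply: le_trans; have [y /= yxs xy] := xsU x Ux.
rewrite -[h x](subrK (h y)); apply: normKD_le.
  apply: le_trans xy _; rewrite expr0 lerDl sumr_ge0// => z _; exact: normK_ge0.
rewrite /C (perm_big _ (perm_to_rem yxs)) big_cons addrCA lerDl addr_ge0// sumr_ge0// => z _.
exact: normK_ge0.
Qed.

Lemma analytic_at_cst (a0 : K) (a : 'rV[K]_n) : analytic_at (fun=> a0) a.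
Proof.
exists (fun k => if k == [ffun=> 0%N] then a0 else 0), 1, (absK a0); split => // [k|z _].
  by rewrite expr1n mulr1; case: eqP => // _; rewrite absK0 absK_ge0.
apply: cvg_near_cst; exists 1%N => //= -[//|N] _.
rewrite (bigD1 [ffun=> ord0])//= big1 ?addr0 => [|k k0].
  rewrite ifT; first by rewrite /monomial big1 ?mulr1// => i _; rewrite !ffunE expr0.
  by apply/eqP/ffunP => i; rewrite !ffunE.
rewrite ifF ?mul0r//; apply: contra_neqF k0 => /eqP/ffunP k0.
by apply/ffunP => i; have := k0 i; rewrite !ffunE => k0i; exact/val_inj.
Qed.

Lemma ideal_on_component (l : nat) (f : 'rV[K]_n -> 'rV[K]_l) j :
  ideal_on U f (fun x => f x 0 j).
Proof.
exists (fun i _ => (i == j)%:R); split => [i x _|x _]; first exact: analytic_at_cst.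
by rewrite (bigD1 j)//= eqxx mul1r big1 ?addr0// => i /negbTE ->; rewrite mul0r.
Qed.

Lemma ideal_on_norm_le (l l' : nat) (f : 'rV[K]_n -> 'rV[K]_l) (g : 'rV[K]_n -> 'rV[K]_l') :
  ideal_on U f `<=` ideal_on U g ->
  exists a, forall x, U x -> normK (f x) <= rho ^- a * normK (g x).
Proof.
move=> fg; have /choice[al alP] : forall j, exists al : 'I_l' -> 'rV[K]_n -> K,
    (forall i x, U x -> analytic_at (al i) x) /\
    forall x, U x -> f x 0 j = \sum_i al i x * g x 0 i.
  by move=> j; have [al h] := fg _ (ideal_on_component f j); exists al.
have /choice[m mP] : forall j, exists m, forall x, U x -> normK (\row_i al j i x) <= rho ^- m.
  move=> j; apply: compact_normK_bounded => x Ux; apply: continuous_normK => i.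
  have -> : (fun y => (\row_i al j i y) 0 i) = al j i by apply/funext => y; rewrite mxE.
  by apply: analytic_continuous; apply: (alP j).1.
exists (\max_j m j)%N => x Ux; apply/normK_le.
  by rewrite mulr_ge0 ?invr_ge0 ?rhoX_ge0 ?normK_ge0.
move=> j; rewrite (alP j).2//; apply: absK_sum_le => [|i _].
  by rewrite mulr_ge0 ?invr_ge0 ?rhoX_ge0 ?normK_ge0.
rewrite absKM ler_pM ?absK_ge0 ?absK_le_normK//.
apply: le_trans (le_trans (mP j x Ux) _).
  by have := absK_le_normK (\row_i al j i x) i; rewrite mxE.
rewrite lef_pV2 ?posrE ?rhoX_gt0//; apply: rhoX_le; exact: leq_bigmax.
Qed.

End CompactBounds.

(** * The coefficients of the zeta function and its pole at - lambda *)

Section VolumesOfValues.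
Context {R : realType} {K : padicFieldType R} {n l : nat}.
Context {mu : {measure set (borelK K n) -> \bar R}}.
Hypothesis mu_haar : normalized_haar mu.
Context {U : set 'rV[K]_n} {f : 'rV[K]_n -> 'rV[K]_l}.
Hypothesis U_compact : compact U.
Hypothesis U_open : open U.
Hypothesis f_analytic : analytic_map_on U f.
Hypothesis f_nontrivial : forall W : set 'rV[K]_n, open W -> W !=set0 -> W `<=` U ->
  exists2 x, W x & f x != 0.
Context {X : @charted_space R K n} {sigma : X -> open_manifold U}.
Context {T : finType} {E : T -> set X} {N v : T -> nat}.
Hypothesis log_res : log_principalization f sigma E N v.
Context {m0 : nat}.
Hypothesis f_bound : forall x, U x -> normK (f x) <= rhoK K ^- m0.
Notation rho := (rhoK K).
Notation L := (ln ((@resq R K)%:R : R)).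

Definition value_volume m : R := fine (vol (mu := mu) (@value_set R K n l U f m0 m)).

Let c i : R := rho ^+ v i.

Lemma multiplicity_gt0 i : (0 < N i)%N.
Proof. by have [_ _ /(_ i)[]] := log_res. Qed.

Lemma discrepancy_gt0 i : (0 < v i)%N.
Proof. by have [_ _ /(_ i)[]] := log_res. Qed.

Lemma discrepancyX01 i : 0 < c i < 1.
Proof.
rewrite /c rhoX_gt0 /=; apply: le_lt_trans (rhoX_le (discrepancy_gt0 i)) _.
by rewrite expr1 rho_lt1.
Qed.

(** Since sigma is onto U, the volumes of images of levels of X are the volumes of levels in U.
    Every index occurs in a term because every divisor is non-empty. *)
Lemma value_volume_terms : exists ts : seq (R * nat * seq T),
  [/\ forall u : R * nat * seq T, u \in ts -> 0 < u.1.1,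
      is_sum_of_terms c N ts value_volume &
      forall i, exists2 u : R * nat * seq T, u \in ts & i \in u.2].
Proof.
have [ts [B0 h hE]] := good_setT mu_haar U_compact U_open f_analytic f_nontrivial log_res f_bound.
exists ts; split => // [|i].
  apply: eq_is_sum_of_terms h => m; congr (fine (vol _)); apply/seteqP; split.
    by move=> _ [x [_ xm] <-]; split => //; exact: resolve_in.
  move=> z [Uz zm]; have [x xz] := resolve_surjective U_compact U_open f_nontrivial log_res Uz.
  by exists x => //; split => //; rewrite /level /mkset xz.
have [_ _ /(_ i)[[x Eix] _ _ _] _] := log_res; exact: hE Eix _.
Qed.

Lemma resq_ln_gt0 : 0 < L. Proof. by rewrite ln_gt0// resq_gt1R. Qed.

Lemma rho_expR : rho = expR (- L).
Proof. by rewrite expRN lnK ?posrE ?resq_gt0. Qed.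

(** At t = q^(-x) the product q^(-v) t^N is q^(-(v + x N)); its position relative to 1 is thus
    decided by comparing - x with v/N. *)
Lemma discrepancyX_expR (x : R) i :
  c i * expR (- (L * x)) ^+ N i = expR (- (L * ((v i)%:R + x * (N i)%:R))).
Proof.
rewrite /c rho_expR -!expRM_natl -expRD; congr expR; ring.
Qed.

Lemma small_power (t : R[i]) : `|t| < 1 -> forall e : R[i], 0 < e -> exists M, `|t| ^+ M < e.
Proof.
move=> t1 e e0.
have [a aE] : exists a : R, `|t| = a%:C%C by rewrite normc_def; eexists.
have [b bE] : exists b : R, e = b%:C%C.
  exists (complex.Re e); case: e e0 => x y /=; rewrite ltcE /= => /andP[/eqP -> _].
  by [].
have a0 : 0 <= a by rewrite -lecR -aE normr_ge0.
have a1 : a < 1 by rewrite -ltcR -aE.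
have b0 : 0 < b by rewrite -ltcR -bE.
have /cvgrPdist_lt/(_ _ b0) : (fun k => a ^+ k) @ \oo --> (0:R).
  by apply: cvg_expr; rewrite ger0_norm.
case=> k _ /(_ k (leqnn k)) /=; rewrite sub0r normrN ger0_norm ?exprn_ge0// => h.
by exists k; rewrite aE bE -rmorphXn ltcR.
Qed.

Lemma norm_qpow (s : R[i]) : `|qpow L s| = (expR (- (L * complex.Re s)))%:C%C.
Proof.
by rewrite norm_cexp; case: s => a b /=; rewrite oppr0 mul0r subr0 mulNr.
Qed.

Lemma zeta_pole : f 0 = 0 -> U 0 -> exists2 lam : R, is_lambda N v lam &
  exists2 M : R[i] -> R[i], meromorphic_continuation (zetaU mu U f) M &
    exists2 s0 : R[i], is_pole M s0 & complex.Re s0 = - lam.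
Proof.
move=> f0 U0; have [i1 _] := index_exists U_compact U_open f_nontrivial log_res f0 U0.
have [lam lamP] := @is_lambda_exists R T i1 N v; exists lam => //.
have [[i0 lamE] lam_le] := lamP.
have [ts [ts_gt0 h tsE]] := value_volume_terms.
have [u0 u0ts i0u0] := tsE i0.
have ts0 : ts != [::] by apply: contraTneq u0ts => ->.
pose S s := \sum_(u <- ts) term_value c N u (qpow L s).
(* This undoes the shift by m0; being holomorphic without zeros, it changes no pole. *)
pose Q s := (qpow L s ^+ m0)^-1.
have Q0 s : qpow L s ^+ m0 != 0 by rewrite expf_neq0// cexp_neq0.
have Qhol s : holomorphic_at Q s by apply: holomorphicV; [exact: holomorphic_qpowX|].
exists (fun s => Q s * S s); first split.
- move=> s; have [m [w hS]] := pole_sum_of_terms c resq_ln_gt0 multiplicity_gt0 ts s.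
  exact: pole_order_meromorphic (pole_orderM (pole_order_holomorphic (Qhol s)) hS).
(* For Re s > 0 one has |t| < 1, and t^m0 Z_U and [S] are sums of the same power series. *)
- move=> s s0; apply: (mulfI (Q0 s)); rewrite /Q mulVKf// mulrC.
  have t1 : `|qpow L s| < 1.
    by rewrite norm_qpow -(rmorph1 (@real_complex R)) ltcR expR_lt1 oppr_lt0 mulr_gt0// resq_ln_gt0.
  apply: (@has_sum_unique _ (fun m => (value_volume m)%:C%C) (qpow L s)).
  + by rewrite normr_gt0 cexp_neq0.
  + exact: small_power.
  + exact: (has_sum_sum_of_terms discrepancyX01 multiplicity_gt0 t1 h).
  exact: (zeta_has_sum mu_haar U_compact U_open f_analytic f_bound s0).
exists (- lam)%:C%C => //.
have cE i : c i * expR (- (L * - lam)) ^+ N i = expR (- (L * ((v i)%:R - lam * (N i)%:R))).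
  by rewrite discrepancyX_expR mulNr.
have N0 i : 0 < (N i)%:R :> R by rewrite ltr0n multiplicity_gt0.
(* The minimality of lambda, in the form v_i - lambda N_i >= 0. *)
have ctau i : c i * expR (- (L * - lam)) ^+ N i <= 1.
  rewrite cE expR_le1 oppr_le0 mulr_ge0 ?(ltW resq_ln_gt0)// subr_ge0.
  by rewrite -ler_pdivlMr.
have [m [w [hS w0 hm]]] := pole_sum_of_terms_real resq_ln_gt0 multiplicity_gt0 ctau ts_gt0 ts0.
apply: (@pole_orderP _ _ _ (0 + m) (Q (- lam)%:C%C * w)); last first.
- exact: pole_orderM (pole_order_holomorphic (Qhol _)) hS.
- by rewrite mulf_neq0 ?invr_eq0 ?Q0// gt_eqF.
(* The index [i0] attains the minimum, so its factor is singular and the pole has positive order. *)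
apply: (hm u0 i0) => //; rewrite cE lamE divfK ?gt_eqF//.
by rewrite subrr mulr0 oppr0 expR0.
Qed.

End VolumesOfValues.

(** * Independence of the generators and of the log-principalization *)

Section Comparison.
Context {R : realType} {K : padicFieldType R} {n l l' : nat}.
Context {mu : {measure set (borelK K n) -> \bar R}}.
Hypothesis mu_haar : normalized_haar mu.
Context {U : set 'rV[K]_n} {f : 'rV[K]_n -> 'rV[K]_l} {g : 'rV[K]_n -> 'rV[K]_l'}.
Hypothesis U_compact : compact U.
Hypothesis U_open : open U.
Hypothesis f_analytic : analytic_map_on U f.
Hypothesis f_nontrivial : forall W : set 'rV[K]_n, open W -> W !=set0 -> W `<=` U ->
  exists2 x, W x & f x != 0.
Hypothesis g_analytic : analytic_map_on U g.
Hypothesis g_nontrivial : forall W : set 'rV[K]_n, open W -> W !=set0 -> W `<=` U ->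
  exists2 x, W x & g x != 0.
Context {X : @charted_space R K n} {sigma : X -> open_manifold U}.
Context {T : finType} {E : T -> set X} {N v : T -> nat}.
Hypothesis f_res : log_principalization f sigma E N v.
Context {X' : @charted_space R K n} {sigma' : X' -> open_manifold U}.
Context {T' : finType} {E' : T' -> set X'} {N' v' : T' -> nat}.
Hypothesis g_res : log_principalization g sigma' E' N' v'.
Variables m0 a : nat.
Notation rho := (rhoK K).
Notation L := (ln ((@resq R K)%:R : R)).
Hypothesis f_bound : forall x, U x -> normK (f x) <= rho ^- m0.
Hypothesis g_bound : forall x, U x -> normK (g x) <= rho ^- m0.
Hypothesis fg : forall x, U x -> normK (f x) <= rho ^- a * normK (g x).
Hypothesis gf : forall x, U x -> normK (g x) <= rho ^- a * normK (f x).
Local Notation Vf := (@value_volume R K n l mu U f m0).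
Local Notation Vg := (@value_volume R K n l' mu U g m0).

(** The two inequalities between the norms say that the exponents of f(x) and g(x) differ by at most
    a; f does not vanish where g does not. *)
Lemma value_volume_compare m :
  Vg m <= \sum_(j < (m + a).+1 | (m <= j + a)%N) Vf j.
Proof.
pose F j := @value_set R K n l U f m0 j.
have mF j : borel_set (F j) by exact: value_set_borel.
have mG : borel_set (@value_set R K n l' U g m0 m) by exact: value_set_borel.
have finF j : (vol (mu := mu) (F j) < +oo)%E.
  apply: le_lt_trans (vol_fin mu_haar U_compact); apply: vol_le => //; first exact: open_borel.
  by move=> x [].
have finG : (vol (mu := mu) (@value_set R K n l' U g m0 m) < +oo)%E.
  apply: le_lt_trans (vol_fin mu_haar U_compact); apply: vol_le => //; first exact: open_borel.
  by move=> x [].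
have sub : @value_set R K n l' U g m0 m `<=`
    \bigcup_(j in [set` [seq j <- index_iota 0 (m + a).+1 | (m <= j + a)%N]]) F j.
  move=> x [Ux gx]; have gx0 : g x != 0 by rewrite -normK_gt0 gx normval_gt0.
  have fx0 : f x != 0.
    rewrite -normK_gt0 in gx0 *; have := lt_le_trans gx0 (gf Ux).
    by rewrite pmulr_rgt0 ?invr_gt0 ?rhoX_gt0// normK_gt0.
  have [j fj] := normK_normval f_bound Ux fx0.
  have := fg Ux; have := gf Ux; rewrite gx fj ![rho ^- a * _]mulrC !ler_pdivlMr ?rhoX_gt0//.
  rewrite -!normvalD !normval_le => jm mj.
  by exists j => //; rewrite /mkset mem_filter mj mem_index_iota ltnS.
have := vol_seq_le (mu := mu) mG mF sub; rewrite big_filter big_mkord => h.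
rewrite /value_volume -lee_fin fineK ?ge0_fin_numE ?vol_ge0//.
rewrite -sumEFin; apply: le_trans h _; apply: lee_sum => j _.
by rewrite fineK// ge0_fin_numE ?vol_ge0.
Qed.

(** Suppose lam' < x < lam and take tau = q^x. The sums of the volumes for f weighted by tau^m are
    bounded, hence so are the weighted volumes for g; but along the progression attached to [i0] the
    latter grow geometrically. *)
Lemma lambda_le (lam lam' : R) : is_lambda N v lam -> is_lambda N' v' lam' -> lam <= lam'.
Proof.
move=> [_ lam_le] [[i0 lamE] _]; rewrite leNgt; apply/negP => lt.
pose x := (lam + lam') / 2.
have x_lt : x < lam by rewrite /x; lra.
have x_gt : lam' < x by rewrite /x; lra.
have N'0 i : 0 < (N' i)%:R :> R by rewrite ltr0n (multiplicity_gt0 g_res).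
have N0 i : 0 < (N i)%:R :> R by rewrite ltr0n (multiplicity_gt0 f_res).
(* This gives tau >= 1, by which tau^m is at most tau^(j + a) when m <= j + a. *)
have x0 : 0 <= x by apply: le_trans (ltW x_gt); rewrite lamE divr_ge0.
pose tau := expR (- (L * - x)).
have tau0 : 0 < tau by exact: expR_gt0.
have tau1 : 1 <= tau by rewrite -expR0 ler_expR mulrN opprK mulr_ge0// ltW// resq_ln_gt0.
have ctau i : rho ^+ v i * tau ^+ N i < 1.
  rewrite /tau discrepancyX_expR expR_lt1 oppr_lt0 mulr_gt0 ?resq_ln_gt0// mulNr subr_gt0.
  by rewrite -ltr_pdivlMr// (lt_le_trans x_lt).
have ctau' : 1 < rho ^+ v' i0 * tau ^+ N' i0.
  rewrite /tau discrepancyX_expR expR_gt1 oppr_gt0 pmulr_rlt0 ?resq_ln_gt0// mulNr subr_lt0.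
  by rewrite -ltr_pdivrMr// -lamE.
have [ts [ts_gt0 hf _]] :=
  value_volume_terms mu_haar U_compact U_open f_analytic f_nontrivial f_res f_bound.
have [ts' [ts'_gt0 hg ts'E]] :=
  value_volume_terms mu_haar U_compact U_open g_analytic g_nontrivial g_res g_bound.
have [u uts i0u] := ts'E i0.
have [D DP] := sum_of_terms_bounded (discrepancyX01 f_res) (multiplicity_gt0 f_res)
  (fun t h => ltW (ts_gt0 t h)) tau0 ctau hf.
have Vf0 j : 0 <= Vf j by rewrite fine_ge0// vol_ge0.
have upper m : Vg m * tau ^+ m <= tau ^+ a * D.
  apply: le_trans (ler_wpM2r _ (value_volume_compare m)) _; first by rewrite exprn_ge0// ltW.
  apply: le_trans (ler_wpM2l _ (DP (m + a).+1)); last by rewrite exprn_ge0// ltW.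
  rewrite mulr_suml mulr_sumr big_mkcond /=; apply: ler_sum => j _.
  case: ifP => mj; last by rewrite !mulr_ge0 ?exprn_ge0// ltW.
  by rewrite mulrCA -exprD ler_wpM2l// ler_weXn2l// addnC.
have lower e : u.1.1 * tau ^+ u.1.2 * (rho ^+ v' i0 * tau ^+ N' i0) ^+ e <= tau ^+ a * D.
  apply: le_trans (upper (u.1.2 + N' i0 * e)%N).
  have := sum_of_terms_lower_bound (discrepancyX01 g_res) (multiplicity_gt0 g_res) e
    (fun t h => ltW (ts'_gt0 t h)) hg uts i0u.
  rewrite exprMn exprD exprM mulrACA => h; apply: ler_wpM2r => //.
  by rewrite mulr_ge0// !exprn_ge0// ltW.
have B0 : 0 < u.1.1 * tau ^+ u.1.2 by rewrite mulr_gt0 ?exprn_gt0// ts'_gt0.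
(* The inverse of the growth ratio; the convergence of its powers to 0 contradicts [lower]. *)
pose z := (rho ^+ v' i0 * tau ^+ N' i0)^-1.
have z01 : 0 < z < 1 by rewrite invr_gt0 invf_lt1 ?ctau' ?(lt_trans _ ctau').
have D0 : 0 < tau ^+ a * D by apply: lt_le_trans (lower 0%N); rewrite expr0 mulr1.
have e0 : 0 < u.1.1 * tau ^+ u.1.2 / (tau ^+ a * D) by rewrite divr_gt0.
have /cvgrPdist_lt/(_ _ e0) : (fun k => z ^+ k) @ \oo --> (0:R).
  by case/andP: z01 => z0 z1; apply: cvg_expr; rewrite gtr0_norm.
case=> k _ /(_ k (leqnn k)) /=; rewrite sub0r normrN ger0_norm; last first.
  by rewrite exprn_ge0//; case/andP: z01 => /ltW.
have zk0 : 0 < (rho ^+ v' i0 * tau ^+ N' i0) ^+ k by rewrite exprn_gt0// (lt_trans _ ctau').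
by rewrite ltr_pdivlMr// mulrC exprVn ltr_pdivrMr// ltNge lower.
Qed.

End Comparison.

(** * The pole at - lambda, and lambda as an invariant of the ideal *)

Theorem theorem2p7 (R : realType) (K : padicFieldType R) (n l : nat)
  (mu : {measure set (borelK K n) -> \bar R}) (mu_haar : normalized_haar mu)
  (U : set 'rV[K]_n) (U_compact : compact U) (U_open : open U) (U0 : U 0)
  (f : 'rV[K]_n -> 'rV[K]_l) (f_analytic : analytic_map_on U f) (f0 : f 0 = 0)
  (f_nontrivial : forall W : set 'rV[K]_n, open W -> W !=set0 -> W `<=` U ->
     exists2 x, W x & f x != 0) :
  (forall (X : charted_space n) (sigma : X -> open_manifold U)
     (T : finType) (E : T -> set X) (N v : T -> nat),
     log_principalization f sigma E N v ->
     exists2 lam : R, is_lambda N v lam &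
       exists2 M : R[i] -> R[i], meromorphic_continuation (zetaU mu U f) M &
         exists2 s0 : R[i], is_pole M s0 & complex.Re s0 = - lam)
  /\
  (forall (l' : nat) (g : 'rV[K]_n -> 'rV[K]_l'),
     analytic_map_on U g -> ideal_on U g = ideal_on U f ->
     forall (X : charted_space n) (sigma : X -> open_manifold U)
       (T : finType) (E : T -> set X) (N v : T -> nat)
       (X' : charted_space n) (sigma' : X' -> open_manifold U)
       (T' : finType) (E' : T' -> set X') (N' v' : T' -> nat) (lam lam' : R),
     log_principalization f sigma E N v ->
     log_principalization g sigma' E' N' v' ->
     is_lambda N v lam -> is_lambda N' v' lam' -> lam = lam').
Proof.
split.
  move=> X sigma T E N v res.
  have [m0 f_bound] := compact_normK_bounded U_compact
    (fun x Ux => f_continuous f_analytic Ux).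
  exact: (zeta_pole mu_haar U_compact U_open f_analytic f_nontrivial res f_bound).
move=> l' g g_analytic gf X sigma T E N v X' sigma' T' E' N' v' lam lam' f_res g_res lamP lamP'.
have [a fg_le] : exists a, forall x, U x -> normK (f x) <= rhoK K ^- a * normK (g x).
  by apply: (ideal_on_norm_le U_compact); rewrite gf.
have [a' gf_le] : exists a, forall x, U x -> normK (g x) <= rhoK K ^- a * normK (f x).
  by apply: (ideal_on_norm_le U_compact); rewrite gf.
have [m f_bound] := compact_normK_bounded U_compact (fun x Ux => f_continuous f_analytic Ux).
have [m' g_bound] := compact_normK_bounded U_compact (fun x Ux => f_continuous g_analytic Ux).
(* A common shift and a common constant for f and g make the comparison symmetric, so that it gives
   both inequalities. *)
have rhoV_le i j : (i <= j)%N -> rhoK K ^- i <= rhoK K ^- j.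
  by move=> ij; rewrite lef_pV2 ?posrE ?rhoX_gt0//; exact: rhoX_le.
have f_bound' x : U x -> normK (f x) <= rhoK K ^- maxn m m'.
  by move=> /f_bound/le_trans; apply; apply: rhoV_le; exact: leq_maxl.
have g_bound' x : U x -> normK (g x) <= rhoK K ^- maxn m m'.
  by move=> /g_bound/le_trans; apply; apply: rhoV_le; exact: leq_maxr.
have fg_le' x : U x -> normK (f x) <= rhoK K ^- maxn a a' * normK (g x).
  move=> /fg_le/le_trans; apply; rewrite ler_wpM2r ?normK_ge0//.
  by apply: rhoV_le; exact: leq_maxl.
have gf_le' x : U x -> normK (g x) <= rhoK K ^- maxn a a' * normK (f x).
  move=> /gf_le/le_trans; apply; rewrite ler_wpM2r ?normK_ge0//.
  by apply: rhoV_le; exact: leq_maxr.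
(* A point where f does not vanish is one where g does not, as the norm of f is at most a multiple
   of that of g. *)
have g_nontrivial (W : set 'rV[K]_n) : open W -> W !=set0 -> W `<=` U ->
    exists2 x, W x & g x != 0.
  move=> oW W0 WU; have [x Wx fx] := f_nontrivial W oW W0 WU; exists x => //.
  rewrite -normK_gt0 in fx; have := lt_le_trans fx (fg_le x (WU x Wx)).
  by rewrite pmulr_rgt0 ?invr_gt0 ?rhoX_gt0// normK_gt0.
apply/le_anti/andP; split.
  exact: (lambda_le mu_haar U_compact U_open f_analytic f_nontrivial g_analytic g_nontrivial
    f_res g_res f_bound' g_bound' fg_le' gf_le').
exact: (lambda_le mu_haar U_compact U_open g_analytic g_nontrivial f_analytic f_nontrivial
  g_res f_res g_bound' f_bound' gf_le' fg_le').
Qed.
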